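(* Consider the piecewise vector field $X_\varepsilon$ below and the function $f_1(r)=a_1\int_0^{\pi}f(r\cos\phi,r\sin\phi)\cos\phi\,d\phi+b_1\int_\pi^{2\pi}f(r\cos\phi,r\sin\phi)\sin\phi\,d\phi$. For each $r^*>0$ with $f_1(r^* )=0$ and $f_1'(r^* )\neq0$, for $|\varepsilon|\neq0$ sufficiently small $X_\varepsilon$ has a crossing limit cycle $\varphi(t,\varepsilon)$ of period $T_\varepsilon=2\pi+\mathcal O(\varepsilon)$ with $\varphi(0,\varepsilon)=(r^*,0,f(r^*,0))+\mathcal O(\varepsilon)$; as $\varepsilon\to0$ it tends to the periodic orbit $\{(x,y,f(x,y)):x^2+y^2=(r^* )^2\}$ of $X_0$.
   Context: Let $f:\mathbb R^2\to\mathbb R$ be smooth ($C^\infty$) and $g(x,y)=f(x,y)+x\,\partial_yf(x,y)-y\,\partial_xf(x,y)$. Let $a_0,a_1,a_2,a_3,b_1,b_2,b_3\in\mathbb R$. The piecewise smooth vector field on $\mathbb R^3$ is $X_\varepsilon=X_\varepsilon^+$ for $y>0$, $X_\varepsilon=X_\varepsilon^-$ for $y<0$, with $X_\varepsilon^+(x,y,z)=\big(-y+\varepsilon(a_0+a_1z)+\varepsilon^2(a_2+a_3z),\ x,\ -z+g(x,y)\big)$ and $X_\varepsilon^-(x,y,z)=\big(-y,\ x+\varepsilon b_1z+\varepsilon^2(b_2+b_3z),\ -z+g(x,y)\big)$; discontinuity set $\Sigma=\{y=0\}$, with trajectories defined by Filippov's convention (near the orbits considered, they cross $\Sigma$ transversally,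 obtained by concatenation). For $\varepsilon=0$ the surface $z=f(x,y)$ is invariant and foliated by the periodic orbits $x^2+y^2=r^2$. A crossing limit cycle is an isolated periodic orbit crossing $\Sigma$. *)

(* Defs.v *)
From Stdlib Require Import Reals Lra.
Open Scope R_scope.

Definition R3 : Type := (R * R * R)%type.
Definition p1 (p : R3) : R := fst (fst p).
Definition p2 (p : R3) : R := snd (fst p).
Definition p3 (p : R3) : R := snd p.

Definition dist3 (p q : R3) : R :=
  sqrt ((p1 p - p1 q)^2 + (p2 p - p2 q)^2 + (p3 p - p3 q)^2).

Definition cont2 (F : R -> R -> R) : Prop :=
  forall x y eps, 0 < eps -> exists del, 0 < del /\
    forall u v, (u - x)^2 + (v - y)^2 < del^2 -> Rabs (F u v - F x y) < eps.

Definition is_dx (F Fx : R -> R -> R) : Prop :=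
  forall x y, derivable_pt_lim (fun u => F u y) x (Fx x y).
Definition is_dy (F Fy : R -> R -> R) : Prop :=
  forall x y, derivable_pt_lim (fun v => F x v) y (Fy x y).

(* C^infty on R^2: continuous, with partial derivatives everywhere which are
   themselves C^infty (all iterated partials exist and are continuous). *)
CoInductive smooth2 (F : R -> R -> R) : Prop :=
  smooth2_intro : forall Fx Fy : R -> R -> R,
    is_dx F Fx -> is_dy F Fy -> cont2 F -> smooth2 Fx -> smooth2 Fy -> smooth2 F.

Definition gfun (f fx fy : R -> R -> R) (x y : R) : R :=
  f x y + x * fy x y - y * fx x y.

Definition Xplus (f fx fy : R -> R -> R) (a0 a1 a2 a3 e : R) (p : R3) : R3 :=
  let x := p1 p in let y := p2 p in let z := p3 p in
  (-y + e * (a0 + a1 * z) + e^2 * (a2 + a3 * z), x, - z + gfun f fx fy x y).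

Definition Xminus (f fx fy : R -> R -> R) (b1 b2 b3 e : R) (p : R3) : R3 :=
  let x := p1 p in let y := p2 p in let z := p3 p in
  (-y, x + e * b1 * z + e^2 * (b2 + b3 * z), - z + gfun f fx fy x y).

(* A trajectory of the discontinuous field (Xp on y>0, Xm on y<0) in the
   crossing regime of Filippov's convention: continuous concatenation of
   solutions of Xp and Xm, meeting Sigma={y=0} only at isolated instants,
   where the crossing is transversal (Xp_y * Xm_y > 0). *)
Definition traj (Xp Xm : R3 -> R3) (phi : R -> R3) : Prop :=
  (forall t, continuity_pt (fun s => p1 (phi s)) t /\
             continuity_pt (fun s => p2 (phi s)) t /\
             continuity_pt (fun s => p3 (phi s)) t) /\
  (forall t, 0 < p2 (phi t) ->
     derivable_pt_lim (fun s => p1 (phi s)) t (p1 (Xp (phi t))) /\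
     derivable_pt_lim (fun s => p2 (phi s)) t (p2 (Xp (phi t))) /\
     derivable_pt_lim (fun s => p3 (phi s)) t (p3 (Xp (phi t)))) /\
  (forall t, p2 (phi t) < 0 ->
     derivable_pt_lim (fun s => p1 (phi s)) t (p1 (Xm (phi t))) /\
     derivable_pt_lim (fun s => p2 (phi s)) t (p2 (Xm (phi t))) /\
     derivable_pt_lim (fun s => p3 (phi s)) t (p3 (Xm (phi t)))) /\
  (forall t, p2 (phi t) = 0 ->
     0 < p2 (Xp (phi t)) * p2 (Xm (phi t)) /\
     exists del, 0 < del /\ forall s, 0 < Rabs (s - t) < del -> p2 (phi s) <> 0).

Definition periodic_sol (Xp Xm : R3 -> R3) (phi : R -> R3) (T : R) : Prop :=
  traj Xp Xm phi /\ 0 < T /\ (forall t, phi (t + T) = phi t) /\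
  (forall s, 0 < s < T -> phi s <> phi 0).

Definition crossing_limit_cycle (Xp Xm : R3 -> R3) (phi : R -> R3) (T : R) : Prop :=
  periodic_sol Xp Xm phi T /\
  (exists t, p2 (phi t) = 0) /\
  exists del, 0 < del /\
    forall (psi : R -> R3) (S : R), periodic_sol Xp Xm psi S ->
      (forall t, exists u, dist3 (psi t) (phi u) < del) ->
      (forall t, exists u, psi t = phi u) /\ (forall u, exists t, phi u = psi t).

Definition is_f1 (f : R -> R -> R) (a1 b1 : R) (F1 : R -> R) : Prop :=
  forall r,
    exists (pr1 : Riemann_integrable
              (fun t => f (r * cos t) (r * sin t) * cos t) 0 PI)
           (pr2 : Riemann_integrable
              (fun t => f (r * cos t) (r * sin t) * sin t) PI (2 * PI)),
      F1 r = a1 * RiemannInt pr1 + b1 * RiemannInt pr2.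

Definition circ (f : R -> R -> R) (r th : R) : R3 :=
  (r * cos th, r * sin th, f (r * cos th) (r * sin th)).

(* Main.v *)
(** In the coordinates [x = r cos theta], [y = r sin theta], [w = z - f(x, y)] the field becomes
    [dr/dtheta = e G], [dw/dtheta = - w + e W], where [G] and [W] switch at [theta = 0, PI] and are
    Lipschitz in [(theta, r, w)] near [r = rs], [w = 0]. At [e = 0], [w = 0] the mean of [G] over a
    turn is [F1 r / (2 PI)].

    Existence: a periodic solution is a fixed point of the map which integrates the right-hand
    sides along [r = rho + e v], [w = e u] and corrects [rho] by minus the integral of [G] over a
    turn divided by [F1' rs]; in a weighted norm this is a contraction for small [e]. Inverting
    the time [t = \int dtheta / theta'] turns the solution into a periodic trajectory.

    Isolation: along any periodic trajectory in a thin tube, compare [r] and [w] with the values of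
    the cycle at the same angle. Where [|Dw|] is maximal the damping gives [|Dw| = O(e max |Dr|)].
    Multiplying [Dr] by [1 - e B], with [B] a primitive of the oscillating part of the linearized
    [G], leaves an equation with constant nonzero principal coefficient, so [|Dr|] has no positive
    maximum. No winding number is needed, since everything is a periodic function of time. *)

Require Import Defs.
From Stdlib Require Import Reals ZArith Lra Lia ClassicalEpsilon.
From Coquelicot Require Import Coquelicot.
Open Scope R_scope.

(** The shape of the contraction comes from an asymmetric coupling. The mean radius is corrected
    through a division by [F1' rs], and in this correction the influence of [v] and [u] is of the
    same order in [e] as the mean itself, because [G] depends on [w] and on the oscillation of [r]
    with coefficients of order one. No power of [e] removes it. The influence of the mean on [v] and
    [u], in contrast, gains a factor [e]. The coupling is thus triangular up to [O(e)], and a small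
    weight [M] on [v] and [u], fixed before [e], makes the whole map contract. Working with integral
    equations rather than with a return map turns the jump of the field at Sigma into a mere change
    of integrand at [PI]. Isolation has to exclude rival orbits of every period, including those
    closing up only after many turns, so uniqueness of a fixed point of one turn would not settle
    it. A maximum principle in time is blind to the number of turns. *)

Definition clamp (a b x : R) : R := Rmax a (Rmin b x).

Lemma clamp_lip a b x y : Rabs (clamp a b x - clamp a b y) <= Rabs (x - y).
Proof.
  unfold clamp, Rmax, Rmin.
  repeat destruct Rle_dec; unfold Rabs; repeat destruct Rcase_abs; lra.
Qed.

Lemma clamp_in a b x : a <= b -> a <= clamp a b x <= b.
Proof. intros H; unfold clamp, Rmax, Rmin; repeat destruct Rle_dec; lra. Qed.

Lemma clamp_id a b x : a <= x <= b -> clamp a b x = x.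
Proof. intros H; unfold clamp, Rmax, Rmin; repeat destruct Rle_dec; lra. Qed.

(** * Continuity and geometric limits on the real line *)

Lemma continuous_eps (f : R -> R) (x : R) :
  continuous f x <->
  forall eps, 0 < eps -> exists del, 0 < del /\
    forall y, Rabs (y - x) < del -> Rabs (f y - f x) < eps.
Proof.
  split.
  - intros H eps Heps.
    destruct (proj1 (filterlim_locally f (f x)) H (mkposreal eps Heps)) as [d Hd].
    exists d; split; [apply cond_pos|].
    intros y Hy; apply (Hd y); exact Hy.
  - intros H; apply filterlim_locally; intros [eps Heps].
    destruct (H eps Heps) as [d [Hd Hy]].
    exists (mkposreal d Hd); intros y Hb; apply (Hy y); exact Hb.
Qed.

Lemma lipschitz_continuous (f : R -> R) (K : R) :
  (forall x y, Rabs (f x - f y) <= K * Rabs (x - y)) -> forall x, continuous f x.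
Proof.
  intros H x; apply continuous_eps; intros eps Heps.
  assert (HK : 0 <= K).
  { generalize (H 1 0) (Rabs_pos (f 1 - f 0)). replace (1 - 0) with 1 by ring.
    rewrite Rabs_R1; lra. }
  exists (eps / (K + 1)); split; [apply Rdiv_lt_0_compat; lra|].
  intros y Hy. apply Rle_lt_trans with (1 := H y x).
  apply Rle_lt_trans with ((K + 1) * Rabs (y - x)).
  - generalize (Rabs_pos (y - x)); nra.
  - apply Rlt_le_trans with ((K + 1) * (eps / (K + 1))).
    + apply Rmult_lt_compat_l; lra.
    + right; field; lra.
Qed.

Lemma continuous_const_plus (f : R -> R) (c x : R) :
  continuous f x -> continuous (fun t => c + f t) x.
Proof.
  intros H. apply (@continuous_plus R_UniformSpace R_AbsRing R_NormedModule (fun _ => c) f);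
    [apply continuous_const|exact H].
Qed.

Lemma continuous_const_mult (f : R -> R) (c x : R) :
  continuous f x -> continuous (fun t => c * f t) x.
Proof.
  intros H. apply (@continuous_scal_r R_UniformSpace R_AbsRing R_NormedModule c f); exact H.
Qed.

Lemma is_derive_const_plus (f : R -> R) (c x l : R) :
  is_derive f x l -> is_derive (fun t => c + f t) x l.
Proof.
  intros H. replace l with (0 + l) by ring.
  apply (@is_derive_plus R_AbsRing R_NormedModule (fun _ => c) f); [|exact H].
  apply (@is_derive_const R_AbsRing).
Qed.

Lemma clamp_continuous a b x : continuous (clamp a b) x.
Proof.
  revert x; apply (lipschitz_continuous _ 1); intros x y.
  generalize (clamp_lip a b x y); lra.
Qed.

Lemma uniform_limit_continuous (u : nat -> R -> R) (l : R -> R) (b : nat -> R) :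
  (forall n x, continuous (u n) x) ->
  (forall n x, Rabs (u n x - l x) <= b n) -> is_lim_seq b 0 ->
  forall x, continuous l x.
Proof.
  intros Hu Hb Hl x; apply continuous_eps; intros eps Heps.
  assert (H3 : 0 < eps / 3) by lra.
  destruct (proj2 (is_lim_seq_spec _ _) Hl (mkposreal _ H3)) as [N HN]; simpl in HN.
  generalize (HN N (Nat.le_refl N)); intros HbN.
  assert (HbN' : b N < eps / 3).
  { generalize (Rle_abs (b N - 0)); lra. }
  destruct (proj1 (continuous_eps _ _) (Hu N x) _ H3) as [d [Hd Hy]].
  exists d; split; [exact Hd|]. intros y Hyd.
  generalize (Hy y Hyd) (Hb N x) (Hb N y); intros A B C.
  replace (l y - l x) with (- (u N y - l y) + (u N y - u N x) + (u N x - l x)) by ring.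
  apply Rle_lt_trans with (Rabs (u N y - l y) + Rabs (u N y - u N x) + Rabs (u N x - l x)).
  - apply Rle_trans with (1 := Rabs_triang _ _).
    apply Rplus_le_compat_r. apply Rle_trans with (1 := Rabs_triang _ _).
    rewrite Rabs_Ropp; lra.
  - lra.
Qed.

(** The subtracted tail makes the induction close: one more increment costs [D * (/ 2) ^ m], exactly
    the drop of [2 * D * (/ 2) ^ m] when [m] grows by one. *)
Lemma geometric_increments_sum (x : nat -> R) (D : R) :
  (forall n, Rabs (x (S n) - x n) <= D * (/ 2) ^ n) ->
  forall n m, (n <= m)%nat -> Rabs (x m - x n) <= 2 * D * (/ 2) ^ n - 2 * D * (/ 2) ^ m.
Proof.
  intros H n m Hnm; induction Hnm as [|m Hnm IH].
  - rewrite Rminus_eq_0, Rabs_R0; lra.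
  - replace (x (S m) - x n) with ((x (S m) - x m) + (x m - x n)) by ring.
    apply Rle_trans with (1 := Rabs_triang _ _).
    generalize (H m) IH; simpl; lra.
Qed.

Lemma half_pow_pos n : 0 < (/ 2) ^ n.
Proof. apply pow_lt; lra. Qed.

Lemma is_lim_seq_half_pow C : is_lim_seq (fun n => C * (/ 2) ^ n) 0.
Proof.
  replace (Finite 0) with (Rbar_mult C 0) by (simpl; f_equal; ring).
  apply is_lim_seq_scal_l. apply is_lim_seq_geom. rewrite Rabs_pos_eq; lra.
Qed.

Lemma le_of_half_pow (x C : R) : (forall n, x <= C * (/ 2) ^ n) -> x <= 0.
Proof.
  intros H.
  apply (is_lim_seq_le (fun _ => x) (fun n => C * (/ 2) ^ n) x 0 H).
  - apply is_lim_seq_const.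
  - apply is_lim_seq_half_pow.
Qed.

Lemma geometric_increments_limit (x : nat -> R) (D : R) :
  (forall n, Rabs (x (S n) - x n) <= D * (/ 2) ^ n) ->
  forall n, Rabs (x n - real (Lim_seq x)) <= 2 * D * (/ 2) ^ n.
Proof.
  intros H n.
  assert (HD : 0 <= D).
  { generalize (H 0%nat) (Rabs_pos (x 1%nat - x 0%nat)); simpl; lra. }
  assert (Hc : ex_finite_lim_seq x).
  { apply ex_lim_seq_cauchy_corr. intros eps.
    assert (He : 0 < eps) by apply cond_pos.
    (* [x p] and [x q] are both within [2 * D * (/ 2) ^ N] of [x N], hence the factor 4. *)
    destruct (proj2 (is_lim_seq_spec _ _) (is_lim_seq_half_pow (4 * D)) eps) as [N HN].
    exists N; intros p q Hp Hq.
    generalize (geometric_increments_sum x D H N p Hp)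
      (geometric_increments_sum x D H N q Hq) (HN N (Nat.le_refl N)); intros A B C.
    generalize (half_pow_pos p) (half_pow_pos q) (half_pow_pos N); intros.
    rewrite Rminus_0_r, Rabs_pos_eq in C by nra.
    replace (x p - x q) with ((x p - x N) + - (x q - x N)) by ring.
    apply Rle_lt_trans with (1 := Rabs_triang _ _). rewrite Rabs_Ropp. nra. }
  destruct Hc as [l Hl]. rewrite (is_lim_seq_unique _ _ Hl); simpl.
  rewrite Rabs_minus_sym.
  apply (is_lim_seq_le_loc (fun m => Rabs (x m - x n)) (fun _ => 2 * D * (/ 2) ^ n)
           (Rabs (l - x n)) (2 * D * (/ 2) ^ n)).
  - exists n; intros m Hm. generalize (geometric_increments_sum x D H n m Hm) (half_pow_pos m); nra.
  - apply (is_lim_seq_abs (fun m => x m - x n) (Finite (l - x n))).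
    apply (is_lim_seq_minus' _ _ l (x n)); [exact Hl|apply is_lim_seq_const].
  - apply is_lim_seq_const.
Qed.

(** * Integrals with an integrand that switches at [PI] *)

(** The primitive, vanishing at 0, of the function equal to [h true] before [PI] and to [h false]
    after it. With [Rmin] and [Rmax] each integrand stays continuous on the whole line and the jump
    never enters an integral. *)
Definition J (h : bool -> R -> R) (t : R) : R :=
  RInt (h true) 0 (Rmin t PI) + RInt (h false) PI (Rmax t PI).

Lemma ex_RInt_cont (f : R -> R) a b : (forall x, continuous f x) -> ex_RInt f a b.
Proof. intros H; apply (ex_RInt_continuous f); intros; apply H. Qed.

Section Switch.
Variable h : bool -> R -> R.
Hypothesis Hh : forall s t, continuous (h s) t.

Lemma J_diff t t' : J h t' - J h t =
  RInt (h true) (Rmin t PI) (Rmin t' PI) + RInt (h false) (Rmax t PI) (Rmax t' PI).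
Proof.
  unfold J.
  rewrite <- (RInt_Chasles (h true) 0 (Rmin t PI) (Rmin t' PI)); try (apply ex_RInt_cont, Hh).
  rewrite <- (RInt_Chasles (h false) PI (Rmax t PI) (Rmax t' PI)); try (apply ex_RInt_cont, Hh).
  unfold plus; simpl; ring.
Qed.

Lemma J_le t : t <= PI -> J h t = RInt (h true) 0 t.
Proof.
  intros H; unfold J. rewrite Rmin_left, Rmax_right by lra.
  rewrite RInt_point; unfold zero; simpl; ring.
Qed.

Lemma J_ge t : PI <= t -> J h t = RInt (h true) 0 PI + RInt (h false) PI t.
Proof. intros H; unfold J. rewrite Rmin_right, Rmax_left by lra. reflexivity. Qed.

Lemma J_0 : J h 0 = 0.
Proof. rewrite J_le by (generalize PI_RGT_0; lra). apply (RInt_point 0 (h true)). Qed.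

Lemma J_2PI : J h (2 * PI) = RInt (h true) 0 PI + RInt (h false) PI (2 * PI).
Proof. apply J_ge. generalize PI_RGT_0; lra. Qed.

Lemma J_between a b t t' : t <= t' -> (forall s u, a <= h s u <= b) ->
  a * (t' - t) <= J h t' - J h t <= b * (t' - t).
Proof.
  intros Htt Hab. rewrite J_diff.
  assert (G : forall s x y, x <= y -> a * (y - x) <= RInt (h s) x y <= b * (y - x)).
  { intros s x y Hxy. split.
    - replace (a * (y - x)) with (RInt (fun _ => a) x y)
        by (rewrite RInt_const; unfold scal; simpl; unfold mult; simpl; ring).
      apply RInt_le; auto; [apply ex_RInt_const|apply ex_RInt_cont, Hh|].
      intros; apply Hab.
    - replace (b * (y - x)) with (RInt (fun _ => b) x y)
        by (rewrite RInt_const; unfold scal; simpl; unfold mult; simpl; ring).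
      apply RInt_le; auto; [apply ex_RInt_cont, Hh|apply ex_RInt_const|].
      intros; apply Hab. }
  (* The parts of the interval before and after [PI] add up to its length, whatever the position of
     [PI]. *)
  assert (E : t' - t = (Rmin t' PI - Rmin t PI) + (Rmax t' PI - Rmax t PI)).
  { unfold Rmin, Rmax; repeat destruct Rle_dec; lra. }
  rewrite E.
  assert (E1 : Rmin t PI <= Rmin t' PI) by (unfold Rmin; repeat destruct Rle_dec; lra).
  assert (E2 : Rmax t PI <= Rmax t' PI) by (unfold Rmax; repeat destruct Rle_dec; lra).
  generalize (G true _ _ E1) (G false _ _ E2); lra.
Qed.

Lemma J_lip K t t' : (forall s u, Rabs (h s u) <= K) -> Rabs (J h t' - J h t) <= K * Rabs (t' - t).
Proof.
  intros HK.
  assert (HK' : forall s u, - K <= h s u <= K) by (intros; apply Rabs_le_between, HK).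
  destruct (Rle_dec t t') as [H|H].
  - rewrite (Rabs_pos_eq (t' - t)) by lra.
    apply Rabs_le_between. generalize (J_between _ _ _ _ H HK'); lra.
  - rewrite (Rabs_left (t' - t)) by lra.
    apply Rabs_le_between. assert (H' : t' <= t) by lra.
    generalize (J_between _ _ _ _ H' HK'); lra.
Qed.

Lemma J_bound K t : (forall s u, Rabs (h s u) <= K) -> Rabs (J h t) <= K * Rabs t.
Proof.
  intros HK. generalize (J_lip K 0 t HK). rewrite J_0, !Rminus_0_r; auto.
Qed.

Lemma J_derive_lt t : t < PI -> is_derive (J h) t (h true t).
Proof.
  intros Ht. apply (is_derive_ext_loc (fun x => RInt (h true) 0 x)).
  - assert (Hd : 0 < PI - t) by lra. exists (mkposreal _ Hd); intros y Hy.
    assert (Hy' : Rabs (y - t) < PI - t) by exact Hy.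
    apply Rabs_lt_between in Hy'. rewrite J_le; lra.
  - apply (is_derive_RInt (h true) _ 0).
    + apply filter_forall; intros x. apply (@RInt_correct R_CompleteNormedModule), ex_RInt_cont, Hh.
    + apply Hh.
Qed.

Lemma J_derive_gt t : PI < t -> is_derive (J h) t (h false t).
Proof.
  intros Ht. apply (is_derive_ext_loc (fun x => RInt (h true) 0 PI + RInt (h false) PI x)).
  - assert (Hd : 0 < t - PI) by lra. exists (mkposreal _ Hd); intros y Hy.
    assert (Hy' : Rabs (y - t) < t - PI) by exact Hy.
    apply Rabs_lt_between in Hy'. rewrite J_ge; lra.
  - apply is_derive_const_plus.
    apply (is_derive_RInt (h false) _ PI).
    + apply filter_forall; intros x. apply (@RInt_correct R_CompleteNormedModule), ex_RInt_cont, Hh.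
    + apply Hh.
Qed.

Lemma J_continuous t : continuous (J h) t.
Proof.
  unfold J.
  apply (continuous_plus (fun t => RInt (h true) 0 (Rmin t PI))
                         (fun t => RInt (h false) PI (Rmax t PI))).
  - apply (continuous_comp (fun t => Rmin t PI) (fun x => RInt (h true) 0 x)).
    + revert t; apply (lipschitz_continuous _ 1); intros x y.
      unfold Rmin; repeat destruct Rle_dec; unfold Rabs; repeat destruct Rcase_abs; lra.
    + apply (continuous_RInt_1 (h true) 0 _ (fun x => RInt (h true) 0 x)).
      apply filter_forall; intros x. apply (@RInt_correct R_CompleteNormedModule), ex_RInt_cont, Hh.
  - apply (continuous_comp (fun t => Rmax t PI) (fun x => RInt (h false) PI x)).
    + revert t; apply (lipschitz_continuous _ 1); intros x y.
      unfold Rmax; repeat destruct Rle_dec; unfold Rabs; repeat destruct Rcase_abs; lra.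
    + apply (continuous_RInt_1 (h false) PI _ (fun x => RInt (h false) PI x)).
      apply filter_forall; intros x. apply (@RInt_correct R_CompleteNormedModule), ex_RInt_cont, Hh.
Qed.
End Switch.

Lemma J_minus (h k : bool -> R -> R) t :
  (forall s t, continuous (h s) t) -> (forall s t, continuous (k s) t) ->
  J (fun s u => h s u - k s u) t = J h t - J k t.
Proof.
  intros Hh Hk; unfold J.
  rewrite (RInt_minus (h true) (k true)), (RInt_minus (h false) (k false));
    try (apply ex_RInt_cont; auto).
  unfold minus, plus, opp; simpl; ring.
Qed.

Lemma J_scal (h : bool -> R -> R) c t :
  (forall s t, continuous (h s) t) -> J (fun s u => c * h s u) t = c * J h t.
Proof.
  intros Hh; unfold J.
  rewrite (RInt_scal (h true)), (RInt_scal (h false)); try (apply ex_RInt_cont; auto).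
  unfold scal; simpl; unfold mult; simpl; ring.
Qed.

Lemma J_ext (h k : bool -> R -> R) t : (forall s u, h s u = k s u) -> J h t = J k t.
Proof.
  intros H; unfold J. f_equal; apply RInt_ext; intros; apply H.
Qed.

Lemma J_close (h k : bool -> R -> R) D t :
  (forall s t, continuous (h s) t) -> (forall s t, continuous (k s) t) ->
  (forall s u, Rabs (h s u - k s u) <= D) -> Rabs (J h t - J k t) <= D * Rabs t.
Proof.
  intros Hh Hk HD. rewrite <- J_minus by auto.
  apply J_bound; auto. intros; apply (continuous_minus (h s) (k s)); auto.
Qed.

(** * Periodic solutions of the angular system *)

(** Freezing functions at their end values outside one turn keeps them bounded and continuous on the
    whole line, so that sup-norm estimates may quantify over all [t]. *)
Definition turn (t : R) : R := clamp 0 (2 * PI) t.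

Lemma turn_in t : 0 <= turn t <= 2 * PI.
Proof. apply clamp_in. generalize PI_RGT_0; lra. Qed.

Lemma turn_id t : 0 <= t <= 2 * PI -> turn t = t.
Proof. apply clamp_id. Qed.

Lemma turn_continuous t : continuous turn t.
Proof. apply clamp_continuous. Qed.

Lemma turn_locally t : 0 < t < 2 * PI -> locally t (fun y => turn y = y).
Proof.
  intros Ht. assert (H : 0 < Rmin t (2 * PI - t)) by (apply Rmin_pos; lra).
  exists (mkposreal _ H); intros y Hy.
  assert (Hy' : Rabs (y - t) < Rmin t (2 * PI - t)) by exact Hy.
  generalize (Rmin_l t (2 * PI - t)) (Rmin_r t (2 * PI - t)); intros.
  apply Rabs_lt_between in Hy'. apply turn_id; lra.
Qed.

Definition lipschitz3 (K : R) (F : R -> R -> R -> R) : Prop :=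
  forall t r w t' r' w',
    Rabs (F t r w - F t' r' w') <= K * (Rabs (t - t') + Rabs (r - r') + Rabs (w - w')).

Lemma lipschitz3_pos K F : lipschitz3 K F -> 0 <= K.
Proof.
  intros H. generalize (H 1 0 0 0 0 0) (Rabs_pos (F 1 0 0 - F 0 0 0)).
  rewrite !Rminus_0_r, Rabs_R0, Rabs_R1; lra.
Qed.

Lemma lipschitz3_continuous K F (r w : R -> R) :
  lipschitz3 K F -> (forall t, continuous r t) -> (forall t, continuous w t) ->
  forall t, continuous (fun t => F t (r t) (w t)) t.
Proof.
  intros HF Hr Hw t. generalize (lipschitz3_pos _ _ HF); intros HK.
  apply continuous_eps; intros eps Heps.
  set (e' := eps / (3 * (K + 1))).
  assert (He' : 0 < e') by (apply Rdiv_lt_0_compat; lra).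
  destruct (proj1 (continuous_eps _ _) (Hr t) e' He') as [d1 [Hd1 H1]].
  destruct (proj1 (continuous_eps _ _) (Hw t) e' He') as [d2 [Hd2 H2]].
  exists (Rmin e' (Rmin d1 d2)); split; [repeat apply Rmin_pos; auto|].
  intros y Hy.
  assert (A1 : Rabs (y - t) < e') by (eapply Rlt_le_trans; [exact Hy|apply Rmin_l]).
  assert (A2 : Rabs (y - t) < d1)
    by (eapply Rlt_le_trans; [exact Hy|eapply Rle_trans; [apply Rmin_r|apply Rmin_l]]).
  assert (A3 : Rabs (y - t) < d2)
    by (eapply Rlt_le_trans; [exact Hy|eapply Rle_trans; [apply Rmin_r|apply Rmin_r]]).
  specialize (H1 _ A2); specialize (H2 _ A3).
  apply Rle_lt_trans with (1 := HF _ _ _ _ _ _).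
  assert (E : eps = (K + 1) * (3 * e')) by (unfold e'; field; lra).
  rewrite E. apply Rle_lt_trans with (K * (3 * e')); [|nra].
  apply Rmult_le_compat_l; lra.
Qed.

(** The solution of [w' = - w + g] on one turn that takes equal values at its ends, by variation of
    constants. The condition [w (2 * PI) = w 0] fixes the integration constant as
    [J k (2 * PI) / (exp (2 * PI) - 1)]. The weight uses [turn] so that it stays bounded. *)
Definition relax (g : bool -> R -> R) (t : R) : R :=
  let k := fun s u => exp (turn u) * g s u in
  exp (- t) * (J k (2 * PI) / (exp (2 * PI) - 1) + J k t).

(** A bound for the norm of the linear operator [relax]: both integrals are at most
    [exp (2 * PI) * (2 * PI)] times the sup norm, and [exp (- t)] is at most 1 on the turn. *)
Definition relax_const : R :=
  exp (2 * PI) * (2 * PI) / (exp (2 * PI) - 1) + exp (2 * PI) * (2 * PI).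

Lemma exp_2PI_gt : 1 < exp (2 * PI).
Proof. rewrite <- exp_0. apply exp_increasing. generalize PI_RGT_0; lra. Qed.

Lemma relax_const_pos : 0 < relax_const.
Proof.
  unfold relax_const. generalize exp_2PI_gt PI_RGT_0; intros.
  apply Rplus_lt_0_compat; [apply Rdiv_lt_0_compat|]; nra.
Qed.

Lemma exp_turn_bound t : 0 < exp (turn t) <= exp (2 * PI).
Proof.
  split; [apply exp_pos|]. generalize (turn_in t); intros [_ H].
  destruct H as [H|H]; [left; apply exp_increasing; auto|rewrite H; right; auto].
Qed.

Lemma exp_turn_mul_continuous (g : R -> R) t :
  continuous g t -> continuous (fun u => exp (turn u) * g u) t.
Proof.
  intros H. apply (continuous_mult (fun u => exp (turn u)) g); auto.
  apply continuous_comp; [apply turn_continuous|].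
  apply (@ex_derive_continuous R_AbsRing R_NormedModule). auto_derive; auto.
Qed.

Lemma relax_close (g k : bool -> R -> R) D t :
  (forall s t, continuous (g s) t) -> (forall s t, continuous (k s) t) ->
  (forall s u, Rabs (g s u - k s u) <= D) -> 0 <= t <= 2 * PI ->
  Rabs (relax g t - relax k t) <= relax_const * D.
Proof.
  intros Hg Hk HD Ht. unfold relax; cbv zeta.
  generalize exp_2PI_gt PI_RGT_0; intros He HPI.
  set (g' := fun s u => exp (turn u) * g s u).
  set (k' := fun s u => exp (turn u) * k s u).
  assert (HD0 : 0 <= D) by (eapply Rle_trans; [apply Rabs_pos|apply (HD true 0)]).
  assert (HJ : forall x, 0 <= x <= 2 * PI ->
                 Rabs (J g' x - J k' x) <= exp (2 * PI) * (2 * PI) * D).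
  { intros x Hx. apply Rle_trans with ((exp (2 * PI) * D) * Rabs x).
    - apply J_close.
      + intros; apply exp_turn_mul_continuous, Hg.
      + intros; apply exp_turn_mul_continuous, Hk.
      + intros s u. unfold g', k'. rewrite <- Rmult_minus_distr_l, Rabs_mult.
        generalize (exp_turn_bound u) (HD s u) (Rabs_pos (g s u - k s u)); intros B1 B2 B3.
        rewrite Rabs_pos_eq by lra. apply Rmult_le_compat; lra.
    - rewrite Rabs_pos_eq by lra.
      replace (exp (2 * PI) * (2 * PI) * D) with ((exp (2 * PI) * D) * (2 * PI)) by ring.
      apply Rmult_le_compat_l; nra. }
  replace (exp (- t) * (J g' (2 * PI) / (exp (2 * PI) - 1) + J g' t) -
           exp (- t) * (J k' (2 * PI) / (exp (2 * PI) - 1) + J k' t))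
    with (exp (- t) * ((J g' (2 * PI) - J k' (2 * PI)) * / (exp (2 * PI) - 1) + (J g' t - J k' t)))
    by (field; lra).
  rewrite Rabs_mult.
  assert (E1 : Rabs (exp (- t)) <= 1).
  { rewrite Rabs_pos_eq by (left; apply exp_pos). rewrite <- exp_0.
    destruct (Req_dec t 0) as [->|N]; [rewrite Ropp_0; lra|].
    left; apply exp_increasing; lra. }
  assert (E2 : Rabs ((J g' (2 * PI) - J k' (2 * PI)) * / (exp (2 * PI) - 1) + (J g' t - J k' t))
               <= relax_const * D).
  { apply Rle_trans with (1 := Rabs_triang _ _).
    rewrite Rabs_mult, Rabs_inv, (Rabs_pos_eq (exp (2 * PI) - 1)) by lra.
    unfold relax_const, Rdiv. rewrite Rmult_plus_distr_r.
    assert (0 < / (exp (2 * PI) - 1)) by (apply Rinv_0_lt_compat; lra).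
    apply Rplus_le_compat; [|apply HJ; auto].
    rewrite (Rmult_assoc _ (/ _) D), (Rmult_comm (/ _) D), <- Rmult_assoc.
    apply Rmult_le_compat_r; [lra|]. apply HJ; lra. }
  generalize (Rabs_pos (exp (- t)))
    (Rabs_pos ((J g' (2 * PI) - J k' (2 * PI)) * / (exp (2 * PI) - 1) + (J g' t - J k' t))); nra.
Qed.

Lemma relax_continuous g t : (forall s t, continuous (g s) t) -> continuous (relax g) t.
Proof.
  intros Hg. unfold relax; cbv zeta.
  apply (continuous_mult (fun t => exp (- t))).
  - apply (@ex_derive_continuous R_AbsRing R_NormedModule). auto_derive; auto.
  - apply continuous_const_plus.
    apply J_continuous. intros; apply exp_turn_mul_continuous, Hg.
Qed.

Lemma relax_periodic g : (forall s t, continuous (g s) t) -> relax g (2 * PI) = relax g 0.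
Proof.
  intros Hg. unfold relax; cbv zeta.
  rewrite J_0.
  generalize exp_2PI_gt; intros. rewrite exp_Ropp, Ropp_0, exp_0. field; lra.
Qed.

Lemma relax_derive g (s : bool) t : (forall s t, continuous (g s) t) ->
  (if s then 0 < t < PI else PI < t < 2 * PI) ->
  is_derive (relax g) t (- relax g t + g s t).
Proof.
  intros Hg Ht.
  assert (Ht' : 0 < t < 2 * PI) by (destruct s; generalize PI_RGT_0; lra).
  set (k := fun s u => exp (turn u) * g s u).
  assert (HJ : is_derive (J k) t (k s t)).
  { destruct s; [apply J_derive_lt|apply J_derive_gt]; try lra;
      intros; apply exp_turn_mul_continuous, Hg. }
  unfold relax; cbv zeta. fold k.
  set (c := J k (2 * PI) / (exp (2 * PI) - 1)).
  replace (- (exp (- t) * (c + J k t)) + g s t)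
    with (- exp (- t) * (c + J k t) + exp (- t) * k s t).
  - apply (is_derive_mult (fun t => exp (- t)) (fun t => c + J k t)).
    + auto_derive; auto; ring.
    + apply is_derive_const_plus, HJ.
    + intros; apply Rmult_comm.
  - unfold k. rewrite turn_id by lra. rewrite exp_Ropp. field. generalize (exp_pos t); lra.
Qed.

(** * The contraction and its fixed point *)

Section Existence.
Variables (G W : bool -> R -> R -> R -> R) (A : bool -> R -> R).
Variables (rs e d K kap del M D : R).
Hypothesis HGl : forall s, lipschitz3 K (G s).
Hypothesis HWl : forall s, lipschitz3 K (W s).
Hypothesis HGb : forall s t r w, Rabs (G s t r w) <= K.
Hypothesis HWb : forall s t r w, Rabs (W s t r w) <= K.
Hypothesis HAc : forall s t, continuous (A s) t.
Hypothesis HAb : forall s t, Rabs (A s t) <= K.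
Hypothesis HAd : J A (2 * PI) = d.
Hypothesis Hd : d <> 0.
Hypothesis Hlin : forall s t r r' w w',
  Rabs (r - rs) <= del -> Rabs (r' - rs) <= del -> Rabs w <= del -> Rabs w' <= del ->
  Rabs (G s t r w - G s t r' w' - A s t * (r - r')) <= kap * Rabs (r - r') + K * Rabs (w - w').
Hypothesis Hzero : Rabs (J (fun s t => G s t rs 0) (2 * PI)) <= K * Rabs e.
(** Roles of the smallness conditions: [HMd] halves distances in the mean component, [Hev] and [Heu]
    in the two others; [HDr], [HDv] and [HDu] say that [D] is large enough for the first step to
    have weighted size at most 1; [Hedel] keeps the states where the linearization [Hlin] is
    valid. *)
Hypothesis Hkap : 0 <= kap.
Hypothesis HM : 0 < M <= 1.
Hypothesis HD : 0 < D.
Hypothesis HMd : 2 * PI * (kap * (1 + M) + 2 * K * M) <= Rabs d / 2.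
Hypothesis HDr : K <= Rabs d * D.
Hypothesis HDv : 2 * PI * K <= M * D.
Hypothesis HDu : relax_const * K <= M * D.
Hypothesis Hev : Rabs e * (2 * PI * K * (1 + 2 * M)) <= M / 2.
Hypothesis Heu : Rabs e * (relax_const * K * (1 + 2 * M)) <= M / 2.
Hypothesis Hedel : Rabs e * (2 * D * (1 + M)) <= del.

(* A state [(rho, v, u)] stands for [r = rho + e v], [w = e u]: the mean [rho] is kept apart, being
   corrected through the averaged equation (a Newton step with slope [d]), while [v] and [u] are
   weighted by the small factor [M] in [near]. *)
Definition state : Type := (R * (R -> R) * (R -> R))%type.
Definition along (F : bool -> R -> R -> R -> R) (x : state) (s : bool) (t : R) : R :=
  F s t (fst (fst x) + e * snd (fst x) t) (e * snd x t).
(** At a fixed point the first component forces the integral of [G] over the turn to vanish, which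
    makes the primitive [v] close up; [u] closes up by the construction of [relax]. *)
Definition step (x : state) : state :=
  (fst (fst x) - J (along G x) (2 * PI) / d,
   fun t => J (along G x) (turn t),
   fun t => relax (along W x) (turn t)).

(** The ball of radius 2 around the starting state in the weighted norm: steps that begin with size
    at most 1 and keep halving cannot leave it. Continuity is carried along because the integrals
    require it. *)
Definition zone (x : state) : Prop :=
  Rabs (fst (fst x) - rs) <= 2 * D * Rabs e /\
  (forall t, Rabs (snd (fst x) t) <= 2 * M * D) /\ (forall t, Rabs (snd x t) <= 2 * M * D) /\
  (forall t, continuous (snd (fst x)) t) /\ (forall t, continuous (snd x) t).

(** Distance at most [q], expressed without forming a supremum. The mean carries the extra factor
    [Rabs e] because the averaged equation holds at [rs] up to an error of that order, so [rho],
    [e v] and [e u] all vary at the scale of [e]. *)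
Definition near (q : R) (x y : state) : Prop :=
  Rabs (fst (fst x) - fst (fst y)) <= D * Rabs e * q /\
  (forall t, Rabs (snd (fst x) t - snd (fst y) t) <= M * D * q) /\
  (forall t, Rabs (snd x t - snd y t) <= M * D * q).

Lemma along_continuous F x : (forall s, lipschitz3 K (F s)) -> zone x ->
  forall s t, continuous (along F x s) t.
Proof.
  intros HF [_ [_ [_ [Hv Hu]]]] s t. unfold along.
  apply (lipschitz3_continuous K (F s) (fun t => fst (fst x) + e * snd (fst x) t)
           (fun t => e * snd x t)); auto.
  - intros u. apply continuous_const_plus.
    apply (continuous_const_mult (snd (fst x))), Hv.
  - intros u. apply (continuous_const_mult (snd x)), Hu.
Qed.

Lemma along_close F x y q : (forall s, lipschitz3 K (F s)) -> 0 <= q -> near q x y ->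
  forall s t, Rabs (along F x s t - along F y s t) <= K * (D * Rabs e * (1 + 2 * M) * q).
Proof.
  intros HF Hq [H1 [H2 H3]] s t. unfold along.
  apply Rle_trans with (1 := HF _ _ _ _ _ _ _).
  generalize (lipschitz3_pos _ _ (HF true)); intros HK.
  apply Rmult_le_compat_l; auto.
  rewrite Rminus_eq_0, Rabs_R0.
  replace (fst (fst x) + e * snd (fst x) t - (fst (fst y) + e * snd (fst y) t))
    with ((fst (fst x) - fst (fst y)) + e * (snd (fst x) t - snd (fst y) t)) by ring.
  rewrite <- Rmult_minus_distr_l.
  generalize (Rabs_triang (fst (fst x) - fst (fst y)) (e * (snd (fst x) t - snd (fst y) t))).
  rewrite !Rabs_mult. generalize (H2 t) (H3 t) (Rabs_pos e); intros. nra.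
Qed.

Lemma along_bound F x : (forall s t r w, Rabs (F s t r w) <= K) ->
  forall s t, Rabs (along F x s t) <= K.
Proof. intros HF s t; apply HF. Qed.

Lemma zone_radius x t : zone x -> Rabs (fst (fst x) + e * snd (fst x) t - rs) <= del.
Proof.
  intros [H1 [H2 _]].
  replace (fst (fst x) + e * snd (fst x) t - rs)
    with ((fst (fst x) - rs) + e * snd (fst x) t) by ring.
  apply Rle_trans with (1 := Rabs_triang _ _). rewrite Rabs_mult.
  generalize (H2 t) (Rabs_pos e); nra.
Qed.

Lemma zone_height x t : zone x -> Rabs (e * snd x t) <= del.
Proof.
  intros [_ [_ [H2 _]]]. rewrite Rabs_mult.
  generalize (H2 t) (Rabs_pos e); nra.
Qed.

Lemma step_contract x y q : zone x -> zone y -> 0 <= q -> near q x y ->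
  near (q / 2) (step x) (step y).
Proof.
  intros Hx Hy Hq Hn.
  assert (Hdp : 0 < Rabs d) by (apply Rabs_pos_lt; auto).
  generalize PI_RGT_0 (Rabs_pos e); intros HPI Hep.
  generalize (along_continuous G x HGl Hx) (along_continuous G y HGl Hy); intros Cx Cy.
  generalize (along_continuous W x HWl Hx) (along_continuous W y HWl Hy); intros Cx' Cy'.
  assert (HDq : 0 <= D * q) by nra.
  repeat split; unfold step; simpl.
  - set (dr := fst (fst x) - fst (fst y)).
    assert (HAdr : forall s t, continuous (fun u => dr * A s u) t)
      by (intros; apply (continuous_const_mult (A s)), HAc).
    (* Since [J A (2 * PI) = d], the Newton correction cancels the part of the difference that is
       linear in [dr]; only the deviation from [dr * A] is left. *)
    assert (E : fst (fst x) - J (along G x) (2 * PI) / d - (fst (fst y) - J (along G y) (2 * PI) / d)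
      = - / d * (J (fun s t => along G x s t - along G y s t) (2 * PI) - J (fun s t => dr * A s t) (2 * PI))).
    { rewrite J_minus, J_scal, HAd by auto. unfold dr. field; auto. }
    rewrite E, Rabs_mult, Rabs_Ropp, Rabs_inv.
    apply Rmult_le_reg_l with (Rabs d); auto.
    rewrite <- Rmult_assoc, Rinv_r, Rmult_1_l by lra.
    eapply Rle_trans.
    + apply (J_close _ _ ((kap * (1 + M) + 2 * K * M) * (D * Rabs e * q))); auto.
      * intros; apply (continuous_minus (along G x s) (along G y s)); auto.
      * intros s t.
        set (dv := snd (fst x) t - snd (fst y) t).
        (* The linearization predicts with the full radial difference [dr + e * dv]. Its part
           [e * dv] is not cancelled and is paid for by the weight [M]. *)
        replace (along G x s t - along G y s t - dr * A s t) with
          ((along G x s t - along G y s t - A s t * (dr + e * dv)) + A s t * (e * dv)) by ring.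
        apply Rle_trans with (1 := Rabs_triang _ _).
        assert (B : Rabs (along G x s t - along G y s t - A s t * (dr + e * dv)) <=
          kap * Rabs (dr + e * dv) + K * Rabs (e * (snd x t - snd y t))).
        { replace (dr + e * dv) with
            (fst (fst x) + e * snd (fst x) t - (fst (fst y) + e * snd (fst y) t))
            by (unfold dr, dv; ring).
          rewrite (Rmult_minus_distr_l e).
          apply Hlin; try apply zone_radius; try apply zone_height; auto. }
        destruct Hn as [N1 [N2 N3]]. specialize (N2 t); specialize (N3 t).
        fold dr in N1; fold dv in N2.
        rewrite !Rabs_mult in B. rewrite !Rabs_mult.
        generalize (Rabs_triang dr (e * dv)); rewrite Rabs_mult; intros T.
        assert (T1 : Rabs e * Rabs dv <= Rabs e * (M * D * q)) by (apply Rmult_le_compat_l; auto).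
        assert (T2 : Rabs e * Rabs (snd x t - snd y t) <= Rabs e * (M * D * q))
          by (apply Rmult_le_compat_l; auto).
        generalize (lipschitz3_pos _ _ (HGl true)); intros HK.
        assert (T3 : Rabs (A s t) * (Rabs e * Rabs dv) <= K * (Rabs e * (M * D * q))).
        { apply Rmult_le_compat; auto using Rabs_pos. apply Rmult_le_pos; auto using Rabs_pos. }
        assert (T4 : K * (Rabs e * Rabs (snd x t - snd y t)) <= K * (Rabs e * (M * D * q)))
          by (apply Rmult_le_compat_l; auto).
        assert (T5 : kap * Rabs (dr + e * dv) <= kap * (D * Rabs e * q + Rabs e * (M * D * q)))
          by (apply Rmult_le_compat_l; lra).
        lra.
    + rewrite (Rabs_pos_eq (2 * PI)) by lra.
      assert (0 <= D * Rabs e * q) by (apply Rmult_le_pos; nra).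
      replace ((kap * (1 + M) + 2 * K * M) * (D * Rabs e * q) * (2 * PI)) with
        ((2 * PI * (kap * (1 + M) + 2 * K * M)) * (D * Rabs e * q)) by ring.
      replace (Rabs d * (D * Rabs e * (q / 2))) with ((Rabs d / 2) * (D * Rabs e * q)) by field.
      apply Rmult_le_compat_r; auto.
  - intros t. eapply Rle_trans; [apply J_close; [auto|auto|apply (along_close G x y q); auto]|].
    generalize (turn_in t); intros Ht. rewrite (Rabs_pos_eq (turn t)) by lra.
    generalize (lipschitz3_pos _ _ (HGl true)); intros HK.
    apply Rle_trans with (K * (D * Rabs e * (1 + 2 * M) * q) * (2 * PI)).
    + apply Rmult_le_compat_l; [|lra]. apply Rmult_le_pos; auto.
      replace (D * Rabs e * (1 + 2 * M) * q) with ((D * q) * (Rabs e * (1 + 2 * M))) by ring.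
      apply Rmult_le_pos; nra.
    + replace (K * (D * Rabs e * (1 + 2 * M) * q) * (2 * PI)) with
        ((Rabs e * (2 * PI * K * (1 + 2 * M))) * (D * q)) by ring.
      replace (M * D * (q / 2)) with (M / 2 * (D * q)) by field.
      apply Rmult_le_compat_r; auto.
  - intros t. eapply Rle_trans;
      [apply relax_close; auto; [apply (along_close W x y q); auto|apply turn_in]|].
    replace (relax_const * (K * (D * Rabs e * (1 + 2 * M) * q))) with
      ((Rabs e * (relax_const * K * (1 + 2 * M))) * (D * q)) by ring.
    replace (M * D * (q / 2)) with (M / 2 * (D * q)) by field.
    apply Rmult_le_compat_r; auto.
Qed.

Lemma step_continuous x : zone x ->
  (forall t, continuous (snd (fst (step x))) t) /\ (forall t, continuous (snd (step x)) t).
Proof.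
  intros Hx; split; intros t; unfold step; simpl.
  - apply (continuous_comp turn (J (along G x))); [apply turn_continuous|].
    apply J_continuous, along_continuous; auto.
  - apply (continuous_comp turn (relax (along W x))); [apply turn_continuous|].
    apply relax_continuous, along_continuous; auto.
Qed.

Definition start : state := (rs, fun _ => 0, fun _ => 0).
Fixpoint iterate (n : nat) : state :=
  match n with O => start | S n => step (iterate n) end.

Lemma relax_0 t : relax (fun _ _ => 0) t = 0.
Proof.
  unfold relax; cbv zeta. unfold J.
  rewrite !(RInt_ext (fun u => exp (turn u) * 0) (fun _ => 0)) by (intros; apply Rmult_0_r).
  rewrite !RInt_const. unfold scal; simpl; unfold mult; simpl.
  unfold Rdiv; ring.
Qed.

Lemma zone_start : zone start.
Proof.
  generalize (Rabs_pos e); intros. assert (0 < M * D) by nra.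
  unfold zone, start; simpl; repeat split; intros; try apply continuous_const;
    rewrite ?Rminus_eq_0, ?Rabs_R0; nra.
Qed.

Lemma near_start : near 1 (step start) start.
Proof.
  generalize PI_RGT_0; intros HPI.
  assert (Hdp : 0 < Rabs d) by (apply Rabs_pos_lt; auto).
  assert (E : forall t, along G start true t = G true t rs 0 /\ along G start false t = G false t rs 0).
  { intros t; unfold along, start; simpl; rewrite !Rmult_0_r, Rplus_0_r; auto. }
  assert (HJ : J (along G start) (2 * PI) = J (fun s t => G s t rs 0) (2 * PI)).
  { apply J_ext; intros [|] u; apply (E u). }
  unfold near; repeat split; simpl.
  - replace (rs - J (along G start) (2 * PI) / d - rs) with (- (/ d * J (along G start) (2 * PI)))
      by (field; auto).
    rewrite HJ, Rabs_Ropp, Rabs_mult, Rabs_inv.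
    apply Rmult_le_reg_l with (Rabs d); auto.
    rewrite <- Rmult_assoc, Rinv_r, Rmult_1_l by lra.
    apply Rle_trans with (1 := Hzero). generalize (Rabs_pos e); nra.
  - intros t. rewrite Rminus_0_r.
    eapply Rle_trans; [apply (J_bound _ (along_continuous G _ HGl zone_start) K), along_bound, HGb|].
    generalize (turn_in t) (lipschitz3_pos _ _ (HGl true)); intros. rewrite Rabs_pos_eq by lra. nra.
  - intros t. rewrite <- (relax_0 (turn t)).
    eapply Rle_trans; [apply (relax_close _ _ K)|]; try apply turn_in.
    + apply along_continuous; auto. apply zone_start.
    + intros; apply continuous_const.
    + intros; rewrite Rminus_0_r; apply along_bound, HWb.
    + lra.
Qed.

Lemma iterate_zone n : zone (iterate n) /\ near ((/ 2) ^ n) (iterate (S n)) (iterate n).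
Proof.
  assert (HMD : 0 < M * D) by nra. generalize (Rabs_pos e); intros Hep.
  assert (H : forall n, (forall k, (k <= n)%nat ->
            zone (iterate k) /\ near ((/ 2) ^ k) (iterate (S k)) (iterate k)) ->
            zone (iterate (S n))).
  { intros m Hm.
    assert (Z : forall (x : nat -> R) C, 0 <= C ->
      (forall k, (k <= m)%nat -> Rabs (x (S k) - x k) <= C * (/ 2) ^ k) ->
      Rabs (x (S m) - x 0%nat) <= 2 * C).
    { intros x C HC Hk.
      (* Increments are known only up to index [m]; freezing the sequence afterwards gives one whose
         increments are all controlled. *)
      set (x' := fun k => if (k <=? S m)%nat then x k else x (S m)).
      replace (x (S m)) with (x' (S m)) by (unfold x'; rewrite (proj2 (Nat.leb_le _ _)); auto).
      replace (x 0%nat) with (x' 0%nat) by (unfold x'; reflexivity).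
      assert (Hx' : forall k, Rabs (x' (S k) - x' k) <= C * (/ 2) ^ k).
      { intros k. unfold x'.
        generalize (Rmult_le_pos C _ HC (Rlt_le _ _ (half_pow_pos k))); intros Hp.
        destruct (Nat.leb_spec (S k) (S m)); destruct (Nat.leb_spec k (S m)); try lia.
        - apply Hk; lia.
        - replace (x k) with (x (S m)) by (f_equal; lia). rewrite Rminus_eq_0, Rabs_R0; lra.
        - rewrite Rminus_eq_0, Rabs_R0; lra. }
      generalize (geometric_increments_sum x' C Hx' 0%nat (S m) (Nat.le_0_l _)).
      rewrite pow_O.
      generalize (Rmult_le_pos C _ HC (Rlt_le _ _ (half_pow_pos (S m)))); lra. }
    destruct (step_continuous (iterate m) (proj1 (Hm m (Nat.le_refl m)))) as [C1 C2].
    repeat split.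
    - generalize (Z (fun k => fst (fst (iterate k))) (D * Rabs e)); simpl.
      intros Z'. rewrite Rmult_assoc. apply Z'; [nra|].
      intros k Hk. apply (Hm k Hk).
    - intros t. generalize (Z (fun k => snd (fst (iterate k)) t) (M * D)).
      simpl; rewrite Rminus_0_r. intros Z'. rewrite Rmult_assoc. apply Z'; [lra|].
      intros k Hk. apply (Hm k Hk).
    - intros t. generalize (Z (fun k => snd (iterate k) t) (M * D)).
      simpl; rewrite Rminus_0_r. intros Z'. rewrite Rmult_assoc. apply Z'; [lra|].
      intros k Hk. apply (Hm k Hk).
    - exact C1.
    - exact C2. }
  induction n as [n IH] using (well_founded_induction Wf_nat.lt_wf).
  destruct n as [|n].
  - split; [apply zone_start|apply near_start].
  - assert (Hz : zone (iterate (S n))) by (apply H; intros k Hk; apply IH; lia).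
    split; auto. destruct (IH n) as [Z1 N1]; [lia|].
    replace ((/ 2) ^ S n) with ((/ 2) ^ n / 2) by (simpl; field).
    apply (step_contract (iterate (S n)) (iterate n)); auto.
    generalize (half_pow_pos n); lra.
Qed.

Definition limit : state :=
  (real (Lim_seq (fun n => fst (fst (iterate n)))),
   fun t => real (Lim_seq (fun n => snd (fst (iterate n)) t)),
   fun t => real (Lim_seq (fun n => snd (iterate n) t))).

Lemma limit_near n : near (2 * (/ 2) ^ n) (iterate n) limit.
Proof.
  repeat split; [|intros t|intros t]; simpl.
  - replace (D * Rabs e * (2 * (/ 2) ^ n)) with (2 * (D * Rabs e) * (/ 2) ^ n) by ring.
    apply (geometric_increments_limit (fun n => fst (fst (iterate n)))).
    intros k; apply iterate_zone.
  - replace (M * D * (2 * (/ 2) ^ n)) with (2 * (M * D) * (/ 2) ^ n) by ring.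
    apply (geometric_increments_limit (fun n => snd (fst (iterate n)) t)).
    intros k; apply iterate_zone.
  - replace (M * D * (2 * (/ 2) ^ n)) with (2 * (M * D) * (/ 2) ^ n) by ring.
    apply (geometric_increments_limit (fun n => snd (iterate n) t)).
    intros k; apply iterate_zone.
Qed.

Lemma limit_zone : zone limit.
Proof.
  destruct (limit_near 0) as [L1 [L2 L3]]. simpl in L1, L2, L3.
  repeat split.
  - rewrite Rabs_minus_sym. simpl. lra.
  - intros t. specialize (L2 t). simpl. unfold Rminus in L2.
    rewrite Rplus_0_l, Rabs_Ropp in L2. lra.
  - intros t. specialize (L3 t). simpl. unfold Rminus in L3.
    rewrite Rplus_0_l, Rabs_Ropp in L3. lra.
  - apply (uniform_limit_continuous (fun n => snd (fst (iterate n))) _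
             (fun n => (2 * (M * D)) * (/ 2) ^ n)).
    + intros n; apply iterate_zone.
    + intros n x. destruct (limit_near n) as [_ [N _]]. specialize (N x).
      replace (2 * (M * D) * (/ 2) ^ n) with (M * D * (2 * (/ 2) ^ n)) by ring. exact N.
    + apply is_lim_seq_half_pow.
  - apply (uniform_limit_continuous (fun n => snd (iterate n)) _
             (fun n => (2 * (M * D)) * (/ 2) ^ n)).
    + intros n; apply iterate_zone.
    + intros n x. destruct (limit_near n) as [_ [_ N]]. specialize (N x).
      replace (2 * (M * D) * (/ 2) ^ n) with (M * D * (2 * (/ 2) ^ n)) by ring. exact N.
    + apply is_lim_seq_half_pow.
Qed.

(** The iterates approach [limit] by convergence and [step limit] by contraction, both at rate
    [(/ 2) ^ n]. The function components are identified pointwise, which is all that the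
    differential equations use. *)
Lemma limit_fixed :
  fst (fst (step limit)) = fst (fst limit) /\
  (forall t, snd (fst (step limit)) t = snd (fst limit) t) /\
  (forall t, snd (step limit) t = snd limit t).
Proof.
  assert (H : forall n, near ((/ 2) ^ n) (iterate (S n)) (step limit) /\
                        near ((/ 2) ^ n) (iterate (S n)) limit).
  { intros n; split.
    - replace ((/ 2) ^ n) with (2 * (/ 2) ^ n / 2) by field.
      apply (step_contract (iterate n) limit);
        [apply iterate_zone|apply limit_zone|generalize (half_pow_pos n); lra|apply limit_near].
    - replace ((/ 2) ^ n) with (2 * (/ 2) ^ (S n)) by (simpl; field). apply limit_near. }
  assert (Z : forall (x : nat -> R) y z C,
    (forall n, Rabs (x n - y) <= C * (/ 2) ^ n) -> (forall n, Rabs (x n - z) <= C * (/ 2) ^ n) ->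
    y = z).
  { intros x y z C Hy Hz. apply Rminus_diag_uniq.
    assert (E : Rabs (y - z) <= 0).
    { apply (le_of_half_pow _ (2 * C)); intros n.
      replace (y - z) with (- (x n - y) + (x n - z)) by ring.
      apply Rle_trans with (1 := Rabs_triang _ _). rewrite Rabs_Ropp.
      generalize (Hy n) (Hz n); lra. }
    generalize (Rabs_pos (y - z)); intros. destruct (Req_dec (y - z) 0); auto.
    generalize (Rabs_pos_lt _ H1); lra. }
  repeat split; [|intros t|intros t].
  - apply (Z (fun n => fst (fst (iterate (S n)))) _ _ (D * Rabs e)); intros n; apply (H n).
  - apply (Z (fun n => snd (fst (iterate (S n))) t) _ _ (M * D)); intros n; apply (H n).
  - apply (Z (fun n => snd (iterate (S n)) t) _ _ (M * D)); intros n; apply (H n).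
Qed.

Lemma periodic_solution_fixed : exists r w : R -> R,
  (forall t, continuous r t) /\ (forall t, continuous w t) /\
  (forall t, Rabs (r t - rs) <= Rabs e * (2 * D * (1 + M))) /\
  (forall t, Rabs (w t) <= Rabs e * (2 * D * (1 + M))) /\
  r (2 * PI) = r 0 /\ w (2 * PI) = w 0 /\
  forall (s : bool) t, (if s then 0 < t < PI else PI < t < 2 * PI) ->
    is_derive r t (e * G s t (r t) (w t)) /\
    is_derive w t (- w t + e * W s t (r t) (w t)).
Proof.
  generalize PI_RGT_0; intros HPI.
  destruct limit_fixed as [F1 [F2 F3]]. generalize limit_zone; intros Hz.
  generalize (along_continuous G limit HGl Hz) (along_continuous W limit HWl Hz); intros CG CW.
  set (x := limit) in *.
  exists (fun t => fst (fst x) + e * snd (fst x) t), (fun t => e * snd x t).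
  assert (T0 : turn 0 = 0) by (apply turn_id; lra).
  assert (T2 : turn (2 * PI) = 2 * PI) by (apply turn_id; lra).
  generalize Hz; intros [Z1 [Z2 [Z3 [Z4 Z5]]]].
  split; [|split; [|split; [|split; [|split; [|split; [|intros s t Ht; split]]]]]].
  - intros t. apply continuous_const_plus.
    apply (continuous_const_mult (snd (fst x))), Z4.
  - intros t. apply (continuous_const_mult (snd x)), Z5.
  - intros t. replace (fst (fst x) + e * snd (fst x) t - rs)
      with ((fst (fst x) - rs) + e * snd (fst x) t) by ring.
    apply Rle_trans with (1 := Rabs_triang _ _). rewrite Rabs_mult.
    generalize (Z2 t) (Rabs_pos e); nra.
  - intros t. rewrite Rabs_mult. generalize (Z3 t) (Rabs_pos e); nra.
  - simpl in F1. rewrite <- !F2. simpl. rewrite T0, T2.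
    rewrite J_0.
    assert (E : J (along G x) (2 * PI) / d = 0) by lra.
    assert (E' : J (along G x) (2 * PI) = 0)
      by (replace (J (along G x) (2 * PI)) with (J (along G x) (2 * PI) / d * d) by (field; auto);
          rewrite E; ring).
    rewrite E'; auto.
  - rewrite <- !F3. simpl. rewrite T0, T2. rewrite relax_periodic; auto.
  - assert (Ht' : 0 < t < 2 * PI) by (destruct s; lra).
    apply is_derive_const_plus.
    apply (is_derive_scal (snd (fst x)) t e (along G x s t)).
    apply (is_derive_ext_loc (J (along G x))).
    + apply filter_imp with (2 := turn_locally t Ht').
      intros y Hy. rewrite <- F2. simpl. rewrite Hy; auto.
    + destruct s; [apply J_derive_lt|apply J_derive_gt]; auto; lra.
  - assert (Ht' : 0 < t < 2 * PI) by (destruct s; lra).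
    replace (- (e * snd x t) + e * W s t (fst (fst x) + e * snd (fst x) t) (e * snd x t))
      with (e * (- snd x t + along W x s t)) by (unfold along; ring).
    apply (is_derive_scal (snd x) t e (- snd x t + along W x s t)).
    apply (is_derive_ext_loc (relax (along W x))).
    + apply filter_imp with (2 := turn_locally t Ht').
      intros y Hy. rewrite <- F3. simpl. rewrite Hy; auto.
    + rewrite <- F3. simpl. rewrite turn_id by lra. apply relax_derive; auto.
Qed.
End Existence.

Theorem periodic_solutions (G W : R -> bool -> R -> R -> R -> R) (A : bool -> R -> R)
  (rs d K e1 : R) :
  0 < e1 -> d <> 0 ->
  (forall e s, Rabs e <= e1 -> lipschitz3 K (G e s)) ->
  (forall e s, Rabs e <= e1 -> lipschitz3 K (W e s)) ->
  (forall e s t r w, Rabs e <= e1 -> Rabs (G e s t r w) <= K) ->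
  (forall e s t r w, Rabs e <= e1 -> Rabs (W e s t r w) <= K) ->
  (forall s t, continuous (A s) t) -> (forall s t, Rabs (A s t) <= K) ->
  J A (2 * PI) = d ->
  (forall kap, 0 < kap -> exists del, 0 < del /\ forall e s t r r' w w',
     Rabs e <= del -> Rabs (r - rs) <= del -> Rabs (r' - rs) <= del ->
     Rabs w <= del -> Rabs w' <= del ->
     Rabs (G e s t r w - G e s t r' w' - A s t * (r - r')) <=
       kap * Rabs (r - r') + K * Rabs (w - w')) ->
  (forall e, Rabs e <= e1 -> Rabs (J (fun s t => G e s t rs 0) (2 * PI)) <= K * Rabs e) ->
  exists e0 C, 0 < e0 /\ 0 < C /\ forall e, Rabs e <= e0 -> exists r w : R -> R,
    (forall t, continuous r t) /\ (forall t, continuous w t) /\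
    (forall t, Rabs (r t - rs) <= Rabs e * C) /\
    (forall t, Rabs (w t) <= Rabs e * C) /\
    r (2 * PI) = r 0 /\ w (2 * PI) = w 0 /\
    forall (s : bool) t, (if s then 0 < t < PI else PI < t < 2 * PI) ->
      is_derive r t (e * G e s t (r t) (w t)) /\
      is_derive w t (- w t + e * W e s t (r t) (w t)).
Proof.
  intros He1 Hd HGl HWl HGb HWb HAc HAb HAd Hlin Hz.
  generalize PI_RGT_0 relax_const_pos; intros HPI Hrel.
  assert (Hdp : 0 < Rabs d) by (apply Rabs_pos_lt; auto).
  assert (HK : 0 <= K) by (eapply Rle_trans; [apply Rabs_pos|apply (HAb true 0)]).
  (* The constants are fixed in the order [M] and [kap], then [D], then the range of [e]. The budget
     [Rabs d / 2] for the mean is split in two halves; this choice gives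
     [4 * PI * K * M <= Rabs d / 4]. *)
  set (M := Rmin 1 (Rabs d / (16 * PI * (K + 1)))).
  assert (HM : 0 < M) by (apply Rmin_pos; [lra|apply Rdiv_lt_0_compat; nra]).
  assert (HM1 : M <= 1) by apply Rmin_l.
  assert (HMK : 4 * PI * K * M <= Rabs d / 4).
  { apply Rle_trans with (4 * PI * (K + 1) * (Rabs d / (16 * PI * (K + 1)))).
    - apply Rmult_le_compat; try nra. apply Rmin_r.
    - right; field; lra. }
  (* With [M <= 1], the term [2 * PI * kap * (1 + M)] takes the other half, [Rabs d / 4]. *)
  set (kap := Rabs d / (16 * PI)).
  assert (Hkap : 0 < kap) by (apply Rdiv_lt_0_compat; lra).
  destruct (Hlin kap Hkap) as [del [Hdel Hl]].
  (* The sum of the three lower bounds required of [D], plus 1 for strict positivity. *)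
  set (D := K / Rabs d + 2 * PI * K / M + relax_const * K / M + 1).
  assert (Hp1 : 0 <= K / Rabs d) by (apply Rdiv_le_0_compat; lra).
  assert (Hp2 : 0 <= 2 * PI * K / M) by (apply Rdiv_le_0_compat; nra).
  assert (Hp3 : 0 <= relax_const * K / M) by (apply Rdiv_le_0_compat; nra).
  assert (HD : 0 < D) by (unfold D; lra).
  set (q1 := 2 * PI * K * (1 + 2 * M)). set (q2 := relax_const * K * (1 + 2 * M)).
  set (q3 := 2 * D * (1 + M)).
  assert (Hq1 : 0 <= q1) by (unfold q1; apply Rmult_le_pos; nra).
  assert (Hq2 : 0 <= q2) by (unfold q2; apply Rmult_le_pos; nra).
  assert (Hq3 : 0 < q3) by (unfold q3; apply Rmult_lt_0_compat; nra).
  assert (Hsm : forall x b q, 0 < b -> 0 <= q -> 0 <= x -> x <= b / (q + 1) -> x * q <= b).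
  { intros x b q Hb Hq Hx H. apply Rle_trans with (b / (q + 1) * (q + 1)).
    - apply Rmult_le_compat; lra.
    - right; field; lra. }
  exists (Rmin (Rmin e1 del) (Rmin (M / 2 / (q1 + 1)) (Rmin (M / 2 / (q2 + 1)) (del / (q3 + 1))))), q3.
  split; [repeat apply Rmin_pos; auto; apply Rdiv_lt_0_compat; lra|].
  split; [auto|]. intros e He. generalize (Rabs_pos e); intros Hep.
  assert (A1 : Rabs e <= e1) by (eapply Rle_trans; [exact He|]; eapply Rle_trans; [apply Rmin_l|apply Rmin_l]).
  assert (A2 : Rabs e <= del) by (eapply Rle_trans; [exact He|]; eapply Rle_trans; [apply Rmin_l|apply Rmin_r]).
  generalize (Rle_trans _ _ _ He (Rmin_r _ _)); clear He; intros He.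
  assert (A3 : Rabs e <= M / 2 / (q1 + 1)) by (eapply Rle_trans; [exact He|apply Rmin_l]).
  generalize (Rle_trans _ _ _ He (Rmin_r _ _)); clear He; intros He.
  assert (A4 : Rabs e <= M / 2 / (q2 + 1)) by (eapply Rle_trans; [exact He|apply Rmin_l]).
  assert (A5 : Rabs e <= del / (q3 + 1)) by (eapply Rle_trans; [exact He|apply Rmin_r]).
  apply (periodic_solution_fixed (G e) (W e) A rs e d K kap del M D); auto; try lra.
  - assert (2 * PI * (kap * (1 + M)) <= Rabs d / 4); [|lra].
    apply Rle_trans with (2 * PI * (kap * 2)).
    + apply Rmult_le_compat_l; [lra|]. apply Rmult_le_compat_l; lra.
    + right; unfold kap; field; lra.
  - apply Rle_trans with (Rabs d * (K / Rabs d)); [right; field; lra|].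
    apply Rmult_le_compat_l; unfold D; lra.
  - apply Rle_trans with (M * (2 * PI * K / M)); [right; field; lra|].
    apply Rmult_le_compat_l; unfold D; lra.
  - apply Rle_trans with (M * (relax_const * K / M)); [right; field; lra|].
    apply Rmult_le_compat_l; unfold D; lra.
  - apply (Hsm _ _ q1); auto; lra.
  - apply (Hsm _ _ q2); auto; lra.
  - apply (Hsm _ _ q3); auto; lra.
Qed.

(** * Continuous periodic functions *)

Lemma is_derive_continuous (f : R -> R) (x l : R) : is_derive f x l -> continuous f x.
Proof.
  intros H. apply (@ex_derive_continuous R_AbsRing R_NormedModule). exists l; exact H.
Qed.

(** Nothing is differentiated at the ends, where a trajectory may cross Sigma. Continuity carries
    the monotonicity to the ends only in weak form; the middle third restores strictness. *)
Lemma derive_pos_lt (V : R -> R) (a b : R) : a < b -> (forall t, continuous V t) ->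
  (forall t, a < t < b -> exists l, is_derive V t l /\ 0 < l) -> V a < V b.
Proof.
  intros Hab Hc Hl.
  assert (Hin : forall u v, a < u -> u < v -> v < b -> V u < V v).
  { intros u v Hu Huv Hv.
    destruct (MVT_gen V u v (Derive V)) as [c [Hc1 Hc2]].
    - rewrite Rmin_left, Rmax_right by lra. intros x Hx.
      destruct (Hl x) as [l [H1 _]]; [lra|]. apply Derive_correct. exists l; auto.
    - intros x _. apply continuity_pt_filterlim, Hc.
    - rewrite Rmin_left, Rmax_right in Hc1 by lra.
      destruct (Hl c) as [l [H1 H2]]; [lra|]. rewrite (is_derive_unique _ _ _ H1) in Hc2. nra. }
  assert (Hle : forall (g : R -> R) p q, (forall t, continuous g t) -> p < q ->
            (forall u v, p < u -> u < v -> v < q -> g u < g v) -> g p <= g q).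
  { intros g p q Hg Hpq Hi.
    destruct (Rle_dec (g p) (g q)) as [|N]; auto; exfalso.
    assert (He : 0 < (g p - g q) / 2) by lra.
    destruct (proj1 (continuous_eps _ _) (Hg p) _ He) as [d1 [Hd1 H1]].
    destruct (proj1 (continuous_eps _ _) (Hg q) _ He) as [d2 [Hd2 H2]].
    set (m := Rmin (Rmin d1 d2) (q - p)).
    assert (Hm : 0 < m) by (repeat apply Rmin_pos; lra).
    assert (m <= d1) by (eapply Rle_trans; [apply Rmin_l|apply Rmin_l]).
    assert (m <= d2) by (eapply Rle_trans; [apply Rmin_l|apply Rmin_r]).
    assert (m <= q - p) by apply Rmin_r.
    specialize (H1 (p + m / 3)); specialize (H2 (q - m / 3)).
    assert (B1 : Rabs (g (p + m / 3) - g p) < (g p - g q) / 2)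
      by (apply H1; apply Rabs_lt_between; lra).
    assert (B2 : Rabs (g (q - m / 3) - g q) < (g p - g q) / 2)
      by (apply H2; apply Rabs_lt_between; lra).
    apply Rabs_lt_between in B1. apply Rabs_lt_between in B2.
    assert (g (p + m / 3) < g (q - m / 3)) by (apply Hi; lra). lra. }
  set (u := a + (b - a) / 3). set (v := a + 2 * (b - a) / 3).
  assert (V a <= V u) by (apply Hle; auto; [unfold u; lra|intros; apply Hin; unfold u in *; lra]).
  assert (V v <= V b) by (apply Hle; auto; [unfold v; lra|intros; apply Hin; unfold v in *; lra]).
  assert (V u < V v) by (apply Hin; unfold u, v; lra). lra.
Qed.

Lemma floor_multiple (T t : R) : 0 < T -> exists k : Z, IZR k * T <= t < (IZR k + 1) * T.
Proof.
  intros HT. exists (Int_part (t / T)). destruct (base_Int_part (t / T)) as [H1 H2].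
  assert (E : t = t / T * T) by (field; lra).
  set (q := t / T) in *. rewrite E. split; nra.
Qed.

Lemma periodic_Z {X : Type} (V : R -> X) (T : R) : (forall t, V (t + T) = V t) ->
  forall (k : Z) t, V (t + IZR k * T) = V t.
Proof.
  intros H.
  assert (Hn : forall (n : nat) t, V (t + INR n * T) = V t).
  { induction n; intros t; [simpl; f_equal; ring|].
    rewrite S_INR. replace (t + (INR n + 1) * T) with ((t + INR n * T) + T) by ring.
    rewrite H; auto. }
  intros k t. destruct (Z_le_gt_dec 0 k) as [Hk|Hk].
  - rewrite <- (Z2Nat.id k), <- INR_IZR_INZ by auto. apply Hn.
  - replace (IZR k) with (- INR (Z.to_nat (- k))).
    + rewrite <- (Hn (Z.to_nat (- k)) (t + - INR (Z.to_nat (- k)) * T)). f_equal; ring.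
    + rewrite INR_IZR_INZ, Z2Nat.id by lia. rewrite opp_IZR; ring.
Qed.

Lemma periodic_max (V : R -> R) (T : R) : 0 < T -> (forall t, continuous V t) ->
  (forall t, V (t + T) = V t) -> exists t0, forall t, V t <= V t0.
Proof.
  intros HT Hc Hp.
  destruct (continuity_ab_maj V 0 T) as [t0 [H0 _]]; [lra| |].
  - intros c _. apply continuity_pt_filterlim, Hc.
  - exists t0. intros t. destruct (floor_multiple T t HT) as [k Hk].
    replace t with ((t - IZR k * T) + IZR k * T) by ring.
    rewrite (periodic_Z V T Hp). apply H0. lra.
Qed.

(** The neighbourhood is punctured because the maximum may sit at a crossing instant, without a
    derivative. The point is compared with a neighbour on the right if [c] is positive and on the
    left otherwise, so either sign of the drift is excluded. *)
Lemma max_not_monotone (V : R -> R) (t0 : R) (c del : R) :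
  (forall t, continuous V t) -> (forall t, V t <= V t0) -> 0 < del ->
  ~ (forall u, 0 < Rabs (u - t0) < del -> exists l, is_derive V u l /\ 0 < c * l).
Proof.
  intros Hc Hm Hdel H.
  assert (Hc0 : c <> 0).
  { intros ->. destruct (H (t0 + del / 2)) as [l [_ Hl]]; [|lra].
    rewrite Rabs_pos_eq; lra. }
  destruct (Rlt_dec 0 c) as [P|P].
  - assert (V t0 < V (t0 + del / 2)); [|generalize (Hm (t0 + del / 2)); lra].
    apply derive_pos_lt; auto; [lra|]. intros t Ht.
    destruct (H t) as [l [H1 H2]]; [rewrite Rabs_pos_eq; lra|]. exists l; split; auto. nra.
  - assert (- V (t0 - del / 2) < - V t0); [|generalize (Hm (t0 - del / 2)); lra].
    apply (derive_pos_lt (fun t => - V t)); [lra| |].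
    + intros t. apply (@continuous_opp R_UniformSpace R_AbsRing R_NormedModule V), Hc.
    + intros t Ht. destruct (H t) as [l [H1 H2]]; [rewrite Rabs_left; lra|].
      exists (- l); split; [apply (@is_derive_opp R_AbsRing R_NormedModule V); auto|nra].
Qed.

Definition perext (g : R -> R) (T t : R) : R := g (t - IZR (Int_part (t / T)) * T).

Lemma perext_eq g T (k : Z) t : 0 < T -> IZR k * T <= t < (IZR k + 1) * T ->
  perext g T t = g (t - IZR k * T).
Proof.
  intros HT Hk. unfold perext. do 3 f_equal.
  symmetry. rewrite <- (Int_part_spec (t / T) k); auto.
  assert (E : t = t / T * T) by (field; lra).
  set (q := t / T) in *. rewrite E in Hk. split; nra.
Qed.

Lemma perext_shift g T t : 0 < T -> perext g T (t + T) = perext g T t.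
Proof.
  intros HT. destruct (floor_multiple T t HT) as [k Hk].
  rewrite (perext_eq g T k t HT Hk), (perext_eq g T (k + 1)); auto.
  - rewrite plus_IZR. f_equal; ring.
  - rewrite plus_IZR. lra.
Qed.

Lemma perext_id g T t : 0 < T -> g T = g 0 -> 0 <= t <= T -> perext g T t = g t.
Proof.
  intros HT Hg Ht. destruct (Req_dec t T) as [->|N].
  - replace T with (0 + T) at 2 by ring. rewrite perext_shift, (perext_eq g T 0) by (simpl; lra).
    rewrite Hg. f_equal; simpl; ring.
  - rewrite (perext_eq g T 0) by (simpl; lra). f_equal; simpl; ring.
Qed.

Lemma perext_locally g T (k : Z) t : 0 < T -> IZR k * T < t < (IZR k + 1) * T ->
  locally t (fun u => g (u - IZR k * T) = perext g T u).
Proof.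
  intros HT Hk. set (a := Rmin (t - IZR k * T) ((IZR k + 1) * T - t)).
  assert (Ha : 0 < a) by (apply Rmin_pos; lra).
  generalize (Rmin_l (t - IZR k * T) ((IZR k + 1) * T - t))
    (Rmin_r (t - IZR k * T) ((IZR k + 1) * T - t)); fold a; intros.
  exists (mkposreal a Ha); intros u Hu.
  assert (Hu' : Rabs (u - t) < a) by exact Hu. apply Rabs_lt_between in Hu'.
  symmetry; apply perext_eq; lra.
Qed.

Lemma perext_derive g T (k : Z) t l : 0 < T -> IZR k * T < t < (IZR k + 1) * T ->
  is_derive g (t - IZR k * T) l -> is_derive (perext g T) t l.
Proof.
  intros HT Hk Hd. apply (is_derive_ext_loc _ _ _ _ (perext_locally g T k t HT Hk)).
  replace l with (1 * l) by ring.
  apply (is_derive_comp g (fun u => u - IZR k * T)); auto. auto_derive; auto; ring.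
Qed.

Lemma perext_continuous g T : 0 < T -> (forall t, continuous g t) -> g T = g 0 ->
  forall t, continuous (perext g T) t.
Proof.
  intros HT Hc Hg t. destruct (floor_multiple T t HT) as [k Hk].
  destruct (Rle_lt_or_eq_dec _ _ (proj1 Hk)) as [Hlt|Heq].
  - apply (continuous_ext_loc _ (fun u => g (u - IZR k * T))).
    + apply perext_locally; auto; lra.
    + apply (continuous_comp (fun u => u - IZR k * T) g); [|apply Hc].
      apply (is_derive_continuous _ _ 1). auto_derive; auto; ring.
  (* At a multiple of [T], points to the right read [g] near 0 and points to the left read [g] near
     [T]; the two are glued by [g T = g 0]. *)
  - apply continuous_eps; intros eps Heps.
    destruct (proj1 (continuous_eps _ _) (Hc 0) eps Heps) as [d1 [Hd1 H1]].
    destruct (proj1 (continuous_eps _ _) (Hc T) eps Heps) as [d2 [Hd2 H2]].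
    exists (Rmin T (Rmin d1 d2)); split; [repeat apply Rmin_pos; auto|].
    intros u Hu.
    assert (A1 : Rabs (u - t) < T) by (eapply Rlt_le_trans; [exact Hu|apply Rmin_l]).
    assert (A2 : Rabs (u - t) < d1)
      by (eapply Rlt_le_trans; [exact Hu|eapply Rle_trans; [apply Rmin_r|apply Rmin_l]]).
    assert (A3 : Rabs (u - t) < d2)
      by (eapply Rlt_le_trans; [exact Hu|eapply Rle_trans; [apply Rmin_r|apply Rmin_r]]).
    rewrite (perext_eq g T k t HT Hk).
    replace (t - IZR k * T) with 0 by lra.
    apply Rabs_lt_between in A1.
    destruct (Rle_dec t u) as [Hut|Hut].
    + rewrite (perext_eq g T k u HT) by lra. apply H1.
      rewrite Heq. replace (u - t - 0) with (u - t) by ring. auto.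
    + rewrite (perext_eq g T (k - 1) u HT) by (rewrite minus_IZR; lra).
      rewrite <- Hg. apply H2. rewrite minus_IZR.
      replace (u - (IZR k - 1) * T - T) with (u - t) by lra. auto.
Qed.

(** The linear lower bound alone gives surjectivity, by the intermediate value theorem on an
    interval of half-length [Rabs y / a], and an inverse that is Lipschitz with constant [/ a]. The
    derivative is treated pointwise because [tau] will be a clock with corners at the switching
    angle. *)
Lemma increasing_inverse (tau : R -> R) (a : R) :
  0 < a -> (forall t, continuous tau t) -> tau 0 = 0 ->
  (forall t t', t <= t' -> a * (t' - t) <= tau t' - tau t) ->
  exists th : R -> R, (forall t, tau (th t) = t) /\ (forall x, th (tau x) = x) /\
    (forall t, continuous th t) /\
    (forall t l, l <> 0 -> is_derive tau (th t) l -> is_derive th t (/ l)).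
Proof.
  intros Ha Hc H0 Hinc.
  assert (Habs : forall x x', a * Rabs (x - x') <= Rabs (tau x - tau x')).
  { intros x x'. destruct (Rle_dec x' x) as [H|H].
    - generalize (Hinc _ _ H) (Rle_abs (tau x - tau x')). rewrite (Rabs_pos_eq (x - x')) by lra. lra.
    - assert (H' : x <= x') by lra.
      generalize (Hinc _ _ H') (Rle_abs (- (tau x - tau x'))). rewrite Rabs_Ropp, (Rabs_left (x - x')) by lra.
      lra. }
  assert (Hinv : forall y, { x | tau x = y }).
  { intros y. set (b := Rabs y / a).
    assert (Hb : 0 <= b) by (apply Rdiv_le_0_compat; auto using Rabs_pos).
    assert (Eb : a * b = Rabs y) by (unfold b; field; lra).
    destruct (IVT_cor (fun x => tau x - y) (- b) b) as [x [_ Hx]].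
    - intros x. apply continuity_pt_minus; [apply continuity_pt_filterlim, Hc|].
      apply continuity_pt_const; intros ? ?; auto.
    - lra.
    - generalize (Hinc 0 b Hb) (Hinc (- b) 0) (Rle_abs y) (Rle_abs (- y)).
      rewrite Rabs_Ropp, H0. intros A1 A2 A3 A4.
      assert (a * (0 - - b) <= 0 - tau (- b)) by (apply A2; lra). nra.
    - exists x; lra. }
  exists (fun y => proj1_sig (Hinv y)).
  assert (E1 : forall t, tau (proj1_sig (Hinv t)) = t) by (intros t; exact (proj2_sig (Hinv t))).
  assert (E2 : forall x, proj1_sig (Hinv (tau x)) = x).
  { intros x. generalize (Habs (proj1_sig (Hinv (tau x))) x) (Rabs_pos (proj1_sig (Hinv (tau x)) - x)).
    rewrite E1, Rminus_eq_0, Rabs_R0. intros B1 B2.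
    apply Rminus_diag_uniq. destruct (Req_dec (proj1_sig (Hinv (tau x)) - x) 0) as [|N]; auto.
    generalize (Rabs_pos_lt _ N); nra. }
  set (th := fun y => proj1_sig (Hinv y)).
  assert (Hl : forall x y, Rabs (th x - th y) <= / a * Rabs (x - y)).
  { intros x y. generalize (Habs (th x) (th y)). unfold th at 3 4. rewrite !E1. intros B.
    apply Rmult_le_reg_l with a; auto. rewrite <- Rmult_assoc, Rinv_r by lra. lra. }
  assert (Hct : forall t, continuous th t) by (apply (lipschitz_continuous th (/ a)), Hl).
  split; [exact E1|]. split; [exact E2|]. split; [exact Hct|].
  intros t l Hl0 Hd. change (is_derive th t (/ l)). change (is_derive tau (th t) l) in Hd.
  apply is_derive_Reals. apply is_derive_Reals in Hd.
  intros eps Heps.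
  assert (Hlp : 0 < Rabs l) by (apply Rabs_pos_lt; auto).
  (* The error [k / h - / l] equals [- (h / k - l) / ((h / k) * l)], and [Rabs (h / k) >= a]; the
     denominator thus costs at most the factor [a * Rabs l]. *)
  destruct (Hd (eps * (a * Rabs l))) as [d Hd']; [apply Rmult_lt_0_compat; nra|].
  destruct (proj1 (continuous_eps _ _) (Hct t) d (cond_pos d)) as [d' [Hd'p Hd'']].
  exists (mkposreal d' Hd'p). intros h Hh Hhd. simpl in Hhd.
  set (k := th (t + h) - th t).
  assert (Hk : th (t + h) = th t + k) by (unfold k; ring).
  assert (Eh : tau (th t + k) - tau (th t) = h).
  { rewrite <- Hk. unfold th; rewrite !E1; ring. }
  assert (Hk0 : k <> 0).
  { intros E. rewrite E, Rplus_0_r, Rminus_eq_0 in Eh. auto. }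
  assert (Hkd : Rabs k < d).
  { unfold k. apply Hd''. replace (t + h - t) with h by ring. auto. }
  specialize (Hd' k Hk0 Hkd). rewrite Eh in Hd'.
  assert (Hq : a <= Rabs (h / k)).
  { generalize (Habs (th t + k) (th t)). rewrite Eh. replace (th t + k - th t) with k by ring.
    intros B. unfold Rdiv. rewrite Rabs_mult, Rabs_inv.
    assert (0 < Rabs k) by (apply Rabs_pos_lt; auto).
    apply Rmult_le_reg_r with (Rabs k); auto. rewrite Rmult_assoc, Rinv_l by lra. lra. }
  replace (k / h - / l) with (- ((h / k - l) / ((h / k) * l))) by (field; auto).
  rewrite Rabs_Ropp. unfold Rdiv at 1. rewrite Rabs_mult, Rabs_inv, Rabs_mult.
  apply Rmult_lt_reg_r with (Rabs (h / k) * Rabs l); [nra|].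
  rewrite Rmult_assoc, Rinv_l by nra. rewrite Rmult_1_r.
  apply Rlt_le_trans with (1 := Hd').
  apply Rmult_le_compat_l; [lra|]. apply Rmult_le_compat_r; lra.
Qed.

(** * Polar coordinates along a curve *)

Definition radius (x y : R) : R := sqrt (x * x + y * y).

(** Values in [[0, 2 * PI)], with the jump on the half-line [x > 0]. One formula in [x / y] per open
    half-plane makes the angle differentiable off Sigma, exactly where the field is. The origin gets
    the default [PI]. *)
Definition arg (x y : R) : R :=
  if Rlt_dec 0 y then PI / 2 - atan (x / y)
  else if Rlt_dec y 0 then 3 * PI / 2 - atan (x / y)
  else if Rlt_dec 0 x then 0 else PI.

Lemma radius_sqr x y : radius x y * radius x y = x * x + y * y.
Proof. apply sqrt_sqrt. nra. Qed.

Lemma radius_ge0 x y : 0 <= radius x y.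
Proof. apply sqrt_pos. Qed.

Lemma radius_polar r t : 0 <= r -> radius (r * cos t) (r * sin t) = r.
Proof.
  intros Hr. unfold radius.
  replace (r * cos t * (r * cos t) + r * sin t * (r * sin t)) with (r * r).
  - apply sqrt_square; auto.
  - generalize (sin2_cos2 t); unfold Rsqr; intros E.
    replace (r * r) with (r * r * (sin t * sin t + cos t * cos t)) by (rewrite E; ring). ring.
Qed.

Lemma radius_triangle a b c d : radius (a + c) (b + d) <= radius a b + radius c d.
Proof.
  generalize (radius_ge0 a b) (radius_ge0 c d) (radius_ge0 (a + c) (b + d)).
  generalize (radius_sqr a b) (radius_sqr c d) (radius_sqr (a + c) (b + d)).
  set (p := radius a b). set (q := radius c d). set (m := radius (a + c) (b + d)).
  intros E1 E2 E3 Hp Hq Hm.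
  (* Cauchy-Schwarz, from the nonnegativity of the square of [a * d - b * c]. *)
  assert (H : a * c + b * d <= p * q).
  { apply Rsqr_incr_0_var; [unfold Rsqr|apply Rmult_le_pos; auto].
    replace (p * q * (p * q)) with ((p * p) * (q * q)) by ring. rewrite E1, E2.
    generalize (Rle_0_sqr (a * d - b * c)); unfold Rsqr; lra. }
  apply Rsqr_incr_0_var; [unfold Rsqr|]; lra.
Qed.

Lemma radius_lip x y x' y' : Rabs (radius x y - radius x' y') <= radius (x - x') (y - y').
Proof.
  assert (S : radius (x' - x) (y' - y) = radius (x - x') (y - y')) by (unfold radius; f_equal; ring).
  generalize (radius_triangle x' y' (x - x') (y - y')) (radius_triangle x y (x' - x) (y' - y)).
  rewrite S. replace (x' + (x - x')) with x by ring. replace (y' + (y - y')) with y by ring.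
  replace (x + (x' - x)) with x' by ring. replace (y + (y' - y)) with y' by ring.
  intros A B. apply Rabs_le_between. lra.
Qed.

Lemma Rabs_le_radius x y : Rabs x <= radius x y /\ Rabs y <= radius x y.
Proof.
  generalize (radius_sqr x y) (radius_ge0 x y); intros E Hp.
  split; rewrite <- (Rabs_pos_eq (radius x y)) by auto; apply Rsqr_le_abs_0; unfold Rsqr; nra.
Qed.

(** The hypotheses give [cos (t - t') = 1], so half the difference is a zero of the sine strictly
    between [- PI] and [PI]. *)
Lemma polar_angle_unique t t' : 0 <= t < 2 * PI -> 0 <= t' < 2 * PI ->
  cos t = cos t' -> sin t = sin t' -> t = t'.
Proof.
  intros Ht Ht' Hc Hs.
  assert (E : cos (t - t') = 1).
  { rewrite cos_minus, Hc, Hs. generalize (sin2_cos2 t'); unfold Rsqr; lra. }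
  replace (t - t') with (2 * ((t - t') / 2)) in E by field.
  rewrite cos_2a_sin in E.
  assert (E' : sin ((t - t') / 2) = 0) by nra.
  destruct (Rtotal_order ((t - t') / 2) 0) as [H|[H|H]]; [|lra|].
  - generalize (sin_gt_0 (- ((t - t') / 2)) ltac:(lra) ltac:(lra)). rewrite sin_neg; lra.
  - generalize (sin_gt_0 ((t - t') / 2) H ltac:(lra)); lra.
Qed.

Lemma arg_upper x y : 0 < y -> arg x y = PI / 2 - atan (x / y).
Proof. intros H; unfold arg; destruct Rlt_dec; [auto|lra]. Qed.

Lemma arg_lower x y : y < 0 -> arg x y = 3 * PI / 2 - atan (x / y).
Proof. intros H; unfold arg; destruct Rlt_dec; [lra|]. destruct Rlt_dec; [auto|lra]. Qed.

Lemma arg_right x : 0 < x -> arg x 0 = 0.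
Proof. intros H; unfold arg; repeat (destruct Rlt_dec; try lra). Qed.

Lemma arg_left x : x < 0 -> arg x 0 = PI.
Proof. intros H; unfold arg; repeat (destruct Rlt_dec; try lra). Qed.

Lemma arg_upper_in x y : 0 < y -> 0 < arg x y < PI.
Proof. intros H; rewrite arg_upper by auto. generalize (atan_bound (x / y)); lra. Qed.

Lemma arg_lower_in x y : y < 0 -> PI < arg x y < 2 * PI.
Proof. intros H; rewrite arg_lower by auto. generalize (atan_bound (x / y)); lra. Qed.

Lemma radius_atan x y : y <> 0 ->
  radius x y * cos (atan (x / y)) = Rabs y /\ radius x y * sin (atan (x / y)) * y = x * Rabs y.
Proof.
  intros Hy. rewrite cos_atan, sin_atan.
  assert (Hp : 0 < Rabs y) by (apply Rabs_pos_lt; auto).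
  assert (Hs : 0 < sqrt (1 + (x / y)²)) by (apply sqrt_lt_R0; generalize (Rle_0_sqr (x / y)); lra).
  assert (E : radius x y = Rabs y * sqrt (1 + (x / y)²)).
  { unfold radius. rewrite <- (sqrt_Rsqr_abs y).
    rewrite <- sqrt_mult_alt by apply Rle_0_sqr. f_equal. unfold Rsqr; field; auto. }
  rewrite E. split; field; lra.
Qed.

Lemma arg_polar x y : (x <> 0 \/ y <> 0) ->
  radius x y * cos (arg x y) = x /\ radius x y * sin (arg x y) = y.
Proof.
  intros H. destruct (Rtotal_order y 0) as [Hy|[Hy|Hy]].
  - destruct (radius_atan x y) as [H1 H2]; [lra|]. rewrite Rabs_left in H1, H2 by auto.
    rewrite arg_lower by auto. set (a := atan (x / y)) in *.
    replace (3 * PI / 2 - a) with ((PI / 2 - a) + PI) by field.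
    rewrite neg_cos, neg_sin, cos_shift, sin_shift. split; [|lra].
    apply Rmult_eq_reg_r with y; lra.
  - subst y. destruct (Rtotal_order x 0) as [Hx|[Hx|Hx]]; [|lra|].
    + rewrite arg_left, cos_PI, sin_PI by auto. unfold radius.
      replace (x * x + 0 * 0) with (- x * - x) by ring. rewrite sqrt_square by lra. lra.
    + rewrite arg_right, cos_0, sin_0 by auto. unfold radius.
      replace (x * x + 0 * 0) with (x * x) by ring. rewrite sqrt_square by lra. lra.
  - destruct (radius_atan x y) as [H1 H2]; [lra|]. rewrite Rabs_pos_eq in H1, H2 by lra.
    rewrite arg_upper by auto. rewrite cos_shift, sin_shift. split; [|lra].
    apply Rmult_eq_reg_r with y; lra.
Qed.

Lemma radius_derive (x y : R -> R) t dx dy : 0 < radius (x t) (y t) ->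
  is_derive x t dx -> is_derive y t dy ->
  is_derive (fun t => radius (x t) (y t)) t ((x t * dx + y t * dy) / radius (x t) (y t)).
Proof.
  intros Hr Hx Hy. unfold radius in *.
  assert (Hp : 0 < x t * x t + y t * y t).
  { destruct (Rlt_dec 0 (x t * x t + y t * y t)); auto. rewrite sqrt_neg_0 in Hr by lra; lra. }
  auto_derive.
  - split; [exists dx; auto|]. split; [exists dx; auto|]. split; [exists dy; auto|].
    split; [exists dy; auto|]. auto.
  - assert (Ex : Derive (fun u : R => x u) t = dx) by (apply is_derive_unique; exact Hx).
    assert (Ey : Derive (fun u : R => y u) t = dy) by (apply is_derive_unique; exact Hy).
    rewrite Ex, Ey.
    field. apply Rgt_not_eq, sqrt_lt_R0, Hp.
Qed.

Lemma continuous_ratio (x y : R -> R) t : continuous x t -> continuous y t -> y t <> 0 ->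
  continuous (fun t => x t / y t) t.
Proof.
  intros Hx Hy H. unfold Rdiv.
  apply (@continuous_mult R_UniformSpace R_AbsRing x (fun t => / y t)); auto.
  apply (continuous_comp y Rinv); auto. apply continuous_Rinv; auto.
Qed.

Lemma continuous_atan_at x : continuous atan x.
Proof. apply (is_derive_continuous atan x (/ (1 + x²))). apply is_derive_atan. Qed.

Lemma radius_continuous (x y : R -> R) t : continuous x t -> continuous y t ->
  continuous (fun t => radius (x t) (y t)) t.
Proof.
  intros Hx Hy. unfold radius. apply (continuous_comp (fun t => x t * x t + y t * y t) sqrt).
  - apply (@continuous_plus R_UniformSpace R_AbsRing R_NormedModule
             (fun t => x t * x t) (fun t => y t * y t));
      [apply (@continuous_mult R_UniformSpace R_AbsRing x x)
      |apply (@continuous_mult R_UniformSpace R_AbsRing y y)]; auto.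
  - apply continuity_pt_filterlim, continuity_pt_sqrt. nra.
Qed.

Lemma arg_derive (x y : R -> R) t dx dy : continuous y t -> y t <> 0 ->
  is_derive x t dx -> is_derive y t dy ->
  is_derive (fun t => arg (x t) (y t)) t
    ((x t * dy - y t * dx) / (radius (x t) (y t) * radius (x t) (y t))).
Proof.
  intros Hc Hy Hx Hdy.
  assert (Hp : 0 < x t * x t + y t * y t) by nra.
  assert (D : forall c, is_derive (fun t => c - atan (x t / y t)) t
    ((x t * dy - y t * dx) / (radius (x t) (y t) * radius (x t) (y t)))).
  { intros c. rewrite radius_sqr.
    assert (Dq : is_derive (fun t => x t / y t) t ((dx * y t - x t * dy) / (y t * y t))).
    { replace ((dx * y t - x t * dy) / (y t * y t)) with ((dx * y t - x t * dy) / (y t ^ 2))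
        by (field; auto).
      apply is_derive_div; auto. }
    replace ((x t * dy - y t * dx) / (x t * x t + y t * y t)) with
      (- (((dx * y t - x t * dy) / (y t * y t)) * / (1 + (x t / y t)²))).
    - apply is_derive_const_plus.
      apply (@is_derive_opp R_AbsRing R_NormedModule (fun t => atan (x t / y t))).
      apply (is_derive_comp atan (fun t => x t / y t)); [apply is_derive_atan|exact Dq].
    - unfold Rsqr. field. repeat split; nra. }
  assert (Hay : 0 < Rabs (y t)) by (apply Rabs_pos_lt; auto).
  destruct (proj1 (continuous_eps _ _) Hc _ Hay) as [d [Hd Hd']].
  destruct (Rlt_dec 0 (y t)) as [P|P].
  - apply (is_derive_ext_loc (fun t => PI / 2 - atan (x t / y t))); [|apply D].
    exists (mkposreal d Hd); intros u Hu. symmetry. apply arg_upper.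
    specialize (Hd' u Hu). rewrite (Rabs_pos_eq (y t)) in Hd' by lra.
    apply Rabs_lt_between in Hd'; lra.
  - apply (is_derive_ext_loc (fun t => 3 * PI / 2 - atan (x t / y t))); [|apply D].
    exists (mkposreal d Hd); intros u Hu. symmetry. apply arg_lower.
    specialize (Hd' u Hu). rewrite (Rabs_left (y t)) in Hd' by lra.
    apply Rabs_lt_between in Hd'; lra.
Qed.

Lemma continuous_sign (x : R -> R) t : continuous x t -> x t <> 0 ->
  locally t (fun u => 0 < x u * x t).
Proof.
  intros Hc Hx. assert (Hp : 0 < Rabs (x t)) by (apply Rabs_pos_lt; auto).
  destruct (proj1 (continuous_eps _ _) Hc _ Hp) as [d [Hd H]].
  exists (mkposreal d Hd); intros u Hu. specialize (H u Hu).
  revert H. unfold Rabs; repeat destruct Rcase_abs; nra.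
Qed.

(* The angle jumps by [2 * PI] on the half-line [x > 0], where it is replaced by [atan (y / x)]. *)
Lemma arg_comp_continuous (g x y : R -> R) t :
  (forall t, continuous g t) -> g (2 * PI) = g 0 ->
  continuous x t -> continuous y t -> (x t <> 0 \/ y t <> 0) ->
  continuous (fun t => g (arg (x t) (y t))) t.
Proof.
  intros Hg Hgp Hx Hy Hxy. generalize PI_RGT_0; intros HPI.
  assert (HT : 0 < 2 * PI) by lra.
  destruct (Req_dec (x t) 0) as [Ex|Nx].
  - assert (Ny : y t <> 0) by (destruct Hxy; auto).
    assert (D : forall c, continuous (fun t => g (c - atan (x t / y t))) t).
    { intros c. apply (continuous_comp (fun t => c - atan (x t / y t)) g); [|apply Hg].
      apply (continuous_const_plus (fun t => - atan (x t / y t))).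
      apply (@continuous_opp R_UniformSpace R_AbsRing R_NormedModule (fun t => atan (x t / y t))).
      apply (continuous_comp (fun t => x t / y t) atan); [|apply continuous_atan_at].
      apply continuous_ratio; auto. }
    generalize (continuous_sign y t Hy Ny); intros Hs.
    destruct (Rlt_dec 0 (y t)) as [P|P].
    + apply (continuous_ext_loc _ (fun t => g (PI / 2 - atan (x t / y t)))); [|apply D].
      revert Hs; apply filter_imp; intros u Hu. rewrite arg_upper; auto. nra.
    + apply (continuous_ext_loc _ (fun t => g (3 * PI / 2 - atan (x t / y t)))); [|apply D].
      revert Hs; apply filter_imp; intros u Hu. rewrite arg_lower; auto. nra.
  - assert (D : forall c, continuous (fun t => perext g (2 * PI) (c + atan (y t / x t))) t).
    { intros c. apply (continuous_comp (fun t => c + atan (y t / x t)) (perext g (2 * PI)));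
        [|apply perext_continuous; auto].
      apply continuous_const_plus.
      apply (continuous_comp (fun t => y t / x t) atan); [|apply continuous_atan_at].
      apply continuous_ratio; auto. }
    assert (Hinv : forall a b, 0 < a -> 0 < b -> atan (b / a) = PI / 2 - atan (a / b)).
    { intros a b Ha Hb. replace (b / a) with (/ (a / b)) by (field; lra).
      apply atan_inv. apply Rdiv_lt_0_compat; auto. }
    generalize (continuous_sign x t Hx Nx); intros Hs.
    destruct (Rlt_dec 0 (x t)) as [P|P].
    + apply (continuous_ext_loc _ (fun t => perext g (2 * PI) (0 + atan (y t / x t)))); [|apply D].
      revert Hs; apply filter_imp; intros u Hu. assert (Hxu : 0 < x u) by nra.
      destruct (Rtotal_order (y u) 0) as [Q|[Q|Q]].
      * rewrite <- perext_shift by auto.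
        replace (0 + atan (y u / x u) + 2 * PI) with (arg (x u) (y u)).
        { apply perext_id; auto. generalize (arg_lower_in (x u) (y u) Q); lra. }
        rewrite arg_lower by auto.
        replace (y u / x u) with (- (- y u / x u)) by (field; lra).
        rewrite atan_opp, (Hinv (x u) (- y u)) by lra.
        replace (x u / y u) with (- (x u / - y u)) by (field; lra).
        rewrite atan_opp. field.
      * rewrite Q, arg_right by auto. unfold Rdiv. rewrite Rmult_0_l, atan_0, Rplus_0_r.
        apply perext_id; auto; lra.
      * replace (0 + atan (y u / x u)) with (arg (x u) (y u)).
        { apply perext_id; auto. generalize (arg_upper_in (x u) (y u) Q); lra. }
        rewrite arg_upper, (Hinv (x u) (y u)) by auto. ring.
    + apply (continuous_ext_loc _ (fun t => perext g (2 * PI) (PI + atan (y t / x t)))); [|apply D].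
      revert Hs; apply filter_imp; intros u Hu. assert (Hxu : x u < 0) by nra.
      destruct (Rtotal_order (y u) 0) as [Q|[Q|Q]].
      * replace (PI + atan (y u / x u)) with (arg (x u) (y u)).
        { apply perext_id; auto. generalize (arg_lower_in (x u) (y u) Q); lra. }
        rewrite arg_lower by auto.
        replace (y u / x u) with (- y u / - x u) by (field; lra).
        rewrite (Hinv (- x u) (- y u)) by lra.
        replace (x u / y u) with (- x u / - y u) by (field; lra). field.
      * rewrite Q, arg_left by auto. unfold Rdiv. rewrite Rmult_0_l, atan_0, Rplus_0_r.
        apply perext_id; auto; lra.
      * replace (PI + atan (y u / x u)) with (arg (x u) (y u)).
        { apply perext_id; auto. generalize (arg_upper_in (x u) (y u) Q); lra. }
        rewrite arg_upper by auto.
        replace (y u / x u) with (- (y u / - x u)) by (field; lra).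
        rewrite atan_opp, (Hinv (- x u) (y u)) by lra.
        replace (x u / y u) with (- (- x u / y u)) by (field; lra).
        rewrite atan_opp. field.
Qed.

(** The equality case of Cauchy-Schwarz: Lagrange's identity expresses the square of [y * c - x * s]
    as a difference that vanishes here. *)
Lemma polar_parallel x y c s : (x <> 0 \/ y <> 0) -> c * c + s * s = 1 ->
  radius x y - (x * c + y * s) = 0 -> x = radius x y * c /\ y = radius x y * s.
Proof.
  intros Hxy Hcs H. generalize (radius_sqr x y); intros E.
  set (p := radius x y) in *.
  assert (Hq : (y * c - x * s) * (y * c - x * s) = 0).
  { replace ((y * c - x * s) * (y * c - x * s))
      with ((x * x + y * y) * (c * c + s * s) - (x * c + y * s) * (x * c + y * s)) by ring.
    rewrite Hcs, <- E. replace (x * c + y * s) with p by lra. ring. }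
  assert (Hq' : y * c - x * s = 0) by nra.
  split.
  - replace p with (x * c + y * s) by lra.
    replace x with (x * (c * c + s * s)) at 1 by (rewrite Hcs; ring).
    replace ((x * c + y * s) * c) with (x * (c * c) + (y * c) * s) by ring.
    replace (y * c) with (x * s) by lra. ring.
  - replace p with (x * c + y * s) by lra.
    replace y with (y * (c * c + s * s)) at 1 by (rewrite Hcs; ring).
    replace ((x * c + y * s) * s) with ((x * s) * c + y * (s * s)) by ring.
    replace (x * s) with (y * c) by lra. ring.
Qed.

(* If the angle [th] were avoided, then with angles measured from [th] the cotangent of the
   half-angle, [Y / (radius - X)], would be periodic and strictly monotone. *)
Lemma rotating_curve_covers (x y : R -> R) (T : R) (th : R) :
  0 < T -> (forall t, continuous x t) -> (forall t, continuous y t) ->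
  (forall t, x (t + T) = x t) -> (forall t, y (t + T) = y t) ->
  (forall t, x t <> 0 \/ y t <> 0) ->
  (forall t, exists del, 0 < del /\ forall u, 0 < Rabs (u - t) < del ->
     exists dx dy, is_derive x u dx /\ is_derive y u dy /\ 0 < x u * dy - y u * dx) ->
  exists t, x t = radius (x t) (y t) * cos th /\ y t = radius (x t) (y t) * sin th.
Proof.
  intros HT Hx Hy Px Py Hxy Hreg.
  apply Classical_Prop.NNPP; intros Hno.
  set (c := cos th) in *. set (s := sin th) in *.
  assert (Hcs : c * c + s * s = 1) by (generalize (sin2_cos2 th); unfold c, s, Rsqr; lra).
  assert (Hden : forall t, radius (x t) (y t) - (x t * c + y t * s) <> 0).
  { intros t E. apply Hno. exists t. apply polar_parallel; auto. }
  assert (Hpos : forall t, 0 < radius (x t) (y t)).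
  { intros t. apply sqrt_lt_R0. destruct (Hxy t); nra. }
  assert (Hlin : forall a b t, continuous (fun t => x t * a + y t * b) t).
  { intros a b t. apply (@continuous_plus R_UniformSpace R_AbsRing R_NormedModule
      (fun t => x t * a) (fun t => y t * b));
      [apply (@continuous_mult R_UniformSpace R_AbsRing x (fun _ => a))
      |apply (@continuous_mult R_UniformSpace R_AbsRing y (fun _ => b))]; auto;
      apply continuous_const. }
  set (q := fun t => (x t * - s + y t * c) / (radius (x t) (y t) - (x t * c + y t * s))).
  assert (Hq : forall t, continuous q t).
  { intros t. apply (continuous_ratio (fun t => x t * - s + y t * c)
      (fun t => radius (x t) (y t) - (x t * c + y t * s))); auto.
    apply (@continuous_minus R_UniformSpace R_AbsRing R_NormedModule
      (fun t => radius (x t) (y t)) (fun t => x t * c + y t * s)); auto.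
    apply radius_continuous; auto. }
  assert (Pq : forall t, q (t + T) = q t) by (intros t; unfold q; rewrite Px, Py; auto).
  destruct (periodic_max q T HT Hq Pq) as [t0 Hmax].
  destruct (Hreg t0) as [del [Hdel Hd]].
  apply (max_not_monotone q t0 (-1) del Hq Hmax Hdel).
  intros u Hu. destruct (Hd u Hu) as [dx [dy [Dx [Dy Hw]]]].
  generalize (radius_derive x y u dx dy (Hpos u) Dx Dy); intros Dr.
  generalize (Hden u) (Hpos u) (radius_sqr (x u) (y u)); intros H1 H2 E.
  assert (Ex : Derive (fun u : R => x u) u = dx) by (apply is_derive_unique; exact Dx).
  assert (Ey : Derive (fun u : R => y u) u = dy) by (apply is_derive_unique; exact Dy).
  (* The cotangent of half an angle [a] has derivative [- a' / (1 - cos a)]. Here [a'] is the areal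
     velocity over the squared radius, and [1 - cos a] is the denominator of [q] over the radius. *)
  exists (- ((x u * dy - y u * dx) / (radius (x u) (y u) * (radius (x u) (y u) - (x u * c + y u * s))))).
  split.
  - assert (Dn : is_derive (fun t => x t * - s + y t * c) u (dx * - s + dy * c)).
    { auto_derive; [split; [exists dx|split; [exists dy|]]; auto|].
      rewrite Ex, Ey; ring. }
    assert (Dm : is_derive (fun t => radius (x t) (y t) - (x t * c + y t * s)) u
      ((x u * dx + y u * dy) / radius (x u) (y u) - (dx * c + dy * s))).
    { apply (@is_derive_minus R_AbsRing R_NormedModule (fun t => radius (x t) (y t))
        (fun t => x t * c + y t * s)); auto.
      auto_derive; [split; [exists dx|split; [exists dy|]]; auto|].
      rewrite Ex, Ey; ring. }
    generalize (is_derive_div _ _ u _ _ Dn Dm H1); intros Dq.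
    cbv beta in Dq.
    match type of Dq with is_derive _ _ ?l =>
      match goal with |- is_derive _ _ ?m => replace m with l; [exact Dq|] end end.
    set (p := radius (x u) (y u)) in *. set (X := x u) in *. set (Y := y u) in *.
    apply Rmult_eq_reg_r with (p * (p - (X * c + Y * s)) ^ 2);
      [|apply Rmult_integral_contrapositive_currified; [lra|apply pow_nonzero; auto]].
    transitivity ((dx * - s + dy * c) * (p * p - p * (X * c + Y * s))
      - (X * - s + Y * c) * (X * dx + Y * dy - p * (dx * c + dy * s))).
    { field. split; auto; lra. }
    transitivity (- (X * dy - Y * dx) * (p - (X * c + Y * s))); [|field; split; auto; lra].
    rewrite E.
    replace (- (X * dy - Y * dx) * (p - (X * c + Y * s))) with
      (- (X * dy - Y * dx) * p * 1 + (X * dy - Y * dx) * (X * c + Y * s) * 1) by ring.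
    replace ((dx * - s + dy * c) * (X * X + Y * Y - p * (X * c + Y * s)) -
      (X * - s + Y * c) * (X * dx + Y * dy - p * (dx * c + dy * s))) with
      (- (X * dy - Y * dx) * p * (c * c + s * s) + (X * dy - Y * dx) * (X * c + Y * s)) by ring.
    rewrite Hcs. ring.
  - assert (Hd0 : 0 < radius (x u) (y u) - (x u * c + y u * s)).
    { set (p := radius (x u) (y u)) in *.
      assert (Hle : (x u * c + y u * s) * (x u * c + y u * s) <= p * p).
      { rewrite E. replace (x u * x u + y u * y u)
          with ((x u * x u + y u * y u) * (c * c + s * s)) by (rewrite Hcs; ring).
        generalize (Rle_0_sqr (x u * s - y u * c)); unfold Rsqr; lra. }
      assert (x u * c + y u * s <= p) by nra. lra. }
    replace (-1 * - ((x u * dy - y u * dx) /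
      (radius (x u) (y u) * (radius (x u) (y u) - (x u * c + y u * s)))))
      with ((x u * dy - y u * dx) /
      (radius (x u) (y u) * (radius (x u) (y u) - (x u * c + y u * s)))) by (field; lra).
    apply Rdiv_lt_0_compat; auto. apply Rmult_lt_0_compat; auto.
Qed.

(** * Uniqueness *)

Lemma continuous_abs_gt (f : R -> R) (t c : R) : continuous f t -> c < Rabs (f t) ->
  exists del, 0 < del /\ forall u, Rabs (u - t) < del -> c < Rabs (f u).
Proof.
  intros Hf Hc. assert (Hp : 0 < Rabs (f t) - c) by lra.
  destruct (proj1 (continuous_eps _ _) Hf _ Hp) as [d [Hd H]].
  exists d; split; auto. intros u Hu. specialize (H u Hu).
  generalize (Rabs_triang_inv (f t) (f u)). rewrite Rabs_minus_sym; lra.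
Qed.

Lemma sqr_max_abs (f : R -> R) (t0 : R) :
  (forall t, f t * f t <= f t0 * f t0) -> forall t, Rabs (f t) <= Rabs (f t0).
Proof. intros H t. apply Rsqr_le_abs_0, H. Qed.

Lemma is_derive_sqr (f : R -> R) (t l : R) : is_derive f t l ->
  is_derive (fun t => f t * f t) t (2 * (f t * l)).
Proof.
  intros H. replace (2 * (f t * l)) with (l * f t + f t * l) by ring.
  apply (is_derive_mult f f); auto. intros; apply Rmult_comm.
Qed.

Lemma continuous_sqr (f : R -> R) (t : R) : continuous f t -> continuous (fun t => f t * f t) t.
Proof. intros H; apply (@continuous_mult R_UniformSpace R_AbsRing f f); auto. Qed.

(** A trajectory obeys its equations except at isolated crossing instants, so they are available on
    punctured neighbourhoods only. *)
Definition regular_near (reg : R -> Prop) : Prop :=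
  forall t, exists del, 0 < del /\ forall u, 0 < Rabs (u - t) < del -> reg u.

(* At a maximum of [Dw ^ 2] the damping forces [|Dw| = O(e max |Dr|)]; then the averaged variable
   [Dr (1 - e B)] obeys [V' = sp e (Ab V + small)], so its square has no maximum unless [Dr = 0]. *)
Theorem averaging_rigidity (Dr Dw B : R -> R) (reg : R -> Prop) (T e Ab K KB kap : R) :
  0 < T -> e <> 0 -> 0 < K -> 0 < KB -> 0 <= kap ->
  (forall t, continuous Dr t) -> (forall t, continuous Dw t) -> (forall t, continuous B t) ->
  (forall t, Dr (t + T) = Dr t) -> (forall t, Dw (t + T) = Dw t) -> (forall t, B (t + T) = B t) ->
  (forall t, Rabs (B t) <= KB) ->
  Rabs e * K <= / 2 -> Rabs e * KB <= / 8 ->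
  kap + 2 * Rabs e * K * K + 2 * Rabs e * KB * K < Rabs Ab / 2 ->
  regular_near reg ->
  (forall t, reg t -> exists sp A dG dW, 0 < sp /\
     is_derive Dr t (sp * (e * dG)) /\ is_derive Dw t (sp * (- Dw t + e * dW)) /\
     is_derive B t (sp * (A - Ab)) /\
     Rabs (dG - A * Dr t) <= kap * Rabs (Dr t) + K * Rabs (Dw t) /\
     Rabs dG <= K * (Rabs (Dr t) + Rabs (Dw t)) /\
     Rabs dW <= K * (Rabs (Dr t) + Rabs (Dw t))) ->
  forall t, Dr t = 0 /\ Dw t = 0.
Proof.
  intros HT He HK HKB Hkap Cr Cw CB Pr Pw PB BB E1 E2 E3 Hreg Hode.
  assert (Hep : 0 < Rabs e) by (apply Rabs_pos_lt; auto).
  assert (HeK : 0 < Rabs e * K) by nra. assert (HeKB : 0 < Rabs e * KB) by nra.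
  assert (HAb : 0 < Rabs Ab) by nra.
  destruct (periodic_max (fun t => Dw t * Dw t) T HT) as [t0 M0];
    [intros; apply continuous_sqr, Cw|intros t; rewrite Pw; auto|].
  destruct (periodic_max (fun t => Dr t * Dr t) T HT) as [t1 M1];
    [intros; apply continuous_sqr, Cr|intros t; rewrite Pr; auto|].
  generalize (sqr_max_abs _ _ M0) (sqr_max_abs _ _ M1); intros N0 N1.
  set (N := Rabs (Dw t0)) in *. set (Mr := Rabs (Dr t1)) in *.
  assert (HN : 0 <= N) by apply Rabs_pos. assert (HMr : 0 <= Mr) by apply Rabs_pos.
  assert (Hw : N <= Rabs e * K * (Mr + N)).
  { destruct (Rle_dec N (Rabs e * K * (Mr + N))) as [|Hn]; auto; exfalso.
    assert (Hn' : Rabs e * K * (Mr + N) < Rabs (Dw t0)) by (fold N; lra).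
    destruct (continuous_abs_gt Dw t0 _ (Cw t0) Hn') as [d1 [Hd1 H1]].
    destruct (Hreg t0) as [d2 [Hd2 H2]].
    apply (max_not_monotone (fun t => Dw t * Dw t) t0 (-1) (Rmin d1 d2)); auto.
    - intros; apply continuous_sqr, Cw.
    - apply Rmin_pos; auto.
    - intros u Hu. generalize (Rmin_l d1 d2) (Rmin_r d1 d2); intros L1 L2.
      assert (G1 := H1 u ltac:(lra)).
      destruct (Hode u) as [sp [A [dG [dW [Hsp [Ur [Uw [UB [F1 [F2 F3]]]]]]]]]]; [apply H2; lra|].
      exists (2 * (Dw u * (sp * (- Dw u + e * dW)))). split; [apply is_derive_sqr; auto|].
      replace (-1 * (2 * (Dw u * (sp * (- Dw u + e * dW)))))
        with (2 * sp * (Dw u * Dw u - e * (Dw u * dW))) by ring.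
      apply Rmult_lt_0_compat; [lra|].
      assert (B1 : Rabs (e * (Dw u * dW)) <= Rabs (Dw u) * (Rabs e * K * (Mr + N))).
      { rewrite !Rabs_mult.
        replace (Rabs e * (Rabs (Dw u) * Rabs dW)) with (Rabs (Dw u) * (Rabs e * Rabs dW)) by ring.
        apply Rmult_le_compat_l; [apply Rabs_pos|].
        rewrite Rmult_assoc. apply Rmult_le_compat_l; [lra|].
        apply Rle_trans with (1 := F3). apply Rmult_le_compat_l; [lra|].
        generalize (N0 u) (N1 u); lra. }
      assert (B2 : Dw u * Dw u = Rabs (Dw u) * Rabs (Dw u)).
      { rewrite <- Rabs_mult, Rabs_pos_eq; auto. nra. }
      assert (B3 : 0 < Rabs (Dw u)).
      { apply Rle_lt_trans with (2 := G1). apply Rmult_le_pos; [|lra]. nra. }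
      generalize (Rle_abs (e * (Dw u * dW))). nra. }
  assert (Hw' : N <= 2 * Rabs e * K * Mr) by nra.
  assert (HNM : N <= Mr) by nra.
  assert (Hz : Mr = 0).
  { destruct (Req_dec Mr 0) as [|Hn]; auto; exfalso.
    assert (HMp : 0 < Mr) by lra.
    assert (Hphi : forall t, 7 / 8 <= 1 - e * B t <= 9 / 8).
    { intros t. assert (Bd : Rabs (e * B t) <= / 8).
      { rewrite Rabs_mult. apply Rle_trans with (2 := E2).
        apply Rmult_le_compat_l; [lra|auto]. }
      apply Rabs_le_between in Bd. lra. }
    set (U := fun t => Dr t * (1 - e * B t)).
    assert (CU : forall t, continuous U t).
    { intros t. apply (@continuous_mult R_UniformSpace R_AbsRing Dr (fun t => 1 - e * B t)); auto.
      apply (continuous_const_plus (fun t => - (e * B t))).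
      apply (@continuous_opp R_UniformSpace R_AbsRing R_NormedModule (fun t => e * B t)).
      apply continuous_const_mult, CB. }
    destruct (periodic_max (fun t => U t * U t) T HT) as [t2 M2];
      [intros; apply continuous_sqr, CU|intros t; unfold U; rewrite Pr, PB; auto|].
    generalize (sqr_max_abs _ _ M2); intros N2.
    (* Comparison of [U] at [t2] and [t1]: the correcting factor lies between 7/8 and 9/8, so
       [Rabs (Dr t2)] is at least [7 / 9] of [Mr]. *)
    assert (Hbig : Mr / 2 < Rabs (Dr t2)).
    { generalize (N2 t1). unfold U. rewrite !Rabs_mult. fold Mr.
      generalize (Hphi t1) (Hphi t2); intros A1 A2.
      rewrite !(Rabs_pos_eq (1 - e * B _)) by lra.
      generalize (Rabs_pos (Dr t2)); nra. }
    destruct (continuous_abs_gt Dr t2 _ (Cr t2) Hbig) as [d1 [Hd1 H1]].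
    destruct (Hreg t2) as [d2 [Hd2 H2]].
    (* The square of [U] moves in the direction of [e * Ab]; taking this product as the sign treats
       growth and decay together. *)
    apply (max_not_monotone (fun t => U t * U t) t2 (e * Ab) (Rmin d1 d2)); auto.
    - intros; apply continuous_sqr, CU.
    - apply Rmin_pos; auto.
    - intros u Hu. generalize (Rmin_l d1 d2) (Rmin_r d1 d2); intros L1 L2.
      assert (G1 := H1 u ltac:(lra)).
      destruct (Hode u) as [sp [A [dG [dW [Hsp [Ur [Uw [UB [F1 [F2 F3]]]]]]]]]]; [apply H2; lra|].
      (* In [U'] the oscillating coefficient [A] of [Dr] cancels against the derivative of [B],
         leaving [Ab]. What remains is the linearization error and the product of the correction
         with [dG]. *)
      set (err := (dG - A * Dr u) - e * B u * dG).
      assert (DU : is_derive U u (sp * e * (Ab * Dr u + err))).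
      { replace (sp * e * (Ab * Dr u + err)) with
          (sp * (e * dG) * (1 - e * B u) + Dr u * - (e * (sp * (A - Ab)))) by (unfold err; ring).
        apply (is_derive_mult Dr (fun t => 1 - e * B t)); auto; [|intros; apply Rmult_comm].
        apply (is_derive_const_plus (fun t => - (e * B t))).
        apply (@is_derive_opp R_AbsRing R_NormedModule (fun t => e * B t)).
        apply is_derive_scal, UB. }
      exists (2 * (U u * (sp * e * (Ab * Dr u + err)))). split; [apply is_derive_sqr; auto|].
      unfold U.
      replace (e * Ab * (2 * (Dr u * (1 - e * B u) * (sp * e * (Ab * Dr u + err)))))
        with ((2 * sp * (e * e) * (1 - e * B u)) * (Ab * Ab * (Dr u * Dr u) + Ab * Dr u * err)) by ring.
      generalize (Hphi u); intros Hu'.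
      assert (Hee : 0 < e * e) by (apply Rsqr_pos_lt; auto).
      apply Rmult_lt_0_compat;
        [apply Rmult_lt_0_compat; [apply Rmult_lt_0_compat|]; lra|].
      assert (Be : Rabs err <= (kap + 2 * Rabs e * K * K + 2 * Rabs e * KB * K) * Mr).
      { unfold err. unfold Rminus at 1. apply Rle_trans with (1 := Rabs_triang _ _).
        rewrite Rabs_Ropp, !Rabs_mult.
        generalize (N0 u) (N1 u) (BB u) (Rabs_pos (B u)) (Rabs_pos dG); intros W0 W1 W2 W3 W4.
        assert (X1 : kap * Rabs (Dr u) <= kap * Mr) by (apply Rmult_le_compat_l; auto).
        assert (X2 : K * Rabs (Dw u) <= K * (2 * Rabs e * K * Mr)) by (apply Rmult_le_compat_l; lra).
        assert (X3 : Rabs dG <= K * (2 * Mr))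
          by (apply Rle_trans with (1 := F2); apply Rmult_le_compat_l; lra).
        assert (X4 : Rabs e * Rabs (B u) * Rabs dG <= Rabs e * KB * (K * (2 * Mr))).
        { apply Rmult_le_compat; auto; [nra|]. apply Rmult_le_compat_l; lra. }
        lra. }
      assert (Be' : Rabs err < Rabs Ab * Rabs (Dr u)).
      { apply Rle_lt_trans with (1 := Be). nra. }
      replace (Ab * Ab * (Dr u * Dr u)) with ((Ab * Dr u) * (Ab * Dr u)) by ring.
      rewrite <- Rabs_mult in Be'.
      revert Be'. generalize (Ab * Dr u) err. intros a b.
      unfold Rabs; repeat destruct Rcase_abs; nra. }
  intros t. generalize (N0 t) (N1 t) (Rabs_pos (Dr t)) (Rabs_pos (Dw t)); intros.
  split; [destruct (Req_dec (Dr t) 0) as [|Hn]; auto|destruct (Req_dec (Dw t) 0) as [|Hn]; auto];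
    generalize (Rabs_pos_lt _ Hn); lra.
Qed.

(** * Lipschitz bounds for smooth functions *)

Lemma mean_value_bound (g g' : R -> R) (a b L : R) :
  (forall x, derivable_pt_lim g x (g' x)) ->
  (forall x, Rmin a b <= x <= Rmax a b -> Rabs (g' x) <= L) ->
  Rabs (g b - g a) <= L * Rabs (b - a).
Proof.
  intros Hd HL. destruct (MVT_gen g a b g') as [c [Hc ->]].
  - intros x _. apply is_derive_Reals, Hd.
  - intros x _. apply derivable_continuous_pt. exists (g' x); apply Hd.
  - rewrite Rabs_mult. apply Rmult_le_compat_r; [apply Rabs_pos|auto].
Qed.

Lemma cont2_continuity_2d (F : R -> R -> R) (x y : R) : cont2 F -> continuity_2d_pt F x y.
Proof.
  intros HF eps. destruct (HF x y eps (cond_pos eps)) as [d [Hd H]].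
  assert (Hd2 : 0 < d / 2) by lra. exists (mkposreal _ Hd2); simpl; intros u v Hu Hv.
  apply H. apply Rabs_lt_between in Hu. apply Rabs_lt_between in Hv. nra.
Qed.

Lemma cont2_comp_continuous (F : R -> R -> R) (x y : R -> R) (t : R) : cont2 F ->
  continuous x t -> continuous y t -> continuous (fun t => F (x t) (y t)) t.
Proof.
  intros HF Hx Hy. apply continuous_eps; intros eps Heps.
  destruct (HF (x t) (y t) eps Heps) as [d [Hd H]].
  assert (Hd2 : 0 < d / 2) by lra.
  destruct (proj1 (continuous_eps _ _) Hx _ Hd2) as [d1 [Hd1 H1]].
  destruct (proj1 (continuous_eps _ _) Hy _ Hd2) as [d2 [Hd2' H2]].
  exists (Rmin d1 d2); split; [apply Rmin_pos; auto|]. intros u Hu.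
  assert (A1 := H1 u (Rlt_le_trans _ _ _ Hu (Rmin_l _ _))).
  assert (A2 := H2 u (Rlt_le_trans _ _ _ Hu (Rmin_r _ _))).
  apply H. apply Rabs_lt_between in A1. apply Rabs_lt_between in A2. nra.
Qed.

(** By uniform continuity the function changes by less than 1 over a short step. The segment from
    the origin to any point of the box is covered by [N] such steps inside the box. *)
Lemma cont2_bounded_box (F : R -> R -> R) (B : R) : cont2 F -> 0 <= B ->
  exists L, 0 <= L /\ forall x y, Rabs x <= B -> Rabs y <= B -> Rabs (F x y) <= L.
Proof.
  intros HF HB.
  destruct (uniform_continuity_2d F (- B) B (- B) B) with (eps := mkposreal 1 Rlt_0_1) as [d Hd].
  { intros; apply cont2_continuity_2d, HF. }
  simpl in Hd. destruct (nfloor_ex (B / d)) as [n Hn].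
  { apply Rdiv_le_0_compat; [auto|apply cond_pos]. }
  assert (HN : 0 < INR n + 1) by (generalize (pos_INR n); lra).
  set (N := INR n + 1) in *.
  assert (HBN : B / N < d).
  { destruct Hn as [_ Hn]. assert (Hdp := cond_pos d).
    apply Rmult_lt_reg_r with (N / d); [apply Rdiv_lt_0_compat; auto|].
    replace (B / N * (N / d)) with (B / d) by (field; lra).
    replace (d * (N / d)) with N by (field; lra). auto. }
  exists (Rabs (F 0 0) + N). split; [generalize (Rabs_pos (F 0 0)); lra|].
  intros x y Hx Hy.
  assert (Hs : forall k, (k <= S n)%nat ->
    Rabs (F (INR k * (x / N)) (INR k * (y / N))) <= Rabs (F 0 0) + INR k).
  { assert (Hb : forall k z, (k <= S n)%nat -> Rabs z <= B -> - B <= INR k * (z / N) <= B).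
    { intros k z Hk Hz. apply Rabs_le_between. rewrite Rabs_mult.
      unfold Rdiv. rewrite Rabs_mult, Rabs_inv, (Rabs_pos_eq N), (Rabs_pos_eq (INR k))
        by (auto using pos_INR; lra).
      apply le_INR in Hk. rewrite S_INR in Hk. fold N in Hk.
      apply Rle_trans with (N * (B * / N)); [|right; field; lra].
      generalize (Rinv_0_lt_compat N HN) (pos_INR k) (Rabs_pos z); intros.
      apply Rmult_le_compat; auto; [apply Rmult_le_pos; lra|apply Rmult_le_compat_r; lra]. }
    assert (Hst : forall k z, Rabs z <= B -> Rabs (INR (S k) * (z / N) - INR k * (z / N)) < d).
    { intros k z Hz. rewrite S_INR. replace ((INR k + 1) * (z / N) - INR k * (z / N)) with (z / N) by ring.
      apply Rle_lt_trans with (2 := HBN). unfold Rdiv.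
      rewrite Rabs_mult, Rabs_inv, (Rabs_pos_eq N) by lra.
      apply Rmult_le_compat_r; [left; apply Rinv_0_lt_compat|]; auto. }
    induction k; intros Hk.
    - simpl. rewrite !Rmult_0_l, Rplus_0_r. lra.
    - assert (IH := IHk ltac:(lia)).
      assert (H := Hd (INR k * (x / N)) (INR k * (y / N)) (INR (S k) * (x / N)) (INR (S k) * (y / N))
        ltac:(apply Hb; [lia|auto]) ltac:(apply Hb; [lia|auto])
        ltac:(apply Hb; [lia|auto]) ltac:(apply Hb; [lia|auto])
        ltac:(apply Hst; auto) ltac:(apply Hst; auto)).
      generalize (Rabs_triang_inv (F (INR (S k) * (x / N)) (INR (S k) * (y / N)))
        (F (INR k * (x / N)) (INR k * (y / N)))). rewrite S_INR. rewrite S_INR in H. lra. }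
  specialize (Hs (S n) (Nat.le_refl _)). rewrite S_INR in Hs. fold N in Hs.
  replace (N * (x / N)) with x in Hs by (field; lra).
  replace (N * (y / N)) with y in Hs by (field; lra). exact Hs.
Qed.

Definition box_lip (F : R -> R -> R) (B L : R) : Prop :=
  forall x y x' y', Rabs x <= B -> Rabs y <= B -> Rabs x' <= B -> Rabs y' <= B ->
    Rabs (F x y) <= L /\ Rabs (F x y - F x' y') <= L * (Rabs (x - x') + Rabs (y - y')).

Lemma box_lip_mono F B L L' : L <= L' -> box_lip F B L -> box_lip F B L'.
Proof.
  intros HL H x y x' y' Hx Hy Hx' Hy'. destruct (H x y x' y') as [H1 H2]; auto.
  split; [lra|]. apply Rle_trans with (1 := H2). apply Rmult_le_compat_r; auto.
  generalize (Rabs_pos (x - x')) (Rabs_pos (y - y')); lra.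
Qed.

Lemma C1_box_lip (F Fx Fy : R -> R -> R) (B : R) : 0 <= B ->
  is_dx F Fx -> is_dy F Fy -> cont2 F -> cont2 Fx -> cont2 Fy -> exists L, 0 <= L /\ box_lip F B L.
Proof.
  intros HB Dx Dy CF Cx Cy.
  destruct (cont2_bounded_box F B CF HB) as [L0 [P0 H0]].
  destruct (cont2_bounded_box Fx B Cx HB) as [L1 [P1 H1]].
  destruct (cont2_bounded_box Fy B Cy HB) as [L2 [P2 H2]].
  exists (L0 + L1 + L2). split; [lra|]. intros x y x' y' Hx Hy Hx' Hy'.
  split; [generalize (H0 x y Hx Hy); lra|].
  assert (Hin : forall a b c, Rabs a <= B -> Rabs b <= B -> Rmin a b <= c <= Rmax a b -> Rabs c <= B).
  { intros a b c Ha Hb. apply Rabs_le_between in Ha. apply Rabs_le_between in Hb.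
    intros Hc. apply Rabs_le_between. revert Hc; unfold Rmin, Rmax; repeat destruct Rle_dec; lra. }
  assert (A1 : Rabs (F x y - F x' y) <= L1 * Rabs (x - x')).
  { apply (mean_value_bound (fun u => F u y) (fun u => Fx u y)); [intros u; apply Dx|].
    intros c Hc. apply H1; [apply (Hin x' x)|]; auto. }
  assert (A2 : Rabs (F x' y - F x' y') <= L2 * Rabs (y - y')).
  { apply (mean_value_bound (fun u => F x' u) (fun u => Fy x' u)); [intros u; apply Dy|].
    intros c Hc. apply H2; [|apply (Hin y' y)]; auto. }
  replace (F x y - F x' y') with ((F x y - F x' y) + (F x' y - F x' y')) by ring.
  apply Rle_trans with (1 := Rabs_triang _ _).
  generalize (Rabs_pos (x - x')) (Rabs_pos (y - y')); nra.
Qed.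

Lemma smooth2_cont2 F : smooth2 F -> cont2 F.
Proof. intros [Fx Fy _ _ C _ _]; exact C. Qed.

Lemma is_dx_unique F G G' : is_dx F G -> is_dx F G' -> forall x y, G x y = G' x y.
Proof. intros H H' x y. apply (uniqueness_limite (fun u => F u y) x); [apply H|apply H']. Qed.

Lemma is_dy_unique F G G' : is_dy F G -> is_dy F G' -> forall x y, G x y = G' x y.
Proof. intros H H' x y. apply (uniqueness_limite (fun u => F x u) y); [apply H|apply H']. Qed.

Lemma smooth2_box_lip F B : smooth2 F -> 0 <= B -> exists L, 0 <= L /\ box_lip F B L.
Proof.
  intros [Fx Fy Dx Dy C Sx Sy] HB. destruct Sx as [? ? _ _ Cx _ _]. destruct Sy as [? ? _ _ Cy _ _].
  apply (C1_box_lip F Fx Fy); auto.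
Qed.

Lemma box_lip_ext F G B L : (forall x y, F x y = G x y) -> box_lip F B L -> box_lip G B L.
Proof. intros E H x y x' y'. rewrite <- !E. apply H. Qed.

(** The partial derivatives hidden inside [smooth2] are not the given [fx] and [fy]; uniqueness of
    derivatives transfers the bounds. *)
Lemma smooth2_box_lip_partials f fx fy B : smooth2 f -> is_dx f fx -> is_dy f fy -> 0 <= B ->
  exists L, 0 <= L /\ box_lip f B L /\ box_lip fx B L /\ box_lip fy B L.
Proof.
  intros Hf Hx Hy HB. destruct (smooth2_box_lip f B Hf HB) as [L0 [P0 H0]].
  destruct Hf as [Fx Fy Dx Dy C Sx Sy].
  destruct (smooth2_box_lip Fx B Sx HB) as [L1 [P1 H1]].
  destruct (smooth2_box_lip Fy B Sy HB) as [L2 [P2 H2]].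
  exists (L0 + L1 + L2). split; [lra|]. split; [apply (box_lip_mono f B L0); auto; lra|].
  split.
  - apply (box_lip_ext Fx); [apply (is_dx_unique f); auto|]. apply (box_lip_mono _ B L1); auto; lra.
  - apply (box_lip_ext Fy); [apply (is_dy_unique f); auto|]. apply (box_lip_mono _ B L2); auto; lra.
Qed.

Lemma derivable_pt_lim_mul_const k x : derivable_pt_lim (fun c => k * c) x k.
Proof. apply is_derive_Reals. auto_derive; auto; ring. Qed.

(** Mean values are taken along a horizontal segment at height [v], then along the vertical one
    above [x]. The partials are Lipschitz on a box, so both errors are quadratic, with [2 * L] and
    [L] adding up to [3 * L]. *)
Lemma smooth2_differentiable f fx fy x y : smooth2 f -> is_dx f fx -> is_dy f fy ->
  differentiable_pt_lim f x y (fx x y) (fy x y).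
Proof.
  intros Hf Hx Hy.
  (* The added 1 leaves room for all points within distance 1 in each coordinate. *)
  set (B := Rabs x + Rabs y + 1).
  generalize (Rabs_pos x) (Rabs_pos y); intros Px Py.
  destruct (smooth2_box_lip_partials f fx fy B Hf Hx Hy) as [L [HL [_ [B1 B2]]]]; [unfold B; lra|].
  intros eps. assert (Hd : 0 < Rmin 1 (eps / (3 * L + 1))).
  { apply Rmin_pos; [lra|]. apply Rdiv_lt_0_compat; [apply cond_pos|lra]. }
  exists (mkposreal _ Hd); simpl; intros u v Hu Hv.
  set (m := Rmax (Rabs (u - x)) (Rabs (v - y))).
  assert (M1 : Rabs (u - x) <= m) by apply Rmax_l.
  assert (M2 : Rabs (v - y) <= m) by apply Rmax_r.
  assert (Hm : m < Rmin 1 (eps / (3 * L + 1))) by (apply Rmax_lub_lt; auto).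
  assert (Hm1 : m < 1) by (eapply Rlt_le_trans; [exact Hm|apply Rmin_l]).
  assert (Hm2 : m < eps / (3 * L + 1)) by (eapply Rlt_le_trans; [exact Hm|apply Rmin_r]).
  assert (Hm0 : 0 <= m) by (apply Rle_trans with (2 := M1); apply Rabs_pos).
  assert (Hbt : forall a b c, Rmin a b <= c <= Rmax a b -> Rabs (c - a) <= Rabs (b - a)).
  { intros a b c. unfold Rmin, Rmax, Rabs; repeat destruct Rle_dec; repeat destruct Rcase_abs; lra. }
  assert (Hin : forall a b, Rabs (b - a) <= m -> Rabs a <= B - 1 -> Rabs b <= B).
  { intros a b Hab Ha. replace b with (a + (b - a)) by ring.
    apply Rle_trans with (1 := Rabs_triang _ _). lra. }
  assert (E1 : Rabs ((f u v - fx x y * u) - (f x v - fx x y * x)) <= 2 * L * m * Rabs (u - x)).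
  { apply (mean_value_bound (fun c => f c v - fx x y * c) (fun c => fx c v - fx x y)).
    - intros c. apply (derivable_pt_lim_minus (fun c => f c v) (fun c => fx x y * c)); [apply Hx|].
      apply derivable_pt_lim_mul_const.
    - intros c Hc. apply Hbt in Hc.
      destruct (B1 c v x y) as [_ D]; try (apply (Hin x); unfold B in *; lra);
        try (apply (Hin y); unfold B in *; lra); try (unfold B; lra).
      apply Rle_trans with (1 := D). nra. }
  assert (E2 : Rabs ((f x v - fy x y * v) - (f x y - fy x y * y)) <= L * m * Rabs (v - y)).
  { apply (mean_value_bound (fun c => f x c - fy x y * c) (fun c => fy x c - fy x y)).
    - intros c. apply (derivable_pt_lim_minus (fun c => f x c) (fun c => fy x y * c)); [apply Hy|].
      apply derivable_pt_lim_mul_const.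
    - intros c Hc. apply Hbt in Hc.
      destruct (B2 x c x y) as [_ D]; try (apply (Hin y); unfold B in *; lra);
        try (unfold B; lra).
      apply Rle_trans with (1 := D). rewrite Rminus_eq_0, Rabs_R0. nra. }
  replace (f u v - f x y - (fx x y * (u - x) + fy x y * (v - y))) with
    (((f u v - fx x y * u) - (f x v - fx x y * x)) + ((f x v - fy x y * v) - (f x y - fy x y * y))) by ring.
  apply Rle_trans with (1 := Rabs_triang _ _).
  assert (E3 : 3 * L * m <= eps).
  { apply Rle_trans with ((3 * L + 1) * (eps / (3 * L + 1))); [|right; field; lra]. nra. }
  apply Rle_trans with (3 * L * m * m); [|nra].
  assert (2 * L * m * Rabs (u - x) <= 2 * L * m * m) by (apply Rmult_le_compat_l; nra).
  assert (L * m * Rabs (v - y) <= L * m * m) by (apply Rmult_le_compat_l; nra).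
  lra.
Qed.

(** * Bounded Lipschitz families under algebraic operations *)

Section Algebra.
Variables ra rb : R.
Hypothesis Hra : 0 < ra.
Hypothesis Hrab : ra <= rb.

(** The constant is uniform in [e] and in the unrestricted angle. Being closed under sums, products
    and quotients bounded below, the class yields bounds for the field directly from the shape of
    its formulas. *)
Definition ubl (e1 : R) (F : R -> R -> R -> R -> R) : Prop :=
  exists K, 0 <= K /\ forall e t r w t' r' w', Rabs e <= e1 ->
    ra <= r <= rb -> ra <= r' <= rb -> Rabs w <= 1 -> Rabs w' <= 1 ->
    Rabs (F e t r w) <= K /\
    Rabs (F e t r w - F e t' r' w') <= K * (Rabs (t - t') + Rabs (r - r') + Rabs (w - w')).

Lemma ubl_plus e1 F G : ubl e1 F -> ubl e1 G -> ubl e1 (fun e t r w => F e t r w + G e t r w).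
Proof.
  intros [K [HK H]] [K' [HK' H']]. exists (K + K'); split; [lra|].
  intros e t r w t' r' w' He Hr Hr' Hw Hw'.
  destruct (H e t r w t' r' w') as [A1 A2]; auto. destruct (H' e t r w t' r' w') as [B1 B2]; auto.
  split.
  - apply Rle_trans with (1 := Rabs_triang _ _); lra.
  - replace (F e t r w + G e t r w - (F e t' r' w' + G e t' r' w'))
      with ((F e t r w - F e t' r' w') + (G e t r w - G e t' r' w')) by ring.
    apply Rle_trans with (1 := Rabs_triang _ _); lra.
Qed.

Lemma ubl_mult e1 F G : ubl e1 F -> ubl e1 G -> ubl e1 (fun e t r w => F e t r w * G e t r w).
Proof.
  intros [K [HK H]] [K' [HK' H']]. exists (2 * K * K'); split; [nra|].
  intros e t r w t' r' w' He Hr Hr' Hw Hw'.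
  destruct (H e t r w t' r' w') as [A1 A2]; auto. destruct (H' e t r w t' r' w') as [B1 B2]; auto.
  destruct (H' e t' r' w' t r w) as [B1' _]; auto.
  set (d := Rabs (t - t') + Rabs (r - r') + Rabs (w - w')) in *.
  assert (Hd : 0 <= d)
    by (unfold d; generalize (Rabs_pos (t - t')) (Rabs_pos (r - r')) (Rabs_pos (w - w')); lra).
  split.
  - rewrite Rabs_mult. apply Rle_trans with (K * K'); [apply Rmult_le_compat; auto using Rabs_pos|nra].
  - replace (F e t r w * G e t r w - F e t' r' w' * G e t' r' w')
      with (F e t r w * (G e t r w - G e t' r' w') + (F e t r w - F e t' r' w') * G e t' r' w') by ring.
    apply Rle_trans with (1 := Rabs_triang _ _). rewrite !Rabs_mult.
    assert (Rabs (F e t r w) * Rabs (G e t r w - G e t' r' w') <= K * (K' * d))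
      by (apply Rmult_le_compat; auto using Rabs_pos).
    assert (Rabs (F e t r w - F e t' r' w') * Rabs (G e t' r' w') <= (K * d) * K')
      by (apply Rmult_le_compat; auto using Rabs_pos).
    lra.
Qed.

Lemma ubl_const e1 c : ubl e1 (fun _ _ _ _ => c).
Proof.
  exists (Rabs c); split; [apply Rabs_pos|]. intros. rewrite Rminus_eq_0, Rabs_R0.
  split; [lra|]. apply Rmult_le_pos; [apply Rabs_pos|].
  generalize (Rabs_pos (t - t')) (Rabs_pos (r - r')) (Rabs_pos (w - w')); lra.
Qed.

Lemma ubl_opp e1 F : ubl e1 F -> ubl e1 (fun e t r w => - F e t r w).
Proof.
  intros [K [HK H]]. exists K; split; auto. intros e t r w t' r' w' He Hr Hr' Hw Hw'.
  destruct (H e t r w t' r' w') as [A1 A2]; auto.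
  replace (- F e t r w - - F e t' r' w') with (- (F e t r w - F e t' r' w')) by ring.
  rewrite !Rabs_Ropp; auto.
Qed.

Lemma ubl_minus e1 F G : ubl e1 F -> ubl e1 G -> ubl e1 (fun e t r w => F e t r w - G e t r w).
Proof. intros HF HG. apply (ubl_plus e1 F (fun e t r w => - G e t r w)); auto. apply ubl_opp; auto. Qed.

Lemma ubl_eps e1 : 0 <= e1 -> ubl e1 (fun e _ _ _ => e).
Proof.
  exists e1; split; auto. intros. rewrite Rminus_eq_0, Rabs_R0. split; auto.
  apply Rmult_le_pos; auto.
  generalize (Rabs_pos (t - t')) (Rabs_pos (r - r')) (Rabs_pos (w - w')); lra.
Qed.

Lemma ubl_radius e1 : ubl e1 (fun _ _ r _ => r).
Proof.
  exists (rb + 1); split; [lra|]. intros. rewrite Rabs_pos_eq by lra. split; [lra|].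
  generalize (Rabs_pos (t - t')) (Rabs_pos (r - r')) (Rabs_pos (w - w')); nra.
Qed.

Lemma ubl_height e1 : ubl e1 (fun _ _ _ w => w).
Proof.
  exists 1; split; [lra|]. intros. split; auto.
  generalize (Rabs_pos (t - t')) (Rabs_pos (r - r')) (Rabs_pos (w - w')); lra.
Qed.

Lemma ubl_angle e1 (g : R -> R) : (forall t, Rabs (g t) <= 1) ->
  (forall t t', Rabs (g t - g t') <= Rabs (t - t')) -> ubl e1 (fun _ t _ _ => g t).
Proof.
  intros Hb Hl. exists 1; split; [lra|]. intros. split; auto.
  generalize (Hl t t') (Rabs_pos (r - r')) (Rabs_pos (w - w')); lra.
Qed.

Lemma ubl_cos e1 : ubl e1 (fun _ t _ _ => cos t).
Proof.
  apply ubl_angle.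
  - intros t. apply Rabs_le. apply COS_bound.
  - intros t t'. rewrite <- (Rmult_1_l (Rabs (t - t'))).
    apply (mean_value_bound cos (fun x => - sin x)).
    + intros; apply derivable_pt_lim_cos.
    + intros. rewrite Rabs_Ropp. apply Rabs_le, SIN_bound.
Qed.

Lemma ubl_sin e1 : ubl e1 (fun _ t _ _ => sin t).
Proof.
  apply ubl_angle.
  - intros t. apply Rabs_le. apply SIN_bound.
  - intros t t'. rewrite <- (Rmult_1_l (Rabs (t - t'))).
    apply (mean_value_bound sin cos).
    + intros; apply derivable_pt_lim_sin.
    + intros. apply Rabs_le, COS_bound.
Qed.

Lemma ubl_inv e1 F c : 0 < c ->
  (forall e t r w, Rabs e <= e1 -> ra <= r <= rb -> Rabs w <= 1 -> c <= F e t r w) ->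
  ubl e1 F -> ubl e1 (fun e t r w => / F e t r w).
Proof.
  intros Hc Hlow [K [HK H]]. exists (/ c + K / (c * c)).
  assert (Hc1 : 0 < / c) by (apply Rinv_0_lt_compat; auto).
  assert (HKc : 0 <= K / (c * c)) by (apply Rdiv_le_0_compat; nra).
  split; [lra|]. intros e t r w t' r' w' He Hr Hr' Hw Hw'.
  destruct (H e t r w t' r' w') as [A1 A2]; auto.
  assert (L1 := Hlow e t r w He Hr Hw). assert (L2 := Hlow e t' r' w' He Hr' Hw').
  set (x := F e t r w) in *. set (y := F e t' r' w') in *.
  set (d := Rabs (t - t') + Rabs (r - r') + Rabs (w - w')) in *.
  assert (Hd : 0 <= d)
    by (unfold d; generalize (Rabs_pos (t - t')) (Rabs_pos (r - r')) (Rabs_pos (w - w')); lra).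
  assert (I1 : 0 < / x <= / c) by (split; [apply Rinv_0_lt_compat; lra|apply Rinv_le_contravar; auto]).
  assert (I2 : 0 < / y <= / c) by (split; [apply Rinv_0_lt_compat; lra|apply Rinv_le_contravar; auto]).
  split; [rewrite Rabs_pos_eq; lra|].
  replace (/ x - / y) with (- ((x - y) * (/ x * / y))) by (field; lra).
  rewrite Rabs_Ropp, Rabs_mult, (Rabs_pos_eq (/ x * / y)) by nra.
  apply Rle_trans with ((K * d) * (/ c * / c)).
  - apply Rmult_le_compat; auto using Rabs_pos; [nra|apply Rmult_le_compat; lra].
  - apply Rle_trans with (K / (c * c) * d); [right; field; lra|]. apply Rmult_le_compat_r; lra.
Qed.

Lemma ubl_div e1 F G c : 0 < c ->
  (forall e t r w, Rabs e <= e1 -> ra <= r <= rb -> Rabs w <= 1 -> c <= G e t r w) ->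
  ubl e1 F -> ubl e1 G -> ubl e1 (fun e t r w => F e t r w / G e t r w).
Proof.
  intros Hc Hl HF HG. apply (ubl_mult e1 F (fun e t r w => / G e t r w)); auto.
  apply (ubl_inv e1 G c); auto.
Qed.

Lemma polar_in_box r t : ra <= r <= rb -> Rabs (r * cos t) <= rb /\ Rabs (r * sin t) <= rb.
Proof.
  intros Hr. rewrite !Rabs_mult, !(Rabs_pos_eq r) by lra.
  assert (Rabs (cos t) <= 1) by (apply Rabs_le, COS_bound).
  assert (Rabs (sin t) <= 1) by (apply Rabs_le, SIN_bound).
  generalize (Rabs_pos (cos t)) (Rabs_pos (sin t)); split; nra.
Qed.

Lemma ubl_box e1 F L : 0 <= L -> box_lip F rb L -> ubl e1 (fun _ t r _ => F (r * cos t) (r * sin t)).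
Proof.
  intros HL HF.
  destruct (ubl_mult e1 _ _ (ubl_radius e1) (ubl_cos e1)) as [K1 [P1 H1]].
  destruct (ubl_mult e1 _ _ (ubl_radius e1) (ubl_sin e1)) as [K2 [P2 H2]].
  exists (L + L * (K1 + K2)). split; [nra|]. intros e t r w t' r' w' He Hr Hr' Hw Hw'.
  destruct (polar_in_box r t Hr) as [X1 X2]. destruct (polar_in_box r' t' Hr') as [Y1 Y2].
  destruct (HF _ _ _ _ X1 X2 Y1 Y2) as [Z1 Z2].
  destruct (H1 e t r w t' r' w') as [_ D1]; auto. destruct (H2 e t r w t' r' w') as [_ D2]; auto.
  set (d := Rabs (t - t') + Rabs (r - r') + Rabs (w - w')) in *.
  assert (Hd : 0 <= d)
    by (unfold d; generalize (Rabs_pos (t - t')) (Rabs_pos (r - r')) (Rabs_pos (w - w')); lra).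
  split; [nra|]. apply Rle_trans with (1 := Z2).
  apply Rle_trans with (L * (K1 * d + K2 * d)); [apply Rmult_le_compat_l; lra|nra].
Qed.

End Algebra.

(** * The vector field in cylindrical coordinates *)

Section Field.
Variables (f fx fy : R -> R -> R) (a0 a1 a2 a3 b1 b2 b3 rs : R).
Hypothesis Hsm : smooth2 f.
Hypothesis Hfx : is_dx f fx.
Hypothesis Hfy : is_dy f fy.
Hypothesis Hrs : 0 < rs.

(* The boolean is [true] on the side [y > 0]. With [w = z - f(x, y)], the field reads
   [r' = e * al * force], [theta' = speed], [w' = - w - e * force * slope]. *)
Definition force0 (s : bool) (z : R) : R := if s then a0 + a1 * z else b1 * z.
Definition force1 (s : bool) (z : R) : R := if s then a2 + a3 * z else b2 + b3 * z.
Definition al (s : bool) (t : R) : R := if s then cos t else sin t.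
Definition be (s : bool) (t : R) : R := if s then - sin t else cos t.
Definition lift (t r w : R) : R := w + f (r * cos t) (r * sin t).
Definition force (s : bool) (e t r w : R) : R :=
  force0 s (lift t r w) + e * force1 s (lift t r w).
Definition slope (s : bool) (t r : R) : R :=
  if s then fx (r * cos t) (r * sin t) else fy (r * cos t) (r * sin t).
Definition turning (s : bool) (e t r w : R) : R := be s t * force s e t r w / r.
Definition speed (s : bool) (e t r w : R) : R := 1 + e * turning s e t r w.
Definition Gf (s : bool) (e t r w : R) : R := al s t * force s e t r w / speed s e t r w.
(** Dividing [w'] by [theta'] also rescales the damping; writing the result as [- w + e * Wf] moves
    this defect, [w * turning], into [Wf]. *)
Definition Wf (s : bool) (e t r w : R) : R :=
  (- (force s e t r w * slope s t r) + w * turning s e t r w) / speed s e t r w.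
(** [Gf0] is the value at [e = 0], and [Gf1] is the exact difference quotient, obtained from
    [1 / (1 + e q) = 1 - e q / (1 + e q)] with [q] the value of [turning]. It is bounded and
    Lipschitz by the same rules as the field itself. *)
Definition Gf0 (s : bool) (t r w : R) : R := al s t * force0 s (lift t r w).
Definition Gf1 (s : bool) (e t r w : R) : R :=
  al s t * (force1 s (lift t r w) - turning s e t r w * force0 s (lift t r w)) / speed s e t r w.

Lemma Gf_expand s e t r w : speed s e t r w <> 0 -> Gf s e t r w = Gf0 s t r w + e * Gf1 s e t r w.
Proof.
  intros H. unfold Gf, Gf0, Gf1. apply Rmult_eq_reg_r with (speed s e t r w); auto.
  transitivity (al s t * force s e t r w); [field; auto|].
  transitivity (al s t * force0 s (lift t r w) * speed s e t r w +
    e * (al s t * (force1 s (lift t r w) - turning s e t r w * force0 s (lift t r w))));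
    [|field; auto].
  unfold speed, force. ring.
Qed.

Lemma box_constant : exists L, 0 <= L /\
  box_lip f (2 * rs) L /\ box_lip fx (2 * rs) L /\ box_lip fy (2 * rs) L.
Proof. apply smooth2_box_lip_partials; auto; lra. Qed.

Definition ublf := ubl (rs / 2) (2 * rs).

Lemma Rdom : 0 < rs / 2 /\ rs / 2 <= 2 * rs.
Proof. lra. Qed.

Lemma ubl_lift e1 : ublf e1 (fun _ t r w => lift t r w).
Proof.
  destruct box_constant as [L [HL [B _]]]. unfold lift. apply ubl_plus; [apply ubl_height|].
  apply (ubl_box (rs / 2) (2 * rs) (proj1 Rdom) (proj2 Rdom) e1 f L); auto.
Qed.

Lemma ubl_al e1 s : ublf e1 (fun _ t _ _ => al s t).
Proof. destruct s; [apply ubl_cos|apply ubl_sin]. Qed.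

Lemma ubl_be e1 s : ublf e1 (fun _ t _ _ => be s t).
Proof. destruct s; [apply ubl_opp, ubl_sin|apply ubl_cos]. Qed.

Lemma ubl_force0 e1 s : ublf e1 (fun _ t r w => force0 s (lift t r w)).
Proof.
  destruct s; unfold force0.
  - apply ubl_plus; [apply ubl_const|]. apply ubl_mult; [apply ubl_const|apply ubl_lift].
  - apply ubl_mult; [apply ubl_const|apply ubl_lift].
Qed.

Lemma ubl_force1 e1 s : ublf e1 (fun _ t r w => force1 s (lift t r w)).
Proof.
  destruct s; unfold force1; (apply ubl_plus; [apply ubl_const|]);
    (apply ubl_mult; [apply ubl_const|apply ubl_lift]).
Qed.

Lemma ubl_force e1 s : 0 <= e1 -> ublf e1 (fun e t r w => force s e t r w).
Proof.
  intros H. unfold force. apply ubl_plus; [apply ubl_force0|].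
  apply ubl_mult; [apply ubl_eps; auto|apply ubl_force1].
Qed.

Lemma ubl_turning e1 s : 0 <= e1 -> ublf e1 (fun e t r w => turning s e t r w).
Proof.
  intros H. unfold turning. apply (ubl_div _ _ e1 _ _ (rs / 2)); [lra|intros; lra| |].
  - apply ubl_mult; [apply ubl_be|apply ubl_force; auto].
  - apply ubl_radius; lra.
Qed.

Lemma ubl_slope e1 s : ublf e1 (fun _ t r _ => slope s t r).
Proof.
  destruct box_constant as [L [HL [_ [B1 B2]]]]. destruct Rdom.
  destruct s; unfold slope.
  - apply (ubl_box (rs / 2) (2 * rs)) with (F := fx) (L := L); auto.
  - apply (ubl_box (rs / 2) (2 * rs)) with (F := fy) (L := L); auto.
Qed.

(** The annulus keeps [r] away from 0, where [turning] is singular, and bounds the box on which the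
    constants for [f] are taken. *)
Definition dom (r w : R) : Prop := rs / 2 <= r <= 2 * rs /\ Rabs w <= 1.

Lemma speed_bounds : exists e1 K, 0 < e1 <= 1 /\ 0 <= K /\ forall s e t r w, Rabs e <= e1 -> dom r w ->
  / 2 <= speed s e t r w <= 3 / 2 /\ Rabs (speed s e t r w - 1) <= K * Rabs e.
Proof.
  destruct (ubl_turning 1 true Rle_0_1) as [K1 [HK1 H1]].
  destruct (ubl_turning 1 false Rle_0_1) as [K2 [HK2 H2]].
  set (K := K1 + K2 + 1). assert (HK : 1 <= K) by (unfold K; lra).
  exists (/ (2 * K)), K.
  assert (Hi : 0 < / (2 * K)) by (apply Rinv_0_lt_compat; lra).
  assert (Hi1 : / (2 * K) <= 1).
  { rewrite <- Rinv_1. apply Rinv_le_contravar; lra. }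
  split; [lra|]. split; [lra|]. intros s e t r w He [Hr Hw].
  assert (B : Rabs (turning s e t r w) <= K).
  { destruct s; [destruct (H1 e t r w t r w)|destruct (H2 e t r w t r w)]; auto; unfold K; lra. }
  assert (B' : Rabs (speed s e t r w - 1) <= K * Rabs e).
  { unfold speed. replace (1 + e * turning s e t r w - 1) with (e * turning s e t r w) by ring.
    rewrite Rabs_mult. generalize (Rabs_pos e); nra. }
  split; auto.
  assert (K * Rabs e <= / 2).
  { apply Rle_trans with (K * / (2 * K)); [apply Rmult_le_compat_l; lra|right; field; lra]. }
  apply Rabs_le_between in B'. lra.
Qed.

Definition lip_dom (K : R) (F : R -> R -> R -> R) : Prop :=
  forall t r w t' r' w', dom r w -> dom r' w' ->
    Rabs (F t r w) <= K /\
    Rabs (F t r w - F t' r' w') <= K * (Rabs (t - t') + Rabs (r - r') + Rabs (w - w')).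

Record good (e1 K : R) : Prop := {
  good_e1 : 0 < e1 <= 1;
  good_K : 0 < K;
  good_speed : forall s e t r w, Rabs e <= e1 -> dom r w ->
    / 2 <= speed s e t r w <= 3 / 2 /\ Rabs (speed s e t r w - 1) <= K * Rabs e;
  good_G : forall s e, Rabs e <= e1 -> lip_dom K (Gf s e);
  good_W : forall s e, Rabs e <= e1 -> lip_dom K (Wf s e);
  good_G1 : forall s e, Rabs e <= e1 -> lip_dom K (Gf1 s e);
  good_S : forall s e, Rabs e <= e1 -> lip_dom K (speed s e);
  good_force : forall s e, Rabs e <= e1 -> lip_dom K (force s e)
}.

Lemma ubl_lip_dom e1 (F : bool -> R -> R -> R -> R -> R) :
  (forall s, ublf e1 (F s)) -> exists K, 0 <= K /\ forall s e, Rabs e <= e1 -> lip_dom K (F s e).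
Proof.
  intros H. destruct (H true) as [K1 [P1 H1]]. destruct (H false) as [K2 [P2 H2]].
  exists (K1 + K2); split; [lra|]. intros s e He t r w t' r' w' [Hr Hw] [Hr' Hw'].
  generalize (Rabs_pos (t - t')) (Rabs_pos (r - r')) (Rabs_pos (w - w')); intros.
  destruct s; [destruct (H1 e t r w t' r' w') as [A B]|destruct (H2 e t r w t' r' w') as [A B]];
    auto; (split; [lra|]); apply Rle_trans with (1 := B); apply Rmult_le_compat_r; lra.
Qed.

Lemma lip_dom_mono K K' F : K <= K' -> lip_dom K F -> lip_dom K' F.
Proof.
  intros HK H t r w t' r' w' D D'. destruct (H t r w t' r' w' D D') as [A B].
  generalize (Rabs_pos (t - t')) (Rabs_pos (r - r')) (Rabs_pos (w - w')); intros.
  split; [lra|]. apply Rle_trans with (1 := B). apply Rmult_le_compat_r; lra.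
Qed.

Lemma good_exists : exists e1 K, good e1 K.
Proof.
  destruct speed_bounds as [e1 [K0 [He1 [HK0 Hs]]]]. destruct Rdom as [R1 R2].
  assert (US : forall s, ublf e1 (speed s)).
  { intros s. unfold speed. apply ubl_plus; [apply ubl_const|].
    apply ubl_mult; [apply ubl_eps; lra|apply ubl_turning; lra]. }
  assert (UD : forall s F, ublf e1 F -> ublf e1 (fun e t r w => F e t r w / speed s e t r w)).
  { intros s F HF. apply (ubl_div _ _ e1 F (speed s) (/ 2)); [lra| |auto|apply US].
    intros e t r w He Hr Hw. apply (Hs s e t r w); auto. split; auto. }
  destruct (ubl_lip_dom e1 speed US) as [K1 [P1 H1]].
  destruct (ubl_lip_dom e1 Gf) as [K2 [P2 H2]].
  { intros s. unfold Gf. apply (UD s (fun e t r w => al s t * force s e t r w)).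
    apply ubl_mult; [apply ubl_al|apply ubl_force; lra]. }
  destruct (ubl_lip_dom e1 Wf) as [K3 [P3 H3]].
  { intros s. unfold Wf.
    apply (UD s (fun e t r w => - (force s e t r w * slope s t r) + w * turning s e t r w)).
    apply ubl_plus; [apply ubl_opp, ubl_mult; [apply ubl_force; lra|apply ubl_slope]|].
    apply ubl_mult; [apply ubl_height|apply ubl_turning; lra]. }
  destruct (ubl_lip_dom e1 Gf1) as [K4 [P4 H4]].
  { intros s. unfold Gf1.
    apply (UD s (fun e t r w => al s t *
      (force1 s (lift t r w) - turning s e t r w * force0 s (lift t r w)))).
    apply ubl_mult; [apply ubl_al|]. apply ubl_minus; [apply ubl_force1|].
    apply ubl_mult; [apply ubl_turning; lra|apply ubl_force0]. }
  destruct (ubl_lip_dom e1 force) as [K5 [P5 H5]].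
  { intros s. apply ubl_force; lra. }
  exists e1, (K0 + K1 + K2 + K3 + K4 + K5 + 1). split; auto; try lra.
  - intros s e t r w He D. destruct (Hs s e t r w He D) as [A B]. split; auto.
    apply Rle_trans with (1 := B). apply Rmult_le_compat_r; [apply Rabs_pos|lra].
  - intros s e He; apply (lip_dom_mono K2); auto; lra.
  - intros s e He; apply (lip_dom_mono K3); auto; lra.
  - intros s e He; apply (lip_dom_mono K4); auto; lra.
  - intros s e He; apply (lip_dom_mono K1); auto; lra.
  - intros s e He; apply (lip_dom_mono K5); auto; lra.
Qed.

(** * The averaged equation *)

Definition coef (s : bool) : R := if s then a1 else b1.
Definition fr (t r : R) : R :=
  fx (r * cos t) (r * sin t) * cos t + fy (r * cos t) (r * sin t) * sin t.
(** The derivative of [Gf0] in [r] at the radius [rs]; its integral over a turn will be [F1' rs]. *)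
Definition Af (s : bool) (t : R) : R := al s t * (coef s * fr t rs).

Lemma radial_derive t r : derivable_pt_lim (fun r => f (r * cos t) (r * sin t)) r (fr t r).
Proof.
  unfold fr.
  apply (derivable_pt_lim_comp_2d f (fun r => r * cos t) (fun r => r * sin t)).
  - apply smooth2_differentiable; auto.
  - apply is_derive_Reals. auto_derive; auto; ring.
  - apply is_derive_Reals. auto_derive; auto; ring.
Qed.

Lemma Rabs_cos_le t : Rabs (cos t) <= 1.
Proof. apply Rabs_le, COS_bound. Qed.

Lemma Rabs_sin_le t : Rabs (sin t) <= 1.
Proof. apply Rabs_le, SIN_bound. Qed.

Lemma Rabs_al_le s t : Rabs (al s t) <= 1.
Proof. destruct s; [apply Rabs_cos_le|apply Rabs_sin_le]. Qed.

(** Both radii are free, a form of strict differentiability: the contraction compares two iterates,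
    and isolation compares two orbits, neither of them at [rs]. *)
Lemma radial_estimate : exists L, 0 < L /\
  (forall t, Rabs (fr t rs) <= L) /\
  forall del t r r', del <= rs / 2 -> Rabs (r - rs) <= del -> Rabs (r' - rs) <= del ->
  Rabs (f (r * cos t) (r * sin t) - f (r' * cos t) (r' * sin t) - fr t rs * (r - r'))
    <= L * del * Rabs (r - r').
Proof.
  destruct box_constant as [L [HL [_ [B1 B2]]]].
  exists (4 * L + 1). split; [lra|].
  assert (Hbox : forall r t, rs / 2 <= r <= 2 * rs -> Rabs (r * cos t) <= 2 * rs /\ Rabs (r * sin t) <= 2 * rs)
    by (intros; apply (polar_in_box (rs / 2)); lra).
  split.
  { intros t. destruct (Hbox rs t) as [X Y]; [lra|].
    destruct (B1 _ _ _ _ X Y X Y) as [C1 _]. destruct (B2 _ _ _ _ X Y X Y) as [C2 _].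
    unfold fr. apply Rle_trans with (1 := Rabs_triang _ _). rewrite !Rabs_mult.
    generalize (Rabs_cos_le t) (Rabs_sin_le t) (Rabs_pos (cos t)) (Rabs_pos (sin t)); intros. nra. }
  intros del t r r' Hdel Hr Hr'.
  apply Rabs_le_between in Hr. apply Rabs_le_between in Hr'.
  replace (f (r * cos t) (r * sin t) - f (r' * cos t) (r' * sin t) - fr t rs * (r - r')) with
    ((f (r * cos t) (r * sin t) - fr t rs * r) - (f (r' * cos t) (r' * sin t) - fr t rs * r')) by ring.
  apply (mean_value_bound (fun r => f (r * cos t) (r * sin t) - fr t rs * r) (fun r => fr t r - fr t rs)).
  - intros c. apply (derivable_pt_lim_minus (fun r => f (r * cos t) (r * sin t)) (fun r => fr t rs * r));
      [apply radial_derive|].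
    apply derivable_pt_lim_mul_const.
  - intros c Hc.
    assert (Hc' : - del <= c - rs <= del) by (revert Hc; unfold Rmin, Rmax; repeat destruct Rle_dec; lra).
    destruct (Hbox c t) as [X Y]; [lra|]. destruct (Hbox rs t) as [X' Y']; [lra|].
    destruct (B1 _ _ _ _ X Y X' Y') as [_ C1]. destruct (B2 _ _ _ _ X Y X' Y') as [_ C2].
    unfold fr.
    replace (fx (c * cos t) (c * sin t) * cos t + fy (c * cos t) (c * sin t) * sin t -
      (fx (rs * cos t) (rs * sin t) * cos t + fy (rs * cos t) (rs * sin t) * sin t)) with
      ((fx (c * cos t) (c * sin t) - fx (rs * cos t) (rs * sin t)) * cos t +
       (fy (c * cos t) (c * sin t) - fy (rs * cos t) (rs * sin t)) * sin t) by ring.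
    apply Rle_trans with (1 := Rabs_triang _ _). rewrite !Rabs_mult.
    rewrite <- !Rmult_minus_distr_r, !Rabs_mult in C1, C2.
    generalize (Rabs_cos_le t) (Rabs_sin_le t) (Rabs_pos (cos t)) (Rabs_pos (sin t)); intros T1 T2 T3 T4.
    assert (Hcr : Rabs (c - rs) <= del) by (apply Rabs_le_between; lra).
    assert (D : L * (Rabs (c - rs) * Rabs (cos t) + Rabs (c - rs) * Rabs (sin t)) <= 2 * L * del).
    { generalize (Rabs_pos (c - rs)); intros. replace (2 * L * del) with (L * (del + del)) by ring.
      apply Rmult_le_compat_l; auto. nra. }
    generalize (Rabs_pos (fx (c * cos t) (c * sin t) - fx (rs * cos t) (rs * sin t)))
      (Rabs_pos (fy (c * cos t) (c * sin t) - fy (rs * cos t) (rs * sin t))); intros. nra.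
Qed.

Lemma Gf0_linear : exists L, 0 < L /\ (forall s t, Rabs (Af s t) <= L) /\
  forall del s t r r' w w', del <= rs / 2 ->
  Rabs (r - rs) <= del -> Rabs (r' - rs) <= del ->
  Rabs (Gf0 s t r w - Gf0 s t r' w' - Af s t * (r - r')) <=
    L * del * Rabs (r - r') + L * Rabs (w - w').
Proof.
  destruct radial_estimate as [L [HL [Hb H]]].
  set (c := Rabs a1 + Rabs b1).
  assert (Hc : forall s, Rabs (coef s) <= c).
  { intros [|]; unfold c, coef; generalize (Rabs_pos a1) (Rabs_pos b1); lra. }
  assert (Hc0 : 0 <= c) by (unfold c; generalize (Rabs_pos a1) (Rabs_pos b1); lra).
  exists (c * L + c + 1). split; [nra|]. split.
  - intros s t. unfold Af. rewrite !Rabs_mult.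
    apply Rle_trans with (1 * (c * L)); [|nra].
    apply Rmult_le_compat; auto using Rabs_pos, Rabs_al_le.
    + apply Rmult_le_pos; apply Rabs_pos.
    + apply Rmult_le_compat; auto using Rabs_pos.
  - intros del s t r r' w w' Hdel Hr Hr'.
    specialize (H del t r r' Hdel Hr Hr').
    assert (Hdel0 : 0 <= del) by (apply Rle_trans with (2 := Hr); apply Rabs_pos).
    replace (Gf0 s t r w - Gf0 s t r' w' - Af s t * (r - r')) with
      (al s t * (coef s * ((f (r * cos t) (r * sin t) - f (r' * cos t) (r' * sin t) - fr t rs * (r - r'))
        + (w - w')))) by (unfold Gf0, Af, force0, coef, lift; destruct s; ring).
    set (q := f (r * cos t) (r * sin t) - f (r' * cos t) (r' * sin t) - fr t rs * (r - r')) in *.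
    rewrite !Rabs_mult.
    apply Rle_trans with (1 * (c * (L * del * Rabs (r - r') + Rabs (w - w')))).
    + apply Rmult_le_compat; auto using Rabs_pos, Rabs_al_le.
      * apply Rmult_le_pos; apply Rabs_pos.
      * apply Rmult_le_compat; auto using Rabs_pos.
        apply Rle_trans with (1 := Rabs_triang _ _); lra.
    + generalize (Rabs_pos (r - r')) (Rabs_pos (w - w')); intros.
      assert (Q1 : 0 <= (c + 1) * (del * Rabs (r - r'))) by (apply Rmult_le_pos; nra).
      assert (Q2 : 0 <= (c * L + 1) * Rabs (w - w')) by (apply Rmult_le_pos; nra).
      lra.
Qed.

(** The factor of the radial difference becomes arbitrarily small but that of [w - w'] does not. The
    latter is absorbed by the weight [M] in the existence argument and by the damping in the
    isolation argument. *)
Lemma Gf_linear e1 K : good e1 K -> exists K', 0 < K' /\ (forall s t, Rabs (Af s t) <= K') /\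
  forall kap, 0 < kap -> exists del, 0 < del <= e1 /\ del <= rs / 2 /\ forall e s t r r' w w',
    Rabs e <= del -> Rabs (r - rs) <= del -> Rabs (r' - rs) <= del -> Rabs w <= del -> Rabs w' <= del ->
    Rabs (Gf s e t r w - Gf s e t r' w' - Af s t * (r - r')) <= kap * Rabs (r - r') + K' * Rabs (w - w').
Proof.
  intros Hg. destruct Gf0_linear as [L [HL [HA H]]].
  destruct Hg as [He1 HK Hs _ _ H1 _ _].
  exists (L + K). split; [lra|]. split; [intros s t; apply Rle_trans with (1 := HA s t); lra|].
  intros kap Hkap.
  set (del := Rmin (Rmin e1 (rs / 2)) (kap / (L + K))).
  assert (D0 : 0 < del) by (repeat apply Rmin_pos; try lra; apply Rdiv_lt_0_compat; lra).
  assert (D1 : del <= e1) by (eapply Rle_trans; [apply Rmin_l|apply Rmin_l]).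
  assert (D2 : del <= rs / 2) by (eapply Rle_trans; [apply Rmin_l|apply Rmin_r]).
  assert (D3 : (L + K) * del <= kap).
  { apply Rle_trans with ((L + K) * (kap / (L + K))); [|right; field; lra].
    apply Rmult_le_compat_l; [lra|apply Rmin_r]. }
  exists del. split; [lra|]. split; [lra|].
  intros e s t r r' w w' He Hr Hr' Hw Hw'.
  assert (X := proj1 (Rabs_le_between _ _) Hr). assert (X' := proj1 (Rabs_le_between _ _) Hr').
  assert (Dom : dom r w) by (split; lra). assert (Dom' : dom r' w') by (split; lra).
  destruct (Hs s e t r w) as [S1 _]; auto; [lra|].
  destruct (Hs s e t r' w') as [S2 _]; auto; [lra|].
  rewrite (Gf_expand s e t r w), (Gf_expand s e t r' w') by lra.
  replace (Gf0 s t r w + e * Gf1 s e t r w - (Gf0 s t r' w' + e * Gf1 s e t r' w') - Af s t * (r - r'))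
    with ((Gf0 s t r w - Gf0 s t r' w' - Af s t * (r - r')) + e * (Gf1 s e t r w - Gf1 s e t r' w')) by ring.
  apply Rle_trans with (1 := Rabs_triang _ _). rewrite Rabs_mult.
  generalize (H del s t r r' w w' D2 Hr Hr'); intros A.
  destruct (H1 s e ltac:(lra) t r w t r' w' Dom Dom') as [_ B].
  rewrite Rminus_eq_0, Rabs_R0, Rplus_0_l in B.
  generalize (Rabs_pos (r - r')) (Rabs_pos (w - w')) (Rabs_pos e); intros P1 P2 P3.
  assert (C : Rabs e * Rabs (Gf1 s e t r w - Gf1 s e t r' w') <= del * (K * (Rabs (r - r') + Rabs (w - w'))))
    by (apply Rmult_le_compat; auto using Rabs_pos).
  assert (C1 : (L + K) * del * Rabs (r - r') <= kap * Rabs (r - r')) by (apply Rmult_le_compat_r; auto).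
  assert (C2 : del * (K * Rabs (w - w')) <= 1 * (K * Rabs (w - w'))) by (apply Rmult_le_compat_r; nra).
  lra.
Qed.

Lemma circle_continuous r t : continuous (fun t => f (r * cos t) (r * sin t)) t.
Proof.
  apply (is_derive_continuous _ _
    (fx (r * cos t) (r * sin t) * (- r * sin t) + fy (r * cos t) (r * sin t) * (r * cos t))).
  apply is_derive_Reals.
  apply (derivable_pt_lim_comp_2d f (fun t => r * cos t) (fun t => r * sin t)).
  - apply smooth2_differentiable; auto.
  - apply is_derive_Reals. auto_derive; auto; ring.
  - apply is_derive_Reals. auto_derive; auto; ring.
Qed.

Lemma cos_continuous t : continuous cos t.
Proof. apply (is_derive_continuous _ _ (- sin t)), is_derive_cos. Qed.

Lemma sin_continuous t : continuous sin t.
Proof. apply (is_derive_continuous _ _ (cos t)), is_derive_sin. Qed.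

Lemma al_continuous s t : continuous (al s) t.
Proof. destruct s; [apply cos_continuous|apply sin_continuous]. Qed.

Lemma Gf0_continuous r s t : continuous (fun t => Gf0 s t r 0) t.
Proof.
  apply (@continuous_mult R_UniformSpace R_AbsRing (al s)); [apply al_continuous|].
  assert (C : continuous (fun t => lift t r 0) t) by apply continuous_const_plus, circle_continuous.
  destruct s; unfold force0.
  - apply continuous_const_plus, continuous_const_mult, C.
  - apply continuous_const_mult, C.
Qed.

Lemma averaged_function (F1 : R -> R) r : is_f1 f a1 b1 F1 ->
  J (fun s t => Gf0 s t r 0) (2 * PI) = F1 r.
Proof.
  intros H. destruct (H r) as [p1 [p2 ->]]. rewrite J_2PI, <- !RInt_Reals.
  assert (C : forall t, continuous (fun t => f (r * cos t) (r * sin t)) t) by apply circle_continuous.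
  assert (C1 : forall t, continuous (fun t => f (r * cos t) (r * sin t) * cos t) t).
  { intros t. apply (@continuous_mult R_UniformSpace R_AbsRing (fun t => f (r * cos t) (r * sin t)) cos);
      [apply C|apply cos_continuous]. }
  assert (C2 : forall t, continuous (fun t => f (r * cos t) (r * sin t) * sin t) t).
  { intros t. apply (@continuous_mult R_UniformSpace R_AbsRing (fun t => f (r * cos t) (r * sin t)) sin);
      [apply C|apply sin_continuous]. }
  (* This zero mean of the cosine over the upper half-turn removes [a0] from the averaged
     function. *)
  assert (Ic : is_RInt cos 0 PI 0).
  { replace 0 with (minus (sin PI) (sin 0)) at 2
      by (rewrite sin_PI, sin_0; unfold minus, plus, opp; simpl; ring).
    apply (is_RInt_derive sin cos); intros; [apply is_derive_sin|apply cos_continuous]. }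
  f_equal; apply is_RInt_unique.
  - set (I := RInt (fun t => f (r * cos t) (r * sin t) * cos t) 0 PI).
    replace (a1 * I) with (plus (scal a0 0) (scal a1 I))
      by (unfold plus, scal; simpl; unfold mult; simpl; ring).
    apply (is_RInt_ext (fun t => plus (scal a0 (cos t)) (scal a1 (f (r * cos t) (r * sin t) * cos t)))).
    { intros t _. unfold Gf0, force0, al, lift, plus, scal; simpl; unfold mult; simpl. ring. }
    apply (@is_RInt_plus R_NormedModule); apply (@is_RInt_scal R_NormedModule); auto.
    apply (@RInt_correct R_CompleteNormedModule), ex_RInt_cont, C1.
  - set (I := RInt (fun t => f (r * cos t) (r * sin t) * sin t) PI (2 * PI)).
    apply (is_RInt_ext (fun t => scal b1 (f (r * cos t) (r * sin t) * sin t))).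
    { intros t _. unfold Gf0, force0, al, lift, scal; simpl; unfold mult; simpl. ring. }
    apply (@is_RInt_scal R_NormedModule).
    apply (@RInt_correct R_CompleteNormedModule), ex_RInt_cont, C2.
Qed.

Lemma Af_continuous s t : continuous (Af s) t.
Proof.
  destruct box_constant as [L [HL [_ [B1 B2]]]].
  assert (U1 : ublf 1 (fun _ t r _ => fx (r * cos t) (r * sin t)))
    by (apply (ubl_box (rs / 2) (2 * rs)) with (F := fx) (L := L); auto; lra).
  assert (U2 : ublf 1 (fun _ t r _ => fy (r * cos t) (r * sin t)))
    by (apply (ubl_box (rs / 2) (2 * rs)) with (F := fy) (L := L); auto; lra).
  assert (U : ublf 1 (fun _ t r _ => al s t * (coef s * fr t r))).
  { unfold fr. apply ubl_mult; [apply ubl_al|]. apply ubl_mult; [apply ubl_const|].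
    apply ubl_plus; (apply ubl_mult; [assumption|]); [apply ubl_cos|apply ubl_sin]. }
  destruct U as [K [HK U]]. revert t. apply (lipschitz_continuous _ K). intros x y.
  destruct (U 0 x rs 0 y rs 0) as [_ D]; rewrite ?Rabs_R0; try lra.
  rewrite !Rminus_eq_0, Rabs_R0, !Rplus_0_r in D. exact D.
Qed.

(** Differentiation under the integral: integrating the linearization of [Gf0] shows that
    [J Af (2 * PI)] is the derivative of [F1] at [rs], with an error quadratic in [h]; uniqueness of
    derivatives concludes. *)
Lemma averaged_derivative (F1 : R -> R) d : is_f1 f a1 b1 F1 -> derivable_pt_lim F1 rs d ->
  J Af (2 * PI) = d.
Proof.
  intros HF Hd. apply (uniqueness_limite F1 rs); auto.
  destruct Gf0_linear as [L [HL [_ H]]]. generalize PI_RGT_0; intros HPI.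
  assert (HC : 0 < L * (2 * PI)) by nra.
  intros eps Heps.
  assert (Hdel : 0 < Rmin (rs / 2) (eps / (2 * (L * (2 * PI)))))
    by (apply Rmin_pos; [lra|apply Rdiv_lt_0_compat; lra]).
  exists (mkposreal _ Hdel); simpl; intros h Hh Hhd.
  assert (H1 : Rabs h <= rs / 2) by (left; eapply Rlt_le_trans; [exact Hhd|apply Rmin_l]).
  assert (H2 : Rabs h < eps / (2 * (L * (2 * PI)))) by (eapply Rlt_le_trans; [exact Hhd|apply Rmin_r]).
  rewrite <- !(averaged_function F1) by auto.
  assert (Hp : 0 < Rabs h) by (apply Rabs_pos_lt; auto).
  assert (CG : forall r s t, continuous (fun t => Gf0 s t r 0) t) by (intros; apply Gf0_continuous).
  assert (E : Rabs (J (fun s t => Gf0 s t (rs + h) 0 - Gf0 s t rs 0) (2 * PI) -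
      J (fun s t => h * Af s t) (2 * PI))
    <= L * Rabs h * Rabs h * Rabs (2 * PI)).
  { apply J_close.
    - intros s t. apply (@continuous_minus R_UniformSpace R_AbsRing R_NormedModule
        (fun t => Gf0 s t (rs + h) 0) (fun t => Gf0 s t rs 0)); apply CG.
    - intros s t. apply continuous_const_mult, Af_continuous.
    - intros s t. generalize (H (Rabs h) s t (rs + h) rs 0 0 H1).
      replace (rs + h - rs) with h by ring. rewrite !Rminus_eq_0, Rabs_R0.
      intros A. rewrite (Rmult_comm h). lra. }
  rewrite J_minus, J_scal in E by (auto using Af_continuous).
  rewrite (Rabs_pos_eq (2 * PI)) in E by lra.
  replace ((J (fun s t => Gf0 s t (rs + h) 0) (2 * PI) - J (fun s t => Gf0 s t rs 0) (2 * PI)) / h -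
      J Af (2 * PI))
    with ((J (fun s t => Gf0 s t (rs + h) 0) (2 * PI) - J (fun s t => Gf0 s t rs 0) (2 * PI) -
      h * J Af (2 * PI)) / h)
    by (field; auto).
  unfold Rdiv at 1. rewrite Rabs_mult, Rabs_inv.
  apply Rmult_lt_reg_r with (Rabs h); auto. rewrite Rmult_assoc, Rinv_l, Rmult_1_r by lra.
  apply Rle_lt_trans with (1 := E).
  apply Rmult_lt_compat_r with (r := L * (2 * PI)) in H2; auto.
  replace (eps / (2 * (L * (2 * PI))) * (L * (2 * PI))) with (eps / 2) in H2 by (field; lra).
  nra.
Qed.

(** * Construction of the limit cycle *)

(** The contraction asks for bounds at all radii and heights. Clamping extends the field globally
    with the same constants, and for small [e] the solution found stays where nothing was
    changed. *)
Definition clampf (F : R -> R -> R -> R) (t r w : R) : R :=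
  F t (clamp (rs / 2) (2 * rs) r) (clamp (-1) 1 w).

Lemma clamp_dom r w : dom (clamp (rs / 2) (2 * rs) r) (clamp (-1) 1 w).
Proof. split; [apply clamp_in; lra|apply Rabs_le, clamp_in; lra]. Qed.

Lemma clampf_id F t r w : dom r w -> clampf F t r w = F t r w.
Proof.
  intros [Hr Hw]. unfold clampf. rewrite !clamp_id; auto. apply Rabs_le_between; auto.
Qed.

Lemma lip_dom_clampf K F : 0 <= K -> lip_dom K F ->
  lipschitz3 K (clampf F) /\ forall t r w, Rabs (clampf F t r w) <= K.
Proof.
  intros HK H. split.
  - intros t r w t' r' w'. unfold clampf.
    destruct (H t _ _ t' _ _ (clamp_dom r w) (clamp_dom r' w')) as [_ A].
    apply Rle_trans with (1 := A). apply Rmult_le_compat_l; auto.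
    generalize (clamp_lip (rs / 2) (2 * rs) r r') (clamp_lip (-1) 1 w w'); lra.
  - intros t r w. apply (H t _ _ t _ _ (clamp_dom r w) (clamp_dom r w)).
Qed.

Lemma lip_dom_continuous K F (r w : R -> R) : 0 <= K -> lip_dom K F ->
  (forall t, continuous r t) -> (forall t, continuous w t) -> (forall t, dom (r t) (w t)) ->
  forall t, continuous (fun t => F t (r t) (w t)) t.
Proof.
  intros HK HF Hr Hw Hd t.
  apply (continuous_ext (fun t => clampf F t (r t) (w t))).
  - intros u. apply clampf_id, Hd.
  - apply (lipschitz3_continuous K); auto. apply lip_dom_clampf; auto.
Qed.

Record orbit (C e : R) (r w : R -> R) : Prop := {
  orbit_r : forall t, continuous r t;
  orbit_w : forall t, continuous w t;
  orbit_dom : forall t, dom (r t) (w t);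
  orbit_near_r : forall t, Rabs (r t - rs) <= Rabs e * C;
  orbit_near_w : forall t, Rabs (w t) <= Rabs e * C;
  orbit_per_r : r (2 * PI) = r 0;
  orbit_per_w : w (2 * PI) = w 0;
  orbit_ode : forall (s : bool) t, (if s then 0 < t < PI else PI < t < 2 * PI) ->
    is_derive r t (e * Gf s e t (r t) (w t)) /\
    is_derive w t (- w t + e * Wf s e t (r t) (w t))
}.

Lemma orbit_exists e1 K F1 d : good e1 K -> is_f1 f a1 b1 F1 -> F1 rs = 0 ->
  derivable_pt_lim F1 rs d -> d <> 0 ->
  exists e0 C, 0 < e0 /\ 0 < C /\ forall e, Rabs e <= e0 -> exists r w, orbit C e r w.
Proof.
  intros Hg HF H0 Hd Hdn.
  destruct (Gf_linear e1 K Hg) as [K' [HK' [HA Hlin]]].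
  destruct Hg as [He1 HK Hs HG HW HG1 _ _].
  generalize PI_RGT_0; intros HPI.
  (* The term [2 * PI * K] bounds the integral of [Gf1] over a turn, which controls the failure of
     the averaged equation at [rs]. *)
  set (Kb := K + K' + 2 * PI * K).
  assert (HKb : 0 < 2 * PI * K) by (apply Rmult_lt_0_compat; lra).
  assert (HJ := averaged_derivative F1 d HF Hd).
  destruct (periodic_solutions (fun e s => clampf (Gf s e)) (fun e s => clampf (Wf s e)) Af rs d Kb e1)
    as [e0 [C [He0 [HC H]]]]; auto; try lra.
  - intros e s He. apply (lip_dom_clampf Kb); [unfold Kb; lra|].
    apply (lip_dom_mono K); [unfold Kb; lra|auto].
  - intros e s He. apply (lip_dom_clampf Kb); [unfold Kb; lra|].
    apply (lip_dom_mono K); [unfold Kb; lra|auto].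
  - intros e s t r w He. apply (lip_dom_clampf Kb); [unfold Kb; lra|].
    apply (lip_dom_mono K); [unfold Kb; lra|auto].
  - intros e s t r w He. apply (lip_dom_clampf Kb); [unfold Kb; lra|].
    apply (lip_dom_mono K); [unfold Kb; lra|auto].
  - intros; apply Af_continuous.
  - intros s t. apply Rle_trans with (1 := HA s t); unfold Kb; lra.
  - intros kap Hkap. destruct (Hlin kap Hkap) as [del [[D1 D2] [D3 D]]].
    exists del; split; auto. intros e s t r r' w w' He Hr Hr' Hw Hw'.
    assert (X := proj1 (Rabs_le_between _ _) Hr). assert (X' := proj1 (Rabs_le_between _ _) Hr').
    rewrite !clampf_id by (split; lra).
    apply Rle_trans with (1 := D e s t r r' w w' He Hr Hr' Hw Hw').
    apply Rplus_le_compat_l, Rmult_le_compat_r; [apply Rabs_pos|unfold Kb; lra].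
  - intros e He.
    assert (Dm : dom rs 0) by (split; [lra|rewrite Rabs_R0; lra]).
    rewrite (J_ext _ (fun s t => Gf0 s t rs 0 + e * Gf1 s e t rs 0)).
    + assert (CG1 : forall s t, continuous (fun t => Gf1 s e t rs 0) t).
      { intros s. apply (lip_dom_continuous K (Gf1 s e) (fun _ => rs) (fun _ => 0)); auto; try lra;
          intros; apply continuous_const. }
      assert (E := J_close (fun s t => Gf0 s t rs 0 + e * Gf1 s e t rs 0) (fun s t => Gf0 s t rs 0)
        (Rabs e * K) (2 * PI)).
      rewrite (averaged_function F1 rs HF), H0, Rminus_0_r, (Rabs_pos_eq (2 * PI)) in E by lra.
      apply Rle_trans with (Rabs e * K * (2 * PI)).
      * apply E.
        -- intros s t. apply (@continuous_plus R_UniformSpace R_AbsRing R_NormedModule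
             (fun t => Gf0 s t rs 0) (fun t => e * Gf1 s e t rs 0));
             [apply Gf0_continuous|apply continuous_const_mult, CG1].
        -- intros s t. apply Gf0_continuous.
        -- intros s t. replace (Gf0 s t rs 0 + e * Gf1 s e t rs 0 - Gf0 s t rs 0)
             with (e * Gf1 s e t rs 0) by ring.
           rewrite Rabs_mult. apply Rmult_le_compat_l; [apply Rabs_pos|].
           apply (HG1 s e He t rs 0 t rs 0 Dm Dm).
      * unfold Kb. generalize (Rabs_pos e); nra.
    + intros s t. rewrite clampf_id by auto. apply Gf_expand.
      destruct (Hs s e t rs 0 He Dm); lra.
  - set (m := Rmin (rs / 2) 1). assert (Hm : 0 < m) by (apply Rmin_pos; lra).
    exists (Rmin e0 (m / C)), C.
    split; [apply Rmin_pos; auto; apply Rdiv_lt_0_compat; auto|]. split; auto.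
    intros e He.
    destruct (H e) as [r [w [Cr [Cw [Nr [Nw [Pr [Pw Hode]]]]]]]];
      [apply Rle_trans with (1 := He), Rmin_l|].
    assert (HeC : Rabs e * C <= m).
    { apply Rle_trans with (m / C * C); [|right; field; lra].
      apply Rmult_le_compat_r; [lra|]. apply Rle_trans with (1 := He), Rmin_r. }
    assert (Hdom : forall t, dom (r t) (w t)).
    { intros t. generalize (Nr t) (Nw t) (Rmin_l (rs / 2) 1) (Rmin_r (rs / 2) 1).
      fold m. intros A B M1 M2. apply Rabs_le_between in A. split; lra. }
    exists r, w. split; auto.
    intros s t Ht. destruct (Hode s t Ht) as [A B].
    rewrite clampf_id in A, B by auto. auto.
Qed.

(** * Cartesian against cylindrical components *)

Definition FZ (s : bool) (e z : R) : R := force0 s z + e * force1 s z.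
Definition vx (s : bool) (e y z : R) : R := - y + (if s then e * FZ s e z else 0).
Definition vy (s : bool) (e x z : R) : R := x + (if s then 0 else e * FZ s e z).
Definition vz (x y z : R) : R := - z + gfun f fx fy x y.
Definition side (s : bool) (y : R) : Prop := if s then 0 < y else y < 0.

Section Polar.
Variables (s : bool) (e t r w : R).
Hypothesis Hr : 0 < r.
Hypothesis Hsp : speed s e t r w <> 0.

Lemma sin2_eq : sin t * sin t = 1 - cos t * cos t.
Proof. generalize (sin2_cos2 t); unfold Rsqr; lra. Qed.

Lemma speed_Gf : speed s e t r w * (e * Gf s e t r w) = e * (al s t * force s e t r w).
Proof. unfold Gf. field. auto. Qed.

Lemma speed_Wf : speed s e t r w * (- w + e * Wf s e t r w) = - w - e * (force s e t r w * slope s t r).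
Proof.
  transitivity (- w * speed s e t r w + e * (- (force s e t r w * slope s t r) + w * turning s e t r w));
    [unfold Wf; field; auto|]. unfold speed; ring.
Qed.

Lemma polar_vx : vx s e (r * sin t) (lift t r w) =
  speed s e t r w * (e * Gf s e t r w) * cos t - r * sin t * speed s e t r w.
Proof.
  rewrite speed_Gf. unfold speed, turning, vx. fold (force s e t r w).
  change (FZ s e (lift t r w)) with (force s e t r w). generalize (force s e t r w); intros m.
  generalize sin2_eq; intros E. destruct s; simpl.
  - transitivity (- (r * sin t) + e * (cos t * m) * cos t + e * m * (sin t * sin t)); [rewrite E; ring|].
    field; lra.
  - field; lra.
Qed.

Lemma polar_vy : vy s e (r * cos t) (lift t r w) =
  speed s e t r w * (e * Gf s e t r w) * sin t + r * cos t * speed s e t r w.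
Proof.
  rewrite speed_Gf. unfold speed, turning, vy.
  change (FZ s e (lift t r w)) with (force s e t r w). generalize (force s e t r w); intros m.
  generalize sin2_eq; intros E. destruct s; simpl.
  - field; lra.
  - transitivity (r * cos t + e * m * (sin t * sin t) + e * m * (cos t * cos t)); [rewrite E; ring|].
    field; lra.
Qed.

Lemma polar_radial : (r * cos t * vx s e (r * sin t) (lift t r w) +
  r * sin t * vy s e (r * cos t) (lift t r w)) / r = speed s e t r w * (e * Gf s e t r w).
Proof.
  rewrite polar_vx, polar_vy.
  set (S := speed s e t r w). set (G := S * (e * Gf s e t r w)).
  transitivity (G * (cos t * cos t) + G * (sin t * sin t)); [field; lra|].
  rewrite sin2_eq; ring.
Qed.

Lemma polar_angular : (r * cos t * vy s e (r * cos t) (lift t r w) -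
  r * sin t * vx s e (r * sin t) (lift t r w)) / (r * r) = speed s e t r w.
Proof.
  rewrite polar_vx, polar_vy.
  set (S := speed s e t r w). set (G := S * (e * Gf s e t r w)).
  transitivity (S * (cos t * cos t) + S * (sin t * sin t)); [field; lra|].
  rewrite sin2_eq; ring.
Qed.

(** The rotation changes [f] at the rate [x * fy - y * fx], which is built into [gfun]. Hence [w]
    decays at rate 1 and is disturbed only by the perturbing force times the partial derivative of
    [f] in its direction. *)
Lemma polar_vertical : vz (r * cos t) (r * sin t) (lift t r w) -
  (fx (r * cos t) (r * sin t) * vx s e (r * sin t) (lift t r w) +
   fy (r * cos t) (r * sin t) * vy s e (r * cos t) (lift t r w)) =
  speed s e t r w * (- w + e * Wf s e t r w).
Proof.
  rewrite speed_Wf. unfold vz, gfun, vx, vy.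
  change (FZ s e (lift t r w)) with (force s e t r w). generalize (force s e t r w); intros m.
  unfold lift, slope. destruct s; ring.
Qed.
End Polar.

(** * From the angular orbit to a periodic trajectory *)

Section Cycle.
Variables (e1 K C e : R) (r w : R -> R).
Hypothesis Hg : good e1 K.
Hypothesis He : Rabs e <= e1.
Hypothesis HeK : Rabs e * K < rs / 2.
Hypothesis Ho : orbit C e r w.

Definition cyl (t : R) : R3 := (r t * cos t, r t * sin t, lift t (r t) (w t)).
Definition slowness (s : bool) (t : R) : R := / speed s e t (r t) (w t).
Definition clock (t : R) : R := J slowness t.

Lemma orbit_speed s t : / 2 <= speed s e t (r t) (w t) <= 3 / 2 /\
  Rabs (speed s e t (r t) (w t) - 1) <= K * Rabs e.
Proof. apply (good_speed _ _ Hg); auto. apply (orbit_dom _ _ _ _ Ho). Qed.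

Lemma orbit_radius t : 0 < rs / 2 <= r t.
Proof. destruct (orbit_dom _ _ _ _ Ho t) as [H _]. lra. Qed.

Lemma slowness_bounds s t : 2 / 3 <= slowness s t <= 2 /\ Rabs (slowness s t - 1) <= 2 * K * Rabs e.
Proof.
  destruct (orbit_speed s t) as [A B]. unfold slowness. set (v := speed s e t (r t) (w t)) in *.
  assert (I : / v * v = 1) by (apply Rinv_l; lra).
  assert (Hi : 0 < / v) by (apply Rinv_0_lt_compat; lra).
  assert (Hi2 : 2 / 3 <= / v <= 2) by (split; nra). split; auto.
  replace (/ v - 1) with (- (/ v * (v - 1))) by (rewrite Rmult_minus_distr_l, I; ring).
  rewrite Rabs_Ropp, Rabs_mult, (Rabs_pos_eq (/ v)) by lra.
  generalize (Rabs_pos (v - 1)); intros. nra.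
Qed.

Lemma slowness_continuous s t : continuous (slowness s) t.
Proof.
  unfold slowness. destruct (orbit_speed s t) as [A _].
  apply (continuous_comp (fun t => speed s e t (r t) (w t)) Rinv).
  - clear A. revert t.
    apply (lip_dom_continuous K (speed s e)).
    + generalize (good_K _ _ Hg); lra.
    + apply (good_S _ _ Hg); auto.
    + apply (orbit_r _ _ _ _ Ho).
    + apply (orbit_w _ _ _ _ Ho).
    + apply (orbit_dom _ _ _ _ Ho).
  - apply continuous_Rinv. lra.
Qed.

Lemma clock_increasing t t' : t <= t' -> 2 / 3 * (t' - t) <= clock t' - clock t.
Proof.
  intros H. apply (J_between slowness slowness_continuous (2 / 3) 2); auto. intros; apply slowness_bounds.
Qed.

Lemma clock_0 : clock 0 = 0.
Proof. apply J_0. Qed.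

Lemma clock_period : Rabs (clock (2 * PI) - 2 * PI) <= 4 * PI * K * Rabs e.
Proof.
  generalize PI_RGT_0; intros HPI.
  assert (H := J_between slowness slowness_continuous (1 - 2 * K * Rabs e) (1 + 2 * K * Rabs e) 0 (2 * PI)).
  rewrite J_0 in H. fold (clock (2 * PI)) in H. apply Rabs_le_between.
  assert (B : forall s u, 1 - 2 * K * Rabs e <= slowness s u <= 1 + 2 * K * Rabs e).
  { intros s u. destruct (slowness_bounds s u) as [_ B]. apply Rabs_le_between in B. lra. }
  specialize (H ltac:(lra) B). lra.
Qed.

Definition in_side (s : bool) (t : R) : Prop := if s then 0 < t < PI else PI < t < 2 * PI.

Lemma clock_derive s t : in_side s t -> is_derive clock t (slowness s t).
Proof.
  intros H. destruct s; unfold in_side in H; [apply J_derive_lt|apply J_derive_gt]; try lra;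
    apply slowness_continuous.
Qed.

Lemma cyl_side s t : 0 <= t < 2 * PI -> side s (r t * sin t) -> in_side s t.
Proof.
  intros Ht Hs. generalize (orbit_radius t); intros Hr. destruct s; unfold side, in_side in *.
  - destruct (Req_dec t 0) as [->|N]; [rewrite sin_0 in Hs; lra|].
    destruct (Rlt_dec t PI); [lra|]. generalize (sin_le_0 t ltac:(lra) ltac:(lra)). nra.
  - destruct (Rlt_dec PI t); [lra|]. generalize (sin_ge_0 t ltac:(lra) ltac:(lra)). nra.
Qed.

Lemma cyl_zero t : 0 <= t < 2 * PI -> r t * sin t = 0 -> t = 0 \/ t = PI.
Proof.
  intros Ht Hz. generalize (orbit_radius t); intros Hr.
  assert (Hs : sin t = 0) by (apply Rmult_eq_reg_l with (r t); lra).
  destruct (Rtotal_order t PI) as [H|[H|H]]; auto.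
  - destruct (Req_dec t 0); auto. generalize (sin_gt_0 t ltac:(lra) H); lra.
  - generalize (sin_lt_0 t H ltac:(lra)); lra.
Qed.

Lemma cyl_derive (th : R -> R) (s : bool) u : in_side s (th u) ->
  is_derive th u (speed s e (th u) (r (th u)) (w (th u))) ->
  is_derive (fun u => p1 (cyl (th u))) u (vx s e (p2 (cyl (th u))) (p3 (cyl (th u)))) /\
  is_derive (fun u => p2 (cyl (th u))) u (vy s e (p1 (cyl (th u))) (p3 (cyl (th u)))) /\
  is_derive (fun u => p3 (cyl (th u))) u (vz (p1 (cyl (th u))) (p2 (cyl (th u))) (p3 (cyl (th u)))).
Proof.
  intros Hs Hth. unfold cyl, p1, p2, p3; simpl.
  set (t := th u) in *. set (S := speed s e t (r t) (w t)) in *.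
  destruct (orbit_ode _ _ _ _ Ho s t Hs) as [Or Ow].
  destruct (orbit_speed s t) as [HS _]. generalize (orbit_radius t); intros Hr.
  assert (Dr : is_derive (fun u => r (th u)) u (S * (e * Gf s e t (r t) (w t))))
    by (apply (is_derive_comp r th); auto).
  assert (Dw : is_derive (fun u => w (th u)) u (S * (- w t + e * Wf s e t (r t) (w t))))
    by (apply (is_derive_comp w th); auto).
  assert (Dc : is_derive (fun u => cos (th u)) u (S * - sin t))
    by (apply (is_derive_comp cos th); auto; apply is_derive_cos).
  assert (Dsn : is_derive (fun u => sin (th u)) u (S * cos t))
    by (apply (is_derive_comp sin th); auto; apply is_derive_sin).
  assert (DX : is_derive (fun u => r (th u) * cos (th u)) u (vx s e (r t * sin t) (lift t (r t) (w t)))).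
  { rewrite polar_vx by lra. fold S.
    replace (S * (e * Gf s e t (r t) (w t)) * cos t - r t * sin t * S) with
      (S * (e * Gf s e t (r t) (w t)) * cos t + r t * (S * - sin t)) by ring.
    apply (is_derive_mult (fun u => r (th u)) (fun u => cos (th u))); auto. intros; apply Rmult_comm. }
  assert (DY : is_derive (fun u => r (th u) * sin (th u)) u (vy s e (r t * cos t) (lift t (r t) (w t)))).
  { rewrite polar_vy by lra. fold S.
    replace (S * (e * Gf s e t (r t) (w t)) * sin t + r t * cos t * S) with
      (S * (e * Gf s e t (r t) (w t)) * sin t + r t * (S * cos t)) by ring.
    apply (is_derive_mult (fun u => r (th u)) (fun u => sin (th u))); auto. intros; apply Rmult_comm. }
  split; [exact DX|]. split; [exact DY|].
  unfold lift at 1.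
  replace (vz (r t * cos t) (r t * sin t) (lift t (r t) (w t))) with
    (S * (- w t + e * Wf s e t (r t) (w t)) +
     (fx (r t * cos t) (r t * sin t) * vx s e (r t * sin t) (lift t (r t) (w t)) +
      fy (r t * cos t) (r t * sin t) * vy s e (r t * cos t) (lift t (r t) (w t)))).
  2:{ unfold S. rewrite <- polar_vertical by lra. ring. }
  apply (@is_derive_plus R_AbsRing R_NormedModule (fun u => w (th u))
    (fun u => f (r (th u) * cos (th u)) (r (th u) * sin (th u)))); auto.
  apply is_derive_Reals.
  apply (derivable_pt_lim_comp_2d f (fun u => r (th u) * cos (th u)) (fun u => r (th u) * sin (th u))).
  - apply smooth2_differentiable; auto.
  - apply is_derive_Reals, DX.
  - apply is_derive_Reals, DY.
Qed.

Lemma cyl_continuous t : continuous (fun t => p1 (cyl t)) t /\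
  continuous (fun t => p2 (cyl t)) t /\ continuous (fun t => p3 (cyl t)) t.
Proof.
  unfold cyl, p1, p2, p3; simpl.
  generalize (orbit_r _ _ _ _ Ho) (orbit_w _ _ _ _ Ho); intros Cr Cw.
  assert (CX : continuous (fun t => r t * cos t) t)
    by (apply (@continuous_mult R_UniformSpace R_AbsRing r cos); auto; apply cos_continuous).
  assert (CY : continuous (fun t => r t * sin t) t)
    by (apply (@continuous_mult R_UniformSpace R_AbsRing r sin); auto; apply sin_continuous).
  split; [exact CX|]. split; [exact CY|].
  apply (@continuous_plus R_UniformSpace R_AbsRing R_NormedModule w
    (fun t => f (r t * cos t) (r t * sin t))); auto.
  apply cont2_comp_continuous; auto. apply smooth2_cont2, Hsm.
Qed.

Lemma cyl_period : cyl (2 * PI) = cyl 0.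
Proof.
  unfold cyl. rewrite (orbit_per_r _ _ _ _ Ho), (orbit_per_w _ _ _ _ Ho), cos_2PI, sin_2PI, cos_0, sin_0.
  unfold lift. rewrite cos_2PI, sin_2PI, cos_0, sin_0. auto.
Qed.

Notation Xp := (Xplus f fx fy a0 a1 a2 a3 e).
Notation Xm := (Xminus f fx fy b1 b2 b3 e).

Lemma Xp_components p : p1 (Xp p) = vx true e (p2 p) (p3 p) /\
  p2 (Xp p) = vy true e (p1 p) (p3 p) /\ p3 (Xp p) = vz (p1 p) (p2 p) (p3 p).
Proof.
  unfold Xplus, vx, vy, vz, FZ, force0, force1, p1, p2, p3; simpl. repeat split; ring.
Qed.

Lemma Xm_components p : p1 (Xm p) = vx false e (p2 p) (p3 p) /\
  p2 (Xm p) = vy false e (p1 p) (p3 p) /\ p3 (Xm p) = vz (p1 p) (p2 p) (p3 p).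
Proof.
  unfold Xminus, vx, vy, vz, FZ, force0, force1, p1, p2, p3; simpl. repeat split; ring.
Qed.

(** On Sigma [Rabs x] equals the radius, at least [rs / 2]. The upper field has second component
    [x], and the lower one differs from [x] by at most [Rabs e * K < rs / 2], so the signs agree. *)
Lemma cyl_crossing t : p2 (cyl t) = 0 -> 0 < p2 (Xp (cyl t)) * p2 (Xm (cyl t)).
Proof.
  intros Hz. destruct (Xp_components (cyl t)) as [_ [-> _]]. destruct (Xm_components (cyl t)) as [_ [-> _]].
  unfold cyl, p1, p2, p3 in *; simpl in *. unfold vy.
  change (FZ false e (lift t (r t) (w t))) with (force false e t (r t) (w t)).
  generalize (orbit_dom _ _ _ _ Ho t) (orbit_radius t); intros D Hr.
  destruct (good_force _ _ Hg false e He t (r t) (w t) t (r t) (w t) D D) as [B _].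
  set (m := force false e t (r t) (w t)) in *. set (x := r t * cos t) in *.
  assert (Hx : x * x = r t * r t).
  { transitivity (x * x + (r t * sin t) * (r t * sin t)); [rewrite Hz; ring|].
    unfold x. generalize (sin2_eq t); intros E.
    transitivity (r t * r t * (cos t * cos t) + r t * r t * (sin t * sin t)); [ring|rewrite E; ring]. }
  assert (Hax : Rabs x = r t).
  { apply Rsqr_eq_abs_0 in Hx. rewrite Hx, Rabs_pos_eq; lra. }
  assert (Hm : Rabs (e * m) < rs / 2).
  { rewrite Rabs_mult. apply Rle_lt_trans with (2 := HeK). apply Rmult_le_compat_l; auto using Rabs_pos. }
  assert (Hxm : Rabs (x * (e * m)) < x * x).
  { rewrite Rabs_mult, Hax, Hx. apply Rmult_lt_compat_l; lra. }
  generalize (Rabs_le_between (x * (e * m)) (Rabs (x * (e * m)))). intros [Q _].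
  specialize (Q (Rle_refl _)). lra.
Qed.

Theorem cycle_exists : exists (phi : R -> R3) (T : R), periodic_sol Xp Xm phi T /\
  Rabs (T - 2 * PI) <= 4 * PI * K * Rabs e /\ phi 0 = cyl 0 /\
  (forall t, exists th, 0 <= th < 2 * PI /\ phi t = cyl th) /\
  (forall th, 0 <= th < 2 * PI -> exists t, phi t = cyl th).
Proof.
  generalize PI_RGT_0; intros HPI.
  destruct (increasing_inverse clock (2 / 3)) as [th [T1 [T2 [Tc Td]]]];
    [lra|intros; apply (J_continuous slowness slowness_continuous)|apply clock_0|apply clock_increasing|].
  (* [T] is the duration of a turn and [P] the instant of the crossing at angle [PI]. *)
  set (T := clock (2 * PI)). set (P := clock PI).
  assert (HP : 0 < P) by (generalize (clock_increasing 0 PI) clock_0; unfold P; lra).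
  assert (HPT : P < T) by (generalize (clock_increasing PI (2 * PI)); unfold P, T; lra).
  assert (HT : 0 < T) by lra.
  assert (Hord : forall u v, u < v -> th u < th v).
  { intros u v Huv. destruct (Rlt_dec (th u) (th v)) as [|N]; auto.
    generalize (clock_increasing (th v) (th u)). rewrite !T1. lra. }
  assert (th0 : th 0 = 0) by (generalize (T2 0); rewrite clock_0; auto).
  assert (thP : th P = PI) by apply T2.
  assert (thT : th T = 2 * PI) by apply T2.
  assert (Hrange : forall u, 0 <= u < T -> 0 <= th u < 2 * PI).
  { intros u [Hu1 Hu2]. split; [|rewrite <- thT; apply Hord; auto].
    destruct Hu1 as [Hu1|<-]; [generalize (Hord 0 u Hu1)|]; lra. }
  set (X := fun u => p1 (cyl (th u))). set (Y := fun u => p2 (cyl (th u))).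
  set (Z := fun u => p3 (cyl (th u))).
  set (phi := fun t => (perext X T t, perext Y T t, perext Z T t) : R3).
  assert (Hphi : forall k u, 0 <= u < T -> phi (u + IZR k * T) = cyl (th u)).
  { intros k u Hu. unfold phi.
    rewrite !(perext_eq _ T k (u + IZR k * T)) by lra.
    replace (u + IZR k * T - IZR k * T) with u by ring.
    unfold X, Y, Z. destruct (cyl (th u)) as [[x y] z]; reflexivity. }
  assert (Hred : forall t, exists k u, 0 <= u < T /\ t = u + IZR k * T).
  { intros t. destruct (floor_multiple T t HT) as [k Hk].
    exists k, (t - IZR k * T). split; lra. }
  assert (HX : forall u, continuous X u).
  { intros u. apply (continuous_comp th (fun t => p1 (cyl t))); [apply Tc|exact (proj1 (cyl_continuous _))]. }
  assert (HY : forall u, continuous Y u).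
  { intros u. apply (continuous_comp th (fun t => p2 (cyl t)));
      [apply Tc|exact (proj1 (proj2 (cyl_continuous _)))]. }
  assert (HZ : forall u, continuous Z u).
  { intros u. apply (continuous_comp th (fun t => p3 (cyl t)));
      [apply Tc|exact (proj2 (proj2 (cyl_continuous _)))]. }
  assert (PX : X T = X 0 /\ Y T = Y 0 /\ Z T = Z 0).
  { unfold X, Y, Z. rewrite thT, th0, cyl_period. auto. }
  assert (Hside : forall s t, side s (p2 (phi t)) ->
    is_derive (fun u => p1 (phi u)) t (vx s e (p2 (phi t)) (p3 (phi t))) /\
    is_derive (fun u => p2 (phi u)) t (vy s e (p1 (phi t)) (p3 (phi t))) /\
    is_derive (fun u => p3 (phi u)) t (vz (p1 (phi t)) (p2 (phi t)) (p3 (phi t)))).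
  { intros s t Hs. destruct (Hred t) as [k [u [Hu Et]]].
    assert (Ep : phi t = cyl (th u)) by (rewrite Et; auto).
    rewrite Ep in Hs |- *.
    assert (Hin : in_side s (th u)) by (apply cyl_side; auto).
    assert (Hu0 : 0 < u).
    { destruct (Req_dec u 0) as [E|]; [|lra]. rewrite E, th0 in Hin.
      destruct s; unfold in_side in Hin; lra. }
    assert (Dth : is_derive th u (speed s e (th u) (r (th u)) (w (th u)))).
    { destruct (orbit_speed s (th u)) as [B _].
      replace (speed s e (th u) (r (th u)) (w (th u))) with (/ slowness s (th u))
        by (unfold slowness; rewrite Rinv_inv; auto).
      apply Td; [|apply clock_derive; auto].
      unfold slowness. apply Rinv_neq_0_compat. lra. }
    assert (Eu : t - IZR k * T = u) by lra.
    destruct (cyl_derive th s u Hin Dth) as [DX [DY DZ]].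
    split; [|split]; [apply (perext_derive X T k)|apply (perext_derive Y T k)|apply (perext_derive Z T k)];
      auto; try lra; rewrite Eu; auto. }
  assert (HNZ : forall k u, 0 < u < T -> u <> P -> p2 (phi (u + IZR k * T)) <> 0).
  { intros k u Hu HuP. rewrite Hphi by lra. intros E.
    destruct (cyl_zero (th u) (Hrange u ltac:(lra)) E) as [E0|EP].
    - assert (u = 0) by (rewrite <- (T1 u), E0; apply clock_0). lra.
    - apply HuP. rewrite <- (T1 u), EP. reflexivity. }
  exists phi, T. split; [|split; [apply clock_period|split; [|split]]].
  - split; [|split; [auto|split]].
    + split; [|split; [|split]].
      * intros t. destruct PX as [P1 [P2 P3]].
        split; [|split]; apply continuity_pt_filterlim;
          [apply (perext_continuous X)|apply (perext_continuous Y)|apply (perext_continuous Z)]; auto.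
      * intros t Ht. destruct (Xp_components (phi t)) as [-> [-> ->]].
        destruct (Hside true t Ht) as [A [B D]]. split; [|split]; apply is_derive_Reals; auto.
      * intros t Ht. destruct (Xm_components (phi t)) as [-> [-> ->]].
        destruct (Hside false t Ht) as [A [B D]]. split; [|split]; apply is_derive_Reals; auto.
      * intros t Ht. destruct (Hred t) as [k [u [Hu Et]]].
        assert (Ep : phi t = cyl (th u)) by (rewrite Et; auto).
        rewrite Ep in Ht |- *. split; [apply cyl_crossing; auto|].
        (* Crossings occur only at the times 0 and [P] modulo [T], so the smaller of the two gaps
           isolates them. *)
        assert (Hm : 0 < Rmin P (T - P)) by (apply Rmin_pos; lra).
        exists (Rmin P (T - P)). split; auto.
        generalize (Rmin_l P (T - P)) (Rmin_r P (T - P)); intros M1 M2.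
        intros v [Hv0 Hv]. set (dl := v - t) in *.
        assert (Hdl : - Rmin P (T - P) < dl < Rmin P (T - P)) by (apply Rabs_lt_between; auto).
        assert (Hdl0 : dl <> 0) by (intros E; rewrite E, Rabs_R0 in Hv0; lra).
        assert (Ev : v = u + dl + IZR k * T) by (unfold dl; lra).
        destruct (cyl_zero (th u) (Hrange u Hu) Ht) as [E0|EP].
        -- assert (Eu : u = 0) by (rewrite <- (T1 u), E0; apply clock_0).
           destruct (Rlt_dec 0 dl).
           ++ rewrite Ev. apply HNZ; lra.
           (* An instant just before a multiple of [T] belongs to the end of the preceding turn. *)
           ++ replace v with (T + dl + IZR (k - 1) * T) by (rewrite minus_IZR; lra).
              apply HNZ; lra.
        -- assert (Eu : u = P) by (rewrite <- (T1 u), EP; reflexivity).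
           rewrite Ev. apply HNZ; lra.
    + intros t. unfold phi. rewrite !perext_shift by auto. auto.
    (* An earlier return to the initial point would lie on Sigma, hence at angle [PI], where the
       first coordinate is negative whereas it is positive initially. *)
    + intros v Hv E. assert (H0 := Hphi 0%Z 0 ltac:(lra)). rewrite Rmult_0_l, Rplus_0_r, th0 in H0.
      assert (H1 := Hphi 0%Z v ltac:(lra)). rewrite Rmult_0_l, Rplus_0_r in H1.
      rewrite H0, H1 in E.
      assert (EY : p2 (cyl (th v)) = 0) by (rewrite E; unfold cyl, p2; simpl; rewrite sin_0; ring).
      assert (EX : p1 (cyl (th v)) = r 0) by (rewrite E; unfold cyl, p1; simpl; rewrite cos_0; ring).
      destruct (cyl_zero (th v) (Hrange v ltac:(lra)) EY) as [E0|EP].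
      * assert (v = 0) by (rewrite <- (T1 v), E0; apply clock_0). lra.
      * revert EX. unfold cyl, p1; simpl. rewrite EP, cos_PI.
        generalize (orbit_radius PI) (orbit_radius 0); lra.
  - assert (H0 := Hphi 0%Z 0 ltac:(lra)). rewrite Rmult_0_l, Rplus_0_r, th0 in H0. exact H0.
  - intros t. destruct (Hred t) as [k [u [Hu Et]]]. exists (th u). split; [apply Hrange; auto|].
    rewrite Et; auto.
  - intros a Ha. exists (clock a + IZR 0 * T). rewrite Hphi, T2; auto.
    generalize (clock_increasing 0 a) (clock_increasing a (2 * PI)) clock_0; unfold T; lra.
Qed.

(** * Periodic trajectories in a thin tube *)

Section Nearby.
Variables (psi : R -> R3) (S0 del0 : R).
Hypothesis Hpsi : periodic_sol Xp Xm psi S0.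
Hypothesis Hdel0 : 0 < del0 <= rs / 2 /\ del0 <= 1.

Definition px (t : R) : R := p1 (psi t).
Definition py (t : R) : R := p2 (psi t).
Definition pz (t : R) : R := p3 (psi t).
Definition rho (t : R) : R := radius (px t) (py t).
Definition ang (t : R) : R := arg (px t) (py t).
Definition wp (t : R) : R := pz t - f (px t) (py t).
Hypothesis Hrho : forall t, Rabs (rho t - rs) <= del0.
Hypothesis Hwp : forall t, Rabs (wp t) <= del0.

Lemma near_dom t : dom (rho t) (wp t).
Proof.
  generalize (Hrho t) (Hwp t); intros A B. apply Rabs_le_between in A. split; lra.
Qed.

Lemma rho_pos t : 0 < rho t.
Proof. destruct (near_dom t) as [A _]; lra. Qed.

Lemma near_nonzero t : px t <> 0 \/ py t <> 0.
Proof.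
  destruct (Req_dec (px t) 0) as [E|]; auto. destruct (Req_dec (py t) 0) as [E'|]; auto. exfalso.
  generalize (rho_pos t) (radius_sqr (px t) (py t)). fold (rho t). rewrite E, E'. nra.
Qed.

Lemma near_polar t : px t = rho t * cos (ang t) /\ py t = rho t * sin (ang t).
Proof. destruct (arg_polar _ _ (near_nonzero t)) as [A B]. split; symmetry; auto. Qed.

Lemma near_lift t : pz t = lift (ang t) (rho t) (wp t).
Proof.
  unfold lift. destruct (near_polar t) as [<- <-]. unfold wp; ring.
Qed.

Lemma near_continuous t : continuous px t /\ continuous py t /\ continuous pz t.
Proof.
  destruct Hpsi as [[Hc _] _]. destruct (Hc t) as [A [B D]].
  split; [|split]; apply continuity_pt_filterlim; auto.
Qed.

Lemma px_continuous t : continuous px t.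
Proof. exact (proj1 (near_continuous t)). Qed.

Lemma py_continuous t : continuous py t.
Proof. exact (proj1 (proj2 (near_continuous t))). Qed.

Lemma pz_continuous t : continuous pz t.
Proof. exact (proj2 (proj2 (near_continuous t))). Qed.

Lemma rho_continuous t : continuous rho t.
Proof. apply (radius_continuous px py); [apply px_continuous|apply py_continuous]. Qed.

Lemma wp_continuous t : continuous wp t.
Proof.
  apply (@continuous_minus R_UniformSpace R_AbsRing R_NormedModule pz (fun t => f (px t) (py t)));
    [apply pz_continuous|].
  apply (cont2_comp_continuous f px py);
    [apply smooth2_cont2, Hsm|apply px_continuous|apply py_continuous].
Qed.

Lemma near_regular : regular_near (fun t => py t <> 0).
Proof.
  intros t. destruct (Req_dec (py t) 0) as [E|N].
  - destruct Hpsi as [[_ [_ [_ H]]] _]. destruct (H t E) as [_ [d [Hd Hd']]].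
    exists d; split; auto.
  - assert (Hp : 0 < Rabs (py t)) by (apply Rabs_pos_lt; auto).
    destruct (continuous_abs_gt py t 0 (py_continuous t) Hp) as [d [Hd H]].
    exists d; split; auto. intros u [_ Hu] E. specialize (H u Hu). rewrite E, Rabs_R0 in H. lra.
Qed.

Lemma near_side t : py t <> 0 -> exists s, side s (py t) /\
  is_derive px t (vx s e (py t) (pz t)) /\ is_derive py t (vy s e (px t) (pz t)) /\
  is_derive pz t (vz (px t) (py t) (pz t)).
Proof.
  intros Hy. destruct Hpsi as [[_ [Hu [Hl _]]] _].
  destruct (Rlt_dec 0 (py t)) as [P|P].
  - exists true. split; auto. destruct (Hu t P) as [A [B D]].
    destruct (Xp_components (psi t)) as [E1 [E2 E3]]. rewrite E1 in A. rewrite E2 in B. rewrite E3 in D.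
    split; [|split]; apply is_derive_Reals; auto.
  - assert (P' : py t < 0) by lra. exists false. split; auto. destruct (Hl t P') as [A [B D]].
    destruct (Xm_components (psi t)) as [E1 [E2 E3]]. rewrite E1 in A. rewrite E2 in B. rewrite E3 in D.
    split; [|split]; apply is_derive_Reals; auto.
Qed.

(** The cylindrical equations of the rival trajectory off Sigma. The last clause, positive areal
    velocity, serves the covering argument. *)
Lemma near_ode t : py t <> 0 -> exists s, in_side s (ang t) /\
  let sp := speed s e (ang t) (rho t) (wp t) in
  / 2 <= sp /\
  is_derive rho t (sp * (e * Gf s e (ang t) (rho t) (wp t))) /\
  is_derive ang t sp /\
  is_derive wp t (sp * (- wp t + e * Wf s e (ang t) (rho t) (wp t))) /\
  exists dx dy, is_derive px t dx /\ is_derive py t dy /\ 0 < px t * dy - py t * dx.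
Proof.
  intros Hy. destruct (near_side t Hy) as [s [Hs [Dx [Dy Dz]]]].
  exists s. destruct (good_speed _ _ Hg s e (ang t) (rho t) (wp t) He (near_dom t)) as [Hsp _].
  assert (Hn : speed s e (ang t) (rho t) (wp t) <> 0) by lra.
  generalize (rho_pos t); intros Hr.
  destruct (near_polar t) as [Ex Ey]. assert (Ez := near_lift t).
  split.
  { destruct s; unfold side, in_side in *; [apply arg_upper_in|apply arg_lower_in]; auto. }
  cbv zeta. split; [lra|].
  assert (Dr := radius_derive px py t _ _ Hr Dx Dy).
  assert (Da := arg_derive px py t _ _ (py_continuous t) Hy Dx Dy).
  fold (rho t) in Dr, Da.
  assert (Er : (px t * vx s e (py t) (pz t) + py t * vy s e (px t) (pz t)) / rho t =
    speed s e (ang t) (rho t) (wp t) * (e * Gf s e (ang t) (rho t) (wp t))).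
  { rewrite <- polar_radial by auto. rewrite <- Ex, <- Ey, <- Ez. auto. }
  assert (Ea : (px t * vy s e (px t) (pz t) - py t * vx s e (py t) (pz t)) / (rho t * rho t) =
    speed s e (ang t) (rho t) (wp t)).
  { rewrite <- (polar_angular s e (ang t) (rho t) (wp t)) at 1 by auto. rewrite <- Ex, <- Ey, <- Ez. auto. }
  assert (Ew : vz (px t) (py t) (pz t) - (fx (px t) (py t) * vx s e (py t) (pz t) +
      fy (px t) (py t) * vy s e (px t) (pz t)) =
    speed s e (ang t) (rho t) (wp t) * (- wp t + e * Wf s e (ang t) (rho t) (wp t))).
  { rewrite <- polar_vertical by auto. rewrite <- Ex, <- Ey, <- Ez. auto. }
  split; [rewrite <- Er; exact Dr|]. split; [rewrite <- Ea; exact Da|]. split.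
  - rewrite <- Ew.
    apply (@is_derive_minus R_AbsRing R_NormedModule pz (fun t => f (px t) (py t))); auto.
    apply is_derive_Reals. apply (derivable_pt_lim_comp_2d f px py).
    + apply smooth2_differentiable; auto.
    + apply is_derive_Reals; auto.
    + apply is_derive_Reals; auto.
  - exists (vx s e (py t) (pz t)), (vy s e (px t) (pz t)). split; auto. split; auto.
    apply Rmult_lt_reg_r with (/ (rho t * rho t)); [apply Rinv_0_lt_compat; nra|].
    rewrite Rmult_0_l.
    change (0 < (px t * vy s e (px t) (pz t) - py t * vx s e (py t) (pz t)) / (rho t * rho t)).
    rewrite Ea. lra.
Qed.

Lemma ang_in t : 0 <= ang t < 2 * PI.
Proof.
  generalize PI_RGT_0; intros HPI. unfold ang.
  destruct (Rtotal_order (py t) 0) as [H|[H|H]].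
  - generalize (arg_lower_in (px t) (py t) H); lra.
  - rewrite H. destruct (near_nonzero t) as [N|N]; [|contradiction].
    destruct (Rlt_dec 0 (px t)); [rewrite arg_right|rewrite arg_left]; lra.
  - generalize (arg_upper_in (px t) (py t) H); lra.
Qed.

Variables (K' kap d : R).
Hypothesis He0 : e <> 0.
Hypothesis HAd : J Af (2 * PI) = d.
Hypothesis HK' : 0 < K'.
Hypothesis HAb : forall s t, Rabs (Af s t) <= K'.
Hypothesis Hkap : 0 <= kap.
Hypothesis Hlin : forall s t r r' w w',
  Rabs (r - rs) <= del0 -> Rabs (r' - rs) <= del0 -> Rabs w <= del0 -> Rabs w' <= del0 ->
  Rabs (Gf s e t r w - Gf s e t r' w' - Af s t * (r - r')) <= kap * Rabs (r - r') + K' * Rabs (w - w').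
Hypothesis HeC : Rabs e * C <= del0.
(** Over one turn the integral of [Af] is at most [2 * PI * K'] and the subtracted linear term at
    most [Rabs d]; the 1 makes the bound positive. *)
Definition bound_B : R := 2 * PI * K' + Rabs d + 1.
Hypothesis Hs1 : Rabs e * (K + K') <= / 2.
Hypothesis Hs2 : Rabs e * bound_B <= / 8.
Hypothesis Hs3 : kap + 2 * Rabs e * (K + K') * (K + K') + 2 * Rabs e * bound_B * (K + K')
  < Rabs (d / (2 * PI)) / 2.

(** Removing the mean of [Af] makes the values at 0 and [2 * PI] equal, so that the composition with
    the jumping angle [ang] stays continuous and periodic in time. *)
Definition corrector (t : R) : R := J Af t + - (d / (2 * PI)) * t.

Lemma corrector_periodic : corrector (2 * PI) = corrector 0.
Proof.
  unfold corrector. rewrite HAd, J_0. generalize PI_RGT_0; intros. field. lra.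
Qed.

Lemma corrector_continuous t : continuous corrector t.
Proof.
  apply (@continuous_plus R_UniformSpace R_AbsRing R_NormedModule (J Af)).
  - apply J_continuous, Af_continuous.
  - apply (continuous_const_mult (fun t => t)). apply continuous_id.
Qed.

Lemma corrector_bound t : 0 <= t <= 2 * PI -> Rabs (corrector t) <= bound_B.
Proof.
  intros Ht. generalize PI_RGT_0; intros HPI. unfold corrector, bound_B.
  apply Rle_trans with (1 := Rabs_triang _ _).
  assert (B := J_bound Af Af_continuous K' t HAb). rewrite (Rabs_pos_eq t) in B by lra.
  assert (B1 : K' * t <= 2 * PI * K') by nra.
  rewrite Rabs_mult, Rabs_Ropp, (Rabs_pos_eq t) by lra.
  unfold Rdiv. rewrite Rabs_mult, Rabs_inv, (Rabs_pos_eq (2 * PI)) by lra.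
  assert (Rabs d * / (2 * PI) * t <= Rabs d).
  { apply Rle_trans with (Rabs d * / (2 * PI) * (2 * PI)); [|right; field; lra].
    apply Rmult_le_compat_l; [|lra]. apply Rmult_le_pos; [apply Rabs_pos|].
    left; apply Rinv_0_lt_compat; lra. }
  lra.
Qed.

Lemma corrector_derive s t : in_side s t -> is_derive corrector t (Af s t - d / (2 * PI)).
Proof.
  intros Hs. apply (@is_derive_plus R_AbsRing R_NormedModule (J Af) (fun t => - (d / (2 * PI)) * t)).
  - destruct s; unfold in_side in Hs; [apply J_derive_lt|apply J_derive_gt]; try lra; apply Af_continuous.
  - apply is_derive_Reals, derivable_pt_lim_mul_const.
Qed.

Lemma nearby_coincides t : rho t = r (ang t) /\ wp t = w (ang t).
Proof.
  destruct Hpsi as [_ [HS [Hper _]]].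
  assert (Px : forall t, px (t + S0) = px t) by (intros u; unfold px; rewrite Hper; auto).
  assert (Py : forall t, py (t + S0) = py t) by (intros u; unfold py; rewrite Hper; auto).
  assert (Pz : forall t, pz (t + S0) = pz t) by (intros u; unfold pz; rewrite Hper; auto).
  (* Functions of the angle with equal values at 0 and [2 * PI] do not see the jump of [ang]; this
     applies to [r], [w] and [corrector]. *)
  assert (Cg : forall g : R -> R, (forall t, continuous g t) -> g (2 * PI) = g 0 ->
    forall t, continuous (fun t => g (ang t)) t).
  { intros g Cg Pg u.
    exact (arg_comp_continuous g px py u Cg Pg (px_continuous u) (py_continuous u) (near_nonzero u)). }
  generalize (good_K _ _ Hg); intros HK.
  assert (H : rho t - r (ang t) = 0 /\ wp t - w (ang t) = 0).
  { apply (averaging_rigidity (fun t => rho t - r (ang t)) (fun t => wp t - w (ang t))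
      (fun t => corrector (ang t)) (fun t => py t <> 0) S0 e (d / (2 * PI)) (K + K') bound_B kap); auto.
    - lra.
    - unfold bound_B. generalize PI_RGT_0 (Rabs_pos d); nra.
    - intros u. apply (@continuous_minus R_UniformSpace R_AbsRing R_NormedModule rho (fun t => r (ang t)));
        [apply rho_continuous|].
      apply Cg; [apply (orbit_r _ _ _ _ Ho)|apply (orbit_per_r _ _ _ _ Ho)].
    - intros u. apply (@continuous_minus R_UniformSpace R_AbsRing R_NormedModule wp (fun t => w (ang t)));
        [apply wp_continuous|].
      apply Cg; [apply (orbit_w _ _ _ _ Ho)|apply (orbit_per_w _ _ _ _ Ho)].
    - apply Cg; [apply corrector_continuous|apply corrector_periodic].
    - intros u. unfold rho, ang. rewrite Px, Py. auto.
    - intros u. unfold wp, ang. rewrite Px, Py, Pz. auto.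
    - intros u. unfold ang. rewrite Px, Py. auto.
    - intros u. apply corrector_bound. generalize (ang_in u); lra.
    - apply near_regular.
    - intros u Hu. destruct (near_ode u Hu) as [s [Hs [Hsp [Dr [Da [Dw _]]]]]].
      set (sp := speed s e (ang u) (rho u) (wp u)) in *.
      destruct (orbit_ode _ _ _ _ Ho s (ang u) Hs) as [Or Ow].
      set (a := ang u) in *.
      exists sp, (Af s a), (Gf s e a (rho u) (wp u) - Gf s e a (r a) (w a)),
        (Wf s e a (rho u) (wp u) - Wf s e a (r a) (w a)).
      assert (Dm := near_dom u). assert (Dm' := orbit_dom _ _ _ _ Ho a).
      split; [lra|]. split; [|split; [|split; [|split; [|split]]]].
      + replace (sp * (e * (Gf s e a (rho u) (wp u) - Gf s e a (r a) (w a)))) with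
          (sp * (e * Gf s e a (rho u) (wp u)) - sp * (e * Gf s e a (r a) (w a))) by ring.
        apply (@is_derive_minus R_AbsRing R_NormedModule rho (fun t => r (ang t))); auto.
        apply (is_derive_comp r ang); auto.
      + replace (sp * (- (wp u - w a) + e * (Wf s e a (rho u) (wp u) - Wf s e a (r a) (w a)))) with
          (sp * (- wp u + e * Wf s e a (rho u) (wp u)) - sp * (- w a + e * Wf s e a (r a) (w a))) by ring.
        apply (@is_derive_minus R_AbsRing R_NormedModule wp (fun t => w (ang t))); auto.
        apply (is_derive_comp w ang); auto.
      + apply (is_derive_comp corrector ang); auto. apply corrector_derive; auto.
      + assert (B := Hlin s a (rho u) (r a) (wp u) (w a) (Hrho u)
          (Rle_trans _ _ _ (orbit_near_r _ _ _ _ Ho a) HeC) (Hwp u)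
          (Rle_trans _ _ _ (orbit_near_w _ _ _ _ Ho a) HeC)).
        apply Rle_trans with (1 := B). apply Rplus_le_compat_l, Rmult_le_compat_r; [apply Rabs_pos|lra].
      + destruct (good_G _ _ Hg s e He a (rho u) (wp u) a (r a) (w a) Dm Dm') as [_ B].
        apply Rle_trans with (1 := B). rewrite Rminus_eq_0, Rabs_R0, Rplus_0_l.
        apply Rmult_le_compat_r; [|lra]. generalize (Rabs_pos (rho u - r a)) (Rabs_pos (wp u - w a)); lra.
      + destruct (good_W _ _ Hg s e He a (rho u) (wp u) a (r a) (w a) Dm Dm') as [_ B].
        apply Rle_trans with (1 := B). rewrite Rminus_eq_0, Rabs_R0, Rplus_0_l.
        apply Rmult_le_compat_r; [|lra]. generalize (Rabs_pos (rho u - r a)) (Rabs_pos (wp u - w a)); lra. }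
  destruct H; split; lra.
Qed.

Lemma nearby_on_cycle t : psi t = cyl (ang t).
Proof.
  destruct (near_polar t) as [Ex Ey]. assert (Ez := near_lift t).
  destruct (nearby_coincides t) as [E1 E2].
  transitivity ((px t, py t, pz t) : R3).
  - unfold px, py, pz, p1, p2, p3. destruct (psi t) as [[x y] z]; reflexivity.
  - unfold cyl. rewrite <- E1, <- E2, <- Ex, <- Ey, <- Ez. reflexivity.
Qed.

(** Lying on the cycle gives one inclusion between the two curves; the other needs the rival to meet
    every half-line, which its steady rotation ensures. *)
Lemma nearby_covers a : 0 <= a < 2 * PI -> exists t, cyl a = psi t.
Proof.
  intros Ha. destruct Hpsi as [_ [HS [Hper _]]].
  destruct (rotating_curve_covers px py S0 a) as [t [Ex Ey]]; auto.
  - apply px_continuous.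
  - apply py_continuous.
  - intros u; unfold px; rewrite Hper; auto.
  - intros u; unfold py; rewrite Hper; auto.
  - apply near_nonzero.
  - intros u. destruct (near_regular u) as [dl [Hdl H]]. exists dl; split; auto.
    intros v Hv. destruct (near_ode v (H v Hv)) as [s [_ [_ [_ [_ [_ Q]]]]]]. exact Q.
  - exists t. rewrite nearby_on_cycle. f_equal. fold (rho t) in Ex, Ey.
    destruct (near_polar t) as [Ex' Ey']. generalize (rho_pos t); intros Hr.
    apply polar_angle_unique; auto using ang_in.
    + apply Rmult_eq_reg_l with (rho t); lra.
    + apply Rmult_eq_reg_l with (rho t); lra.
Qed.
End Nearby.

Lemma dist3_components p q : radius (p1 p - p1 q) (p2 p - p2 q) <= dist3 p q /\
  Rabs (p3 p - p3 q) <= dist3 p q.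
Proof.
  unfold dist3, radius. split.
  - apply sqrt_le_1_alt. generalize (pow2_ge_0 (p3 p - p3 q)); lra.
  - rewrite <- sqrt_Rsqr_abs. apply sqrt_le_1_alt. unfold Rsqr.
    generalize (pow2_ge_0 (p1 p - p1 q)) (pow2_ge_0 (p2 p - p2 q)); lra.
Qed.

Lemma dist3_le_sum p q :
  dist3 p q <= Rabs (p1 p - p1 q) + Rabs (p2 p - p2 q) + Rabs (p3 p - p3 q).
Proof.
  unfold dist3. set (a := p1 p - p1 q). set (b := p2 p - p2 q). set (c := p3 p - p3 q).
  generalize (Rabs_pos a) (Rabs_pos b) (Rabs_pos c); intros.
  rewrite <- (sqrt_square (Rabs a + Rabs b + Rabs c)) by lra.
  apply sqrt_le_1_alt.
  rewrite <- (pow2_abs a), <- (pow2_abs b), <- (pow2_abs c).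
  generalize (Rmult_le_pos (Rabs a) (Rabs b)) (Rmult_le_pos (Rabs a) (Rabs c))
    (Rmult_le_pos (Rabs b) (Rabs c)); intros; lra.
Qed.

(** Converts Euclidean distance to the cycle into bounds on [rho] and [wp]. In [1 + 2 * L], the 1
    accounts for the height and [2 * L] for the change of [f] under displacements of at most [del]
    in each of [x] and [y]; the other half of [del0] is taken by the cycle itself. *)
Lemma tube_near (L del0 del : R) (psi : R -> R3) : 0 <= L -> box_lip f (2 * rs) L ->
  0 < del0 <= rs / 2 -> Rabs e * C <= del0 / 2 -> 0 < del -> del * (1 + 2 * L) <= del0 / 2 ->
  (forall t, exists th, dist3 (psi t) (cyl th) < del) ->
  forall t, Rabs (rho psi t - rs) <= del0 /\ Rabs (wp psi t) <= del0.
Proof.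
  intros HL HB Hd0 HeC Hdel Hdl Htube t. destruct (Htube t) as [th Hth].
  destruct (dist3_components (psi t) (cyl th)) as [D1 D2].
  assert (Ec : radius (p1 (cyl th)) (p2 (cyl th)) = r th).
  { unfold cyl, p1, p2; simpl. apply radius_polar. generalize (orbit_radius th); lra. }
  generalize (radius_lip (px psi t) (py psi t) (p1 (cyl th)) (p2 (cyl th))). rewrite Ec.
  fold (rho psi t). intros D3. fold (px psi t) (py psi t) in D1. fold (pz psi t) in D2.
  generalize (orbit_near_r _ _ _ _ Ho th) (orbit_near_w _ _ _ _ Ho th); intros N1 N2.
  assert (Hdl' : del <= del0 / 2) by (generalize (Rmult_le_pos del L); lra).
  assert (R1 : Rabs (rho psi t - rs) <= del0).
  { replace (rho psi t - rs) with ((rho psi t - r th) + (r th - rs)) by ring.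
    apply Rle_trans with (1 := Rabs_triang _ _). lra. }
  split; auto.
  destruct (Rabs_le_radius (px psi t) (py psi t)) as [B1 B2]. fold (rho psi t) in B1, B2.
  destruct (Rabs_le_radius (p1 (cyl th)) (p2 (cyl th))) as [B3 B4]. rewrite Ec in B3, B4.
  destruct (Rabs_le_radius (px psi t - p1 (cyl th)) (py psi t - p2 (cyl th))) as [B5 B6].
  apply Rabs_le_between in R1. destruct (orbit_dom _ _ _ _ Ho th) as [Q _].
  destruct (HB (px psi t) (py psi t) (p1 (cyl th)) (p2 (cyl th))) as [_ E]; try lra.
  unfold wp.
  replace (pz psi t - f (px psi t) (py psi t)) with
    ((pz psi t - p3 (cyl th)) + (w th + - (f (px psi t) (py psi t) - f (p1 (cyl th)) (p2 (cyl th)))))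
    by (unfold cyl, p1, p2, p3, lift; simpl; ring).
  apply Rle_trans with (1 := Rabs_triang _ _).
  generalize (Rabs_triang (w th) (- (f (px psi t) (py psi t) - f (p1 (cyl th)) (p2 (cyl th))))).
  rewrite Rabs_Ropp. intros T1.
  assert (E' : L * (Rabs (px psi t - p1 (cyl th)) + Rabs (py psi t - p2 (cyl th))) <= L * (del + del))
    by (apply Rmult_le_compat_l; lra).
  lra.
Qed.

(** The two planar displacements and [w] are each at most [Rabs e * C], and the planar ones enter
    again through [f] with factor [L]; hence [3 + 2 * L]. *)
Lemma cyl_near_circle (L : R) : 0 <= L -> box_lip f (2 * rs) L ->
  forall t, dist3 (cyl t) (circ f rs t) <= (3 + 2 * L) * C * Rabs e.
Proof.
  intros HL HB t. apply Rle_trans with (1 := dist3_le_sum _ _).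
  unfold cyl, circ, p1, p2, p3, lift; simpl.
  generalize (orbit_near_r _ _ _ _ Ho t) (orbit_near_w _ _ _ _ Ho t); intros N1 N2.
  destruct (orbit_dom _ _ _ _ Ho t) as [Q _].
  assert (X : Rabs (r t * cos t - rs * cos t) <= Rabs e * C).
  { rewrite <- Rmult_minus_distr_r, Rabs_mult.
    generalize (Rabs_cos_le t) (Rabs_pos (r t - rs)) (Rabs_pos (cos t)); nra. }
  assert (Y : Rabs (r t * sin t - rs * sin t) <= Rabs e * C).
  { rewrite <- Rmult_minus_distr_r, Rabs_mult.
    generalize (Rabs_sin_le t) (Rabs_pos (r t - rs)) (Rabs_pos (sin t)); nra. }
  destruct (polar_in_box (rs / 2) (2 * rs) ltac:(lra) (r t) t Q) as [B1 B2].
  destruct (polar_in_box (rs / 2) (2 * rs) ltac:(lra) rs t ltac:(lra)) as [B3 B4].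
  destruct (HB _ _ _ _ B1 B2 B3 B4) as [_ E].
  assert (Z : Rabs (w t + f (r t * cos t) (r t * sin t) - f (rs * cos t) (rs * sin t)) <=
    Rabs e * C + L * (Rabs e * C + Rabs e * C)).
  { unfold Rminus. rewrite Rplus_assoc. apply Rle_trans with (1 := Rabs_triang _ _).
    apply Rplus_le_compat; auto. apply Rle_trans with (1 := E). apply Rmult_le_compat_l; lra. }
  lra.
Qed.

Theorem cycle_isolated (L del0 K' kap d : R) : 0 <= L -> box_lip f (2 * rs) L ->
  0 < del0 <= rs / 2 -> del0 <= 1 -> Rabs e * C <= del0 / 2 ->
  e <> 0 -> J Af (2 * PI) = d -> 0 < K' -> (forall s t, Rabs (Af s t) <= K') -> 0 <= kap ->
  (forall s t r r' w w',
    Rabs (r - rs) <= del0 -> Rabs (r' - rs) <= del0 -> Rabs w <= del0 -> Rabs w' <= del0 ->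
    Rabs (Gf s e t r w - Gf s e t r' w' - Af s t * (r - r')) <= kap * Rabs (r - r') + K' * Rabs (w - w')) ->
  Rabs e * (K + K') <= / 2 -> Rabs e * bound_B K' d <= / 8 ->
  kap + 2 * Rabs e * (K + K') * (K + K') + 2 * Rabs e * bound_B K' d * (K + K')
    < Rabs (d / (2 * PI)) / 2 ->
  exists (phi : R -> R3) (T : R), crossing_limit_cycle Xp Xm phi T /\
    Rabs (T - 2 * PI) <= 4 * PI * K * Rabs e /\ phi 0 = cyl 0 /\
    (forall t, exists th, 0 <= th < 2 * PI /\ phi t = cyl th) /\
    (forall th, 0 <= th < 2 * PI -> exists t, phi t = cyl th).
Proof.
  intros HL HB Hd0 Hd1 HeC He0 HJ HK' HA Hkap Hlin S1 S2 S3.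
  destruct cycle_exists as [phi [T [Hper [HT [H0 [Hto Hfrom]]]]]].
  exists phi, T. split; [|split; [exact HT|split; [exact H0|split; [exact Hto|exact Hfrom]]]].
  split; [exact Hper|]. split.
  - exists 0. rewrite H0. unfold cyl, p2; simpl. rewrite sin_0; ring.
  - assert (Hden : 0 < 2 * (1 + 2 * L)) by lra.
    exists (del0 / (2 * (1 + 2 * L))). split; [apply Rdiv_lt_0_compat; lra|].
    intros psi S0 Hpsi Htube.
    assert (Hnear : forall t, Rabs (rho psi t - rs) <= del0 /\ Rabs (wp psi t) <= del0).
    { apply (tube_near L del0 (del0 / (2 * (1 + 2 * L)))); auto.
      - apply Rdiv_lt_0_compat; lra.
      - right; field; lra.
      - intros t. destruct (Htube t) as [u Hu]. destruct (Hto u) as [th [_ E]].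
        exists th. rewrite <- E. auto. }
    assert (Hrho : forall t, Rabs (rho psi t - rs) <= del0) by (intros; apply Hnear).
    assert (Hwp : forall t, Rabs (wp psi t) <= del0) by (intros; apply Hnear).
    assert (HeC' : Rabs e * C <= del0) by lra.
    assert (Hd01 : 0 < del0 <= rs / 2 /\ del0 <= 1) by auto.
    split.
    + intros t. destruct (Hfrom (ang psi t)) as [u Hu]; [apply (ang_in psi del0); auto|].
      exists u. rewrite Hu.
      exact (nearby_on_cycle psi S0 del0 Hpsi Hd01 Hrho Hwp K' kap d He0 HJ HK' HA Hkap Hlin HeC'
        S1 S2 S3 t).
    + intros u. destruct (Hto u) as [th [Hth ->]]. 
      destruct (nearby_covers psi S0 del0 Hpsi Hd01 Hrho Hwp K' kap d He0 HJ HK' HA Hkap Hlin HeC'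
        S1 S2 S3 th Hth) as [t Ht]. exists t. exact Ht.
Qed.
End Cycle.

(** * Choice of the constants and conclusion *)

Lemma circ_periodic t : circ f rs (t + 2 * PI) = circ f rs t.
Proof.
  unfold circ.
  rewrite cos_plus, sin_plus, cos_2PI, sin_2PI, !Rmult_1_r, !Rmult_0_r, Rminus_0_r, Rplus_0_r. auto.
Qed.

Theorem limit_cycles (F1 : R -> R) (d : R) : is_f1 f a1 b1 F1 -> F1 rs = 0 ->
  derivable_pt_lim F1 rs d -> d <> 0 ->
  exists e0 M, 0 < e0 /\ 0 < M /\ forall e, 0 < Rabs e < e0 -> exists (phi : R -> R3) (T : R),
    crossing_limit_cycle (Xplus f fx fy a0 a1 a2 a3 e) (Xminus f fx fy b1 b2 b3 e) phi T /\
    Rabs (T - 2 * PI) <= M * Rabs e /\ dist3 (phi 0) (rs, 0, f rs 0) <= M * Rabs e /\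
    (forall t, exists th, dist3 (phi t) (circ f rs th) <= M * Rabs e) /\
    (forall th, exists t, dist3 (phi t) (circ f rs th) <= M * Rabs e).
Proof.
  intros HF H0 Hder Hd. generalize PI_RGT_0; intros HPI.
  destruct good_exists as [e1 [K Hg]].
  assert (HK := good_K _ _ Hg). assert (He1 := good_e1 _ _ Hg).
  destruct (Gf_linear e1 K Hg) as [K' [HK' [HA Hlin]]].
  destruct box_constant as [L [HL [HB _]]].
  destruct (orbit_exists e1 K F1 d Hg HF H0 Hder Hd) as [e2 [C [He2 [HC Horb]]]].
  set (Ab := Rabs (d / (2 * PI))).
  assert (HAb : 0 < Ab).
  { apply Rabs_pos_lt. unfold Rdiv. apply Rmult_integral_contrapositive_currified; auto.
    apply Rinv_neq_0_compat; lra. }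
  (* The rigidity argument allows errors below [Ab / 2]: the linearization takes [Ab / 8], and the
     terms proportional to [e] will take at most [Ab / 4]. *)
  destruct (Hlin (Ab / 8) ltac:(lra)) as [del0 [[D1 D2] [D3 Hl]]].
  set (Kb := K + K'). set (BB := bound_B K' d).
  assert (HBB : 0 < BB) by (unfold BB, bound_B; generalize (Rabs_pos d); nra).
  assert (HKb : 0 < Kb) by (unfold Kb; lra).
  (* The sum of all coefficients that are multiplied by [Rabs e] in the smallness conditions; the
     single bound [Rabs e * Q <= m] then implies each of them. *)
  set (Q := K + C + Kb + BB + 2 * Kb * Kb + 2 * BB * Kb).
  assert (P1 : 0 < 2 * Kb * Kb) by nra. assert (P2 : 0 < 2 * BB * Kb) by nra.
  assert (HQ : 0 < Q) by (unfold Q; lra).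
  set (m := Rmin (Rmin (rs / 4) (del0 / 2)) (Rmin (/ 8) (Ab / 4))).
  assert (Hm : 0 < m) by (repeat apply Rmin_pos; lra).
  assert (M1 : m <= rs / 4) by (eapply Rle_trans; [apply Rmin_l|apply Rmin_l]).
  assert (M2 : m <= del0 / 2) by (eapply Rle_trans; [apply Rmin_l|apply Rmin_r]).
  assert (M3 : m <= / 8) by (eapply Rle_trans; [apply Rmin_r|apply Rmin_l]).
  assert (M4 : m <= Ab / 4) by (eapply Rle_trans; [apply Rmin_r|apply Rmin_r]).
  set (e0 := Rmin (Rmin e2 del0) (m / Q)).
  assert (He0 : 0 < e0) by (repeat apply Rmin_pos; auto; apply Rdiv_lt_0_compat; auto).
  set (M := 4 * PI * K + (3 + 2 * L) * C).
  assert (HM1 : 0 < 4 * PI * K) by nra. assert (HM2 : 0 < (3 + 2 * L) * C) by nra.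
  exists e0, M. split; auto. split; [unfold M; lra|].
  intros e [Hep He].
  assert (E1 : Rabs e < e2)
    by (eapply Rlt_le_trans; [exact He|]; eapply Rle_trans; [apply Rmin_l|apply Rmin_l]).
  assert (E2 : Rabs e < del0)
    by (eapply Rlt_le_trans; [exact He|]; eapply Rle_trans; [apply Rmin_l|apply Rmin_r]).
  assert (E3 : Rabs e * Q <= m).
  { apply Rle_trans with (m / Q * Q); [|right; field; lra].
    apply Rmult_le_compat_r; [lra|]. left; eapply Rlt_le_trans; [exact He|apply Rmin_r]. }
  assert (Hq : forall q, q <= Q -> Rabs e * q <= m).
  { intros q Hq. apply Rle_trans with (2 := E3). apply Rmult_le_compat_l; lra. }
  destruct (Horb e ltac:(lra)) as [r [w Ho]].
  assert (Hee : e <> 0) by (intros E; rewrite E, Rabs_R0 in Hep; lra).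
  destruct (cycle_isolated e1 K C e r w Hg) with (L := L) (del0 := del0) (K' := K') (kap := Ab / 8) (d := d)
    as [phi [T [Hcyc [HT [Hphi0 [Hto Hfrom]]]]]]; auto; try lra.
  - assert (X := Hq K ltac:(unfold Q; lra)). lra.
  - assert (X := Hq C ltac:(unfold Q; lra)). lra.
  - apply (averaged_derivative F1); auto.
  - intros s t ra rb wa wb B1 B2 B3 B4. apply Hl; auto; lra.
  - assert (X := Hq Kb ltac:(unfold Q; lra)). unfold Kb in X. lra.
  - assert (X := Hq BB ltac:(unfold Q; lra)). unfold BB in X. lra.
  - assert (X := Hq (2 * Kb * Kb + 2 * BB * Kb) ltac:(unfold Q; lra)).
    fold Kb BB Ab. lra.
  - assert (Hclose : forall t, dist3 (cyl r w t) (circ f rs t) <= M * Rabs e).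
    { intros t. apply Rle_trans with (1 := cyl_near_circle C e r w Ho L HL HB t).
      apply Rmult_le_compat_r; unfold M; lra. }
    exists phi, T. split; [exact Hcyc|]. split; [|split; [|split]].
    + apply Rle_trans with (1 := HT). apply Rmult_le_compat_r; unfold M; lra.
    + rewrite Hphi0. replace ((rs, 0, f rs 0) : R3) with (circ f rs 0); [apply Hclose|].
      unfold circ. rewrite cos_0, sin_0, Rmult_1_r, Rmult_0_r. reflexivity.
    + intros t. destruct (Hto t) as [th [_ ->]]. exists th. apply Hclose.
    + intros th. destruct (floor_multiple (2 * PI) th) as [k Hk]; [lra|].
      destruct (Hfrom (th - IZR k * (2 * PI))) as [t Ht]; [lra|]. exists t. rewrite Ht.
      replace th with ((th - IZR k * (2 * PI)) + IZR k * (2 * PI)) at 2 by ring.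
      rewrite (periodic_Z (circ f rs) (2 * PI) circ_periodic). apply Hclose.
Qed.
End Field.

Theorem mainTheorem7
  (f fx fy : R -> R -> R) (a0 a1 a2 a3 b1 b2 b3 : R) (F1 : R -> R) (rs : R)
  (Hsm : smooth2 f) (Hfx : is_dx f fx) (Hfy : is_dy f fy)
  (HF1 : is_f1 f a1 b1 F1)
  (Hrs : 0 < rs) (Hzero : F1 rs = 0)
  (Hder : exists d, derivable_pt_lim F1 rs d /\ d <> 0) :
  exists (C e0 : R) (phi : R -> R -> R3) (T : R -> R),
    0 < e0 /\
    (forall e, 0 < Rabs e < e0 ->
       crossing_limit_cycle (Xplus f fx fy a0 a1 a2 a3 e) (Xminus f fx fy b1 b2 b3 e)
         (phi e) (T e) /\
       Rabs (T e - 2 * PI) <= C * Rabs e /\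
       dist3 (phi e 0) (rs, 0, f rs 0) <= C * Rabs e) /\
    (forall eta, 0 < eta -> exists del, 0 < del /\
       forall e, 0 < Rabs e < Rmin del e0 ->
         (forall t, exists th, dist3 (phi e t) (circ f rs th) < eta) /\
         (forall th, exists t, dist3 (phi e t) (circ f rs th) < eta)).
Proof.
  destruct Hder as [d [Hd Hd0]].
  destruct (limit_cycles f fx fy a0 a1 a2 a3 b1 b2 b3 rs Hsm Hfx Hfy Hrs F1 d HF1 Hzero Hd Hd0)
    as [e0 [M [He0 [HM H]]]].
  (* To choose cycle and period as functions of [e], existence is extended to every [e]; outside the
     range the constant curve with period 0 is a dummy satisfying the implication vacuously. *)
  assert (H' : forall e, exists c : (R -> R3) * R, 0 < Rabs e < e0 ->
    crossing_limit_cycle (Xplus f fx fy a0 a1 a2 a3 e) (Xminus f fx fy b1 b2 b3 e) (fst c) (snd c) /\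
    Rabs (snd c - 2 * PI) <= M * Rabs e /\ dist3 (fst c 0) (rs, 0, f rs 0) <= M * Rabs e /\
    (forall t, exists th, dist3 (fst c t) (circ f rs th) <= M * Rabs e) /\
    (forall th, exists t, dist3 (fst c t) (circ f rs th) <= M * Rabs e)).
  { intros e. destruct (Rlt_dec 0 (Rabs e)) as [P|P]; [destruct (Rlt_dec (Rabs e) e0) as [P'|P']|].
    - destruct (H e (conj P P')) as [phi [T HT]]. exists (phi, T). intros _. exact HT.
    - exists (fun _ => (0, 0, 0), 0). lra.
    - exists (fun _ => (0, 0, 0), 0). lra. }
  set (c := fun e => proj1_sig (constructive_indefinite_description _ (H' e))).
  assert (Hc := fun e => proj2_sig (constructive_indefinite_description _ (H' e))).
  exists M, e0, (fun e => fst (c e)), (fun e => snd (c e)). split; [exact He0|]. split.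
  - intros e He. destruct (Hc e He) as [A [B [D _]]]. split; [exact A|]. split; [exact B|exact D].
  (* Convergence to the circle orbit holds with the linear rate [M * Rabs e], so this threshold
     makes the distance smaller than [eta]. *)
  - intros eta Heta. exists (eta / M). split; [apply Rdiv_lt_0_compat; auto|].
    intros e [Hp He].
    assert (E1 : Rabs e < e0) by (eapply Rlt_le_trans; [exact He|apply Rmin_r]).
    assert (E2 : Rabs e < eta / M) by (eapply Rlt_le_trans; [exact He|apply Rmin_l]).
    assert (E3 : M * Rabs e < eta).
    { apply Rlt_le_trans with (M * (eta / M)); [apply Rmult_lt_compat_l; auto|right; field; lra]. }
    destruct (Hc e (conj Hp E1)) as [_ [_ [_ [A B]]]]. split.
    + intros t. destruct (A t) as [th Hth]. exists th. apply Rle_lt_trans with (1 := Hth), E3.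
    + intros th. destruct (B th) as [t Ht]. exists t. apply Rle_lt_trans with (1 := Ht), E3.
Qed.
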